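(* Let $\varphi$ be a primitive, aperiodic substitution on a finite alphabet $\mathcal{A}$ with $d$ letters, let $A$ be its transition matrix and $\mathcal{T}_\varphi$ its tiling space. Let $S$ be the transition complex of $\varphi$ and $ER\subseteq S$ the eventual range, as defined in the context; let $k$ be the number of connected components of $ER$ and let $l$ be the number of independent $1$-cycles in $ER$ (the asymptotic cycle rank of $\varphi$). Then the first integral Čech cohomology group of $\mathcal{T}_\varphi$ satisfies $$\check{H}^1(\mathcal{T}_\varphi)\;\simeq\;\mathbb{Z}^l\oplus\Big(\varinjlim A^t\Big)/G$$ for some subgroup $G$ of $\varinjlim A^t$ with $G\simeq\mathbb{Z}^{k-1}$.
   Context: **Substitutions.** A substitution on $\mathcal{A}=\{1,\dots,d\}$ is a map $\varphi:\mathcal{A}\to\mathcal{A}^*$ into finite nonempty words, extended to words by concatenation. Its transition matrix is $A=(a_{ij})$, where $a_{ij}$ is the number of occurrences of $i$ in $\varphi(j)$. $\varphi$ is primitive if for all sufficiently large $n$ every $\varphi^n(i)$ contains every letter $j$. A (finite or bi-infinite) word is allowed if each of its finite factors is a factor of some $\varphi^n(i)$, $i\in\mathcal{A}$, $n\in\mathbb{N}$; $\mathcal{L}$ is the set of finite allowed words. An allowed bi-infinite word $w=\dots w_{-1}.w_0w_1\dots$ is $\varphi$-periodic if $\varphi^m(w)=\dots\varphi^m(w_{-1}).\varphi^m(w_0)\dots=w$ for some $m\geq 1$. A primitive $\varphi$ is aperiodic if at least one (equivalently, each) $\varphi$-periodic bi-infinite word is not periodic under the shift. **Tiling space.** Let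 $\lambda$ be the Perron–Frobenius eigenvalue of $A$ and $(\omega_1,\dots,\omega_d)$ a positive left eigenvector for it. The prototiles are $P_i=[0,\omega_i]$, labelled by $i$ (so $P_i$ and $P_j$ are distinct for $i\neq j$ even if $\omega_i=\omega_j$). A tiling is a collection $T=\{T_i\}_{i\in\mathbb{Z}}$ of labelled translates of prototiles with union $\mathbb{R}$ such that $T_i\cap T_{i+1}$ is a singleton for each $i$, indexed left to right so that $0\in T_0\setminus T_1$. Its word $\underline{w}(T)=\dots w_{-1}w_0w_1\dots$ has $w_i=j$ iff $T_i$ is a translate of $P_j$. $\mathcal{T}_\varphi$ is the set of tilings whose word is allowed. Topology: $T,T'$ are close if, for some $\epsilon$ near $0$, $T$ and $T'+\epsilon$ are identical in a large neighborhood of $0$; this is compact and metrizable. **Transition complex.** Fix $\epsilon=\min_{a}\omega_a/(2\lambda)>0$. For $a\in\mathcal{A}$ let $e_a=[\epsilon,\omega_a-\epsilon]\times\{a\}$ and for each two-letter word $ab\in\mathcal{L}$ let $e_{ab}=[-\epsilon,\epsilon]\times\{ab\}$. Let $K=[(\bigcup_a e_a)\cup(\bigcup_{ab\in\mathcal{L}}e_{ab})]/\sim$, where $\sim$ is generated by $(\omega_a-\epsilon,a)\sim(-\epsilon,ab)$ and $(\epsilon,b)\sim(\epsilon,ab)$ for all $ab\in\mathcal{L}$. Let $S\subseteq K$ be the image of $\bigcup_{ab\in\mathcal{L}}e_{ab}$. (Thus $S$ is a finite graph with one edge for each allowed two-letter word; $e_{ab}$ and $e_{ab'}$ share their left endpoint,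 and $e_{ab}$ and $e_{a'b}$ share their right endpoint.) **Eventual range.** Let $g|_S:S\to S$ be the map sending $e_{ab}$ onto $e_{cd}$ by $[(x,ab)]\mapsto[(x,cd)]$, where $c$ is the last letter of $\varphi(a)$ and $d$ is the first letter of $\varphi(b)$. Then $ER=\bigcap_{n\ge0}(g|_S)^n(S)$, a subgraph of $S$. The number of independent $1$-cycles in $ER$ is the rank of $H^1(ER;\mathbb{Z})$. **Direct limits.** For a square $n\times n$ integer matrix $M$, $\varinjlim M$ is the direct limit of $\mathbb{Z}^n\xrightarrow{M}\mathbb{Z}^n\xrightarrow{M}\cdots$ ($M$ acting on column vectors). *)

(* Defs.v *)
From HB Require Import structures.
From mathcomp Require Import all_boot all_order all_algebra ring_quotient.
From mathcomp Require Import complex ring lra.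
From mathcomp Require Import all_classical all_reals topology normedtype.

Set Implicit Arguments.
Unset Strict Implicit.
Unset Printing Implicit Defensive.

Import Order.TTheory GRing.Theory Num.Theory.
Local Open Scope classical_set_scope.
Local Open Scope ring_scope.

Definition zmod_iso (U V : zmodType) : Prop :=
  exists f : {additive U -> V}, bijective f.

Definition subgroup (V : zmodType) (G : zmodClosed V) : Type :=
  {x : V | x \in G}.

Section Subgroup.
Variables (V : zmodType) (G : zmodClosed V).
HB.instance Definition _ := SubChoice.on (subgroup G).
HB.instance Definition _ := [SubChoice_isSubZmodule of subgroup G by <:].
End Subgroup.

Definition quotient (V : zmodType) (G : zmodClosed V) : zmodType :=
  Quotient.quot G.

Definition independent (V : zmodType) (n : nat) (x : 'I_n -> V) : Prop :=
  forall c : 'I_n -> int,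
    \sum_(i < n) x i *~ c i = 0 -> forall i, c i = 0.

Definition has_rank (V : zmodType) (n : nat) : Prop :=
  (exists x : 'I_n -> V, independent x) /\
  ~ (exists x : 'I_n.+1 -> V, independent x).

Record dirsystem := DirSystem {
  ds_index : Type;
  ds_le : ds_index -> ds_index -> Prop;
  ds_obj : ds_index -> zmodType;
  ds_map : forall i j, ds_le i j -> {additive ds_obj i -> ds_obj j};
  ds_inh : inhabited ds_index;
  ds_refl : forall i, ds_le i i;
  ds_trans : forall i j k, ds_le i j -> ds_le j k -> ds_le i k;
  ds_directed : forall i j, exists k, ds_le i k /\ ds_le j k;
  ds_map_id : forall i (h : ds_le i i) x, ds_map h x = x;
  ds_map_comp : forall i j k (hij : ds_le i j) (hjk : ds_le j k)
    (hik : ds_le i k) x, ds_map hjk (ds_map hij x) = ds_map hik x }.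

Section DirectLimit.
Variable D : dirsystem.

Definition stage : Type := {i : ds_index D & ds_obj i}.
HB.instance Definition _ := gen_eqMixin stage.
HB.instance Definition _ := gen_choiceMixin stage.

Definition stage_eq (x y : stage) : bool :=
  `[< exists k (hx : ds_le (tag x) k) (hy : ds_le (tag y) k),
        ds_map hx (tagged x) = ds_map hy (tagged y) >].

Lemma stage_eq_equiv : equiv_class_of stage_eq.
Proof.
split.
- move=> [i x]; apply/asboolP; exists i, (ds_refl i), (ds_refl i); by [].
- move=> x y; apply/idP/idP => /asboolP [k [hx [hy e]]];
    by apply/asboolP; exists k, hy, hx.
- move=> y x z /asboolP [k [hx [hy e]]] /asboolP [l [hy' [hz e']]].
  have [m [hk hl]] := ds_directed k l.
  apply/asboolP; exists m, (ds_trans hx hk), (ds_trans hz hl).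
  rewrite -(ds_map_comp hx hk) e (ds_map_comp hy hk (ds_trans hy hk)).
  by rewrite -(ds_map_comp hz hl) -e' (ds_map_comp hy' hl (ds_trans hy hk)).
Qed.

Canonical stage_equiv := EquivRelPack stage_eq_equiv.
Canonical stage_enc := defaultEncModRel stage_eq.

Definition dirlim : Type := {eq_quot stage_eq}%qT.
HB.instance Definition _ : EqQuotient stage stage_eq dirlim :=
  EqQuotient.on dirlim.
HB.instance Definition _ := Choice.on dirlim.

Definition to_dirlim (i : ds_index D) (x : ds_obj i) : dirlim :=
  \pi_dirlim%qT (existT _ i x).

Lemma to_dirlim_eq i j (x : ds_obj i) (y : ds_obj j) :
  to_dirlim x = to_dirlim y <->
  exists k (hi : ds_le i k) (hj : ds_le j k), ds_map hi x = ds_map hj y.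
Proof. by split=> [/eqmodP/asboolP //|h]; apply/eqmodP/asboolP. Qed.

Lemma to_dirlim_map i j (h : ds_le i j) x :
  to_dirlim (ds_map h x) = to_dirlim x.
Proof.
apply/to_dirlim_eq; exists j, (ds_refl j), h.
exact: ds_map_comp.
Qed.

Lemma to_dirlimP (u : dirlim) : exists i (x : ds_obj i), u = to_dirlim x.
Proof.
exists (tag (repr u)), (tagged (repr u)); rewrite /to_dirlim.
by case: (repr u) (reprK u).
Qed.

Lemma to_dirlimP2 (u v : dirlim) : exists i (x y : ds_obj i),
  u = to_dirlim x /\ v = to_dirlim y.
Proof.
have [i [x ->]] := to_dirlimP u; have [j [y ->]] := to_dirlimP v.
have [k [hi hj]] := ds_directed i j.
by exists k, (ds_map hi x), (ds_map hj y); rewrite !to_dirlim_map.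
Qed.

Fact dirlim_add_subproof (u v : dirlim) : exists w : dirlim,
  exists i (x y : ds_obj i),
    [/\ u = to_dirlim x, v = to_dirlim y & w = to_dirlim (x + y)].
Proof.
by have [i [x [y [-> ->]]]] := to_dirlimP2 u v; exists (to_dirlim (x + y)), i, x, y.
Qed.

Definition dirlim_add (u v : dirlim) : dirlim :=
  projT1 (cid (dirlim_add_subproof u v)).

Lemma to_dirlimD i (x y : ds_obj i) :
  dirlim_add (to_dirlim x) (to_dirlim y) = to_dirlim (x + y).
Proof.
rewrite /dirlim_add; case: cid => /= w [j [x' [y' [ex ey ->]]]].
have /to_dirlim_eq[k [hi [hj e1]]] := ex.
have /to_dirlim_eq[l [hi' [hj' e2]]] := ey.
have [m [hk hl]] := ds_directed k l.
apply/to_dirlim_eq; exists m, (ds_trans hj hk), (ds_trans hi hk).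
rewrite !raddfD -(ds_map_comp hj hk) -e1 (ds_map_comp hi hk (ds_trans hi hk)).
congr (_ + _).
rewrite -(ds_map_comp hj' hl) -e2.
exact: ds_map_comp.
Qed.

Definition dirlim_zero : dirlim :=
  projT1 (cid (let: inhabits i := ds_inh D in
     ex_intro (fun z => exists i, z = to_dirlim (0 : ds_obj i))
       (to_dirlim (0 : ds_obj i)) (ex_intro _ i erefl))).

Lemma to_dirlim0 i : to_dirlim (0 : ds_obj i) = dirlim_zero.
Proof.
rewrite /dirlim_zero; case: cid => /= z [j ->].
have [k [hi hj]] := ds_directed i j.
by apply/to_dirlim_eq; exists k, hi, hj; rewrite !raddf0.
Qed.

Definition dirlim_opp (u : dirlim) : dirlim :=
  to_dirlim (- tagged (repr u)).

Lemma to_dirlimN i (x : ds_obj i) : dirlim_opp (to_dirlim x) = to_dirlim (- x).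
Proof.
rewrite /dirlim_opp.
have : to_dirlim (tagged (repr (to_dirlim x))) = to_dirlim x.
  by rewrite -[RHS]reprK /to_dirlim; case: (repr _).
move=> /to_dirlim_eq[k [hi [hj e]]].
by apply/to_dirlim_eq; exists k, hi, hj; rewrite !raddfN e.
Qed.

Lemma dirlim_addC : commutative dirlim_add.
Proof.
by move=> u v; have [i [x [y [-> ->]]]] := to_dirlimP2 u v; rewrite !to_dirlimD addrC.
Qed.

Lemma dirlim_addA : associative dirlim_add.
Proof.
move=> u v w; have [i [x [y [-> ->]]]] := to_dirlimP2 u v.
have [j [z ->]] := to_dirlimP w; have [k [hi hj]] := ds_directed i j.
rewrite -(to_dirlim_map hi x) -(to_dirlim_map hi y) -(to_dirlim_map hj z).
by rewrite !to_dirlimD addrA.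
Qed.

Lemma dirlim_add0 : left_id dirlim_zero dirlim_add.
Proof.
by move=> u; have [i [x ->]] := to_dirlimP u; rewrite -(to_dirlim0 i) to_dirlimD add0r.
Qed.

Lemma dirlim_addN : left_inverse dirlim_zero dirlim_opp dirlim_add.
Proof.
move=> u; have [i [x ->]] := to_dirlimP u.
by rewrite to_dirlimN to_dirlimD addNr to_dirlim0.
Qed.

HB.instance Definition _ := GRing.isZmodule.Build dirlim
  dirlim_addA dirlim_addC dirlim_add0 dirlim_addN.

End DirectLimit.

Section MatrixLimit.
Variables (n : nat) (M : 'M[int]_n).

Definition mxsys_map i j (_ : (i <= j)%N) : {additive 'cV[int]_n -> 'cV[int]_n} :=
  mulmx (M ^+ (j - i)).

Lemma mxsys_map_id i (h : (i <= i)%N) x : mxsys_map h x = x.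
Proof. by rewrite /mxsys_map /= subnn expr0 mul1mx. Qed.

Lemma mxsys_map_comp i j k (hij : (i <= j)%N) (hjk : (j <= k)%N)
  (hik : (i <= k)%N) x : mxsys_map hjk (mxsys_map hij x) = mxsys_map hik x.
Proof.
by rewrite /mxsys_map /= mulmxA mulmxE -exprD; congr (_ ^+ _ *m _);
  rewrite addnBA // subnK.
Qed.

Lemma mxsys_directed i j : exists k, (i <= k)%N /\ (j <= k)%N.
Proof. by exists (maxn i j); rewrite leq_maxl leq_maxr. Qed.

Definition mxsys : dirsystem :=
  @DirSystem nat (fun i j => (i <= j)%N) (fun _ => 'cV[int]_n) mxsys_map
    (inhabits 0%N) leqnn (fun i j k hij hjk => leq_trans hij hjk)
    mxsys_directed mxsys_map_id mxsys_map_comp.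

Definition matrix_limit : zmodType := dirlim mxsys.

End MatrixLimit.

Section Cech.
Variable X : topologicalType.

Record open_cover := OpenCover {
  members : set (set X);
  members_open : forall A, members A -> open A;
  members_cover : \bigcup_(A in members) A = [set: X] }.

Definition refines (U V : open_cover) : Prop :=
  forall B, members V B -> exists A, members U A /\ B `<=` A.

(** Cochains are total functions; only their values on tuples of members with
    nonempty intersection (the simplices of the nerve) matter, since
    [coboundary1] identifies functions that agree there. *)
Definition cochain1 := set X -> set X -> int.

Definition cocycle1 (U : open_cover) : {pred cochain1} := fun c =>
  `[< forall A B C, members U A -> members U B -> members U C ->
        A `&` B `&` C !=set0 -> c B C - c A C + c A B = 0 >].

Lemma cocycle1_closed U : zmod_closed (cocycle1 U).
Proof.
split=> [|c c' /asboolP hc /asboolP hc'].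
  have z A B : (0 : cochain1) A B = 0 by [].
  by apply/asboolP => A B C _ _ _ _; rewrite !z subrr.
apply/asboolP => A B C UA UB UC ABC.
have := hc A B C UA UB UC ABC; have := hc' A B C UA UB UC ABC.
by rewrite !fctE; lra.
Qed.
HB.instance Definition _ U :=
  GRing.isZmodClosed.Build cochain1 (cocycle1 U) (cocycle1_closed U).

Definition Z1 U : zmodType := subgroup (cocycle1 U).

Definition coboundary1 (U : open_cover) : {pred Z1 U} := fun c =>
  `[< exists f : set X -> int, forall A B, members U A -> members U B ->
        A `&` B !=set0 -> val c A B = f B - f A >].

Lemma coboundary1_closed U : zmod_closed (@coboundary1 U).
Proof.
split=> [|c c' /asboolP [f hf] /asboolP [f' hf']].
  by apply/asboolP; exists (fun=> 0) => A B _ _ _; rewrite subrr.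
apply/asboolP; exists (f - f') => A B UA UB AB.
have -> : val (c - c') A B = val c A B - val c' A B by [].
by rewrite hf // hf' // !fctE; ring.
Qed.
HB.instance Definition _ U :=
  GRing.isZmodClosed.Build (Z1 U) (@coboundary1 U) (@coboundary1_closed U).

Definition nerve_H1 U : zmodType := quotient (@coboundary1 U).

Definition projection (U V : open_cover) (p : set X -> set X) : Prop :=
  forall B, members V B -> members U (p B) /\ B `<=` p B.

Lemma refines_projection U V : refines U V -> exists p, projection U V p.
Proof.
move=> h.
have /choice[p hp] : forall B, exists A, members V B -> members U A /\ B `<=` A.
  move=> B; case: (pselect (members V B)) => [/h[A ?]|nB]; first by exists A.
  by exists B.
by exists p.
Qed.

Lemma pullback_cocycle U V p (c : Z1 U) : projection U V p ->
  (fun A B => val c (p A) (p B)) \in cocycle1 V.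
Proof.
move=> hp; apply/asboolP => A B C VA VB VC [x [[Ax Bx] Cx]].
have /asboolP hc := valP c.
have [? Ap] := hp _ VA; have [? Bp] := hp _ VB; have [? Cp] := hp _ VC.
by apply: hc => //; exists x; split; [split; [exact: Ap|exact: Bp]|exact: Cp].
Qed.

Definition pullback U V p (hp : projection U V p) (c : Z1 U) : Z1 V :=
  exist (fun b : cochain1 => b \in cocycle1 V) _ (pullback_cocycle c hp).

Lemma pullbackB U V p (hp : projection U V p) :
  {morph pullback hp : c c' / c - c'}.
Proof. by move=> c c'; exact: val_inj. Qed.

Lemma pullback_coboundary U V p (hp : projection U V p) (c : Z1 U) :
  c \in @coboundary1 U -> pullback hp c \in @coboundary1 V.
Proof.
move=> /asboolP[f hf]; apply/asboolP; exists (f \o p) => A B VA VB [x [Ax Bx]].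
have [? Ap] := hp _ VA; have [? Bp] := hp _ VB.
by rewrite /= hf //; exists x; split; [exact: Ap|exact: Bp].
Qed.

Lemma pullback_indep U V p q (hp : projection U V p) (hq : projection U V q) c :
  pullback hp c - pullback hq c \in @coboundary1 V.
Proof.
apply/asboolP; exists (fun B => val c (q B) (p B)) => A B VA VB [x [Ax Bx]].
have /asboolP hc := valP c.
have [? Ap] := hp _ VA; have [? Bp] := hp _ VB.
have [? Aq] := hq _ VA; have [? Bq] := hq _ VB.
have h1 : val c (p A) (p B) - val c (q A) (p B) + val c (q A) (p A) = 0.
  by apply: hc => //; exists x; split; [split; [exact: Aq|exact: Ap]|exact: Bp].
have h2 : val c (q B) (p B) - val c (q A) (p B) + val c (q A) (q B) = 0.
  by apply: hc => //; exists x; split; [split; [exact: Aq|exact: Bq]|exact: Bp].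
have -> : val (pullback hp c - pullback hq c) A B =
  val c (p A) (p B) - val c (q A) (q B) by [].
by move: h1 h2; lra.
Qed.

Definition nerve_map U V (h : refines U V) (u : nerve_H1 U) : nerve_H1 V :=
  \pi_(nerve_H1 V)%qT
    (pullback (projT2 (cid (refines_projection h))) (repr u)).

Lemma nerve_mapE U V (h : refines U V) p (hp : projection U V p) (c : Z1 U) :
  nerve_map h (\pi_(nerve_H1 U)%qT c) = \pi_(nerve_H1 V)%qT (pullback hp c).
Proof.
rewrite /nerve_map; case: cid => q hq /=; set c' := repr _.
have e : c' - c \in @coboundary1 U.
  by rewrite Quotient.idealrBE /c' reprK.
apply/eqP; rewrite -Quotient.idealrBE.
have : pullback hq (c' - c) + (pullback hq c - pullback hp c)
    \in @coboundary1 V by rewrite rpredD ?pullback_indep // pullback_coboundary.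
by rewrite pullbackB addrA subrK.
Qed.

Lemma nerve_map_zmod U V (h : refines U V) : zmod_morphism (nerve_map h).
Proof.
move=> u v; have [p hp] := refines_projection h.
rewrite -[u]reprK -[v]reprK -raddfB !(nerve_mapE h hp) pullbackB.
by rewrite raddfB.
Qed.
HB.instance Definition _ U V (h : refines U V) :=
  GRing.isZmodMorphism.Build (nerve_H1 U) (nerve_H1 V) (nerve_map h)
    (nerve_map_zmod h).

Lemma refines_refl U : refines U U.
Proof. by move=> B UB; exists B; split. Qed.

Lemma refines_trans U V W : refines U V -> refines V W -> refines U W.
Proof.
move=> hUV hVW C /hVW[B [/hUV[A [UA BA]] CB]].
by exists A; split => //; apply: subset_trans CB BA.
Qed.

Fact trivial_cover_open (A : set X) : [set [set: X]] A -> open A.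
Proof. by move=> ->; exact: openT. Qed.
Fact trivial_cover_cover : \bigcup_(A in [set [set: X]]) A = [set: X].
Proof. by rewrite bigcup_set1. Qed.
Definition trivial_cover := OpenCover trivial_cover_open trivial_cover_cover.

Lemma refines_directed U V : exists W, refines U W /\ refines V W.
Proof.
pose M := [set C | exists A B, [/\ members U A, members V B & C = A `&` B]].
have Mo C : M C -> open C.
  by move=> [A [B [UA VB ->]]]; apply: openI; apply: members_open; eassumption.
have Mc : \bigcup_(C in M) C = [set: X].
  rewrite -subTset => x _.
  have [A UA Ax] : (\bigcup_(A in members U) A) x by rewrite members_cover.
  have [B VB Bx] : (\bigcup_(A in members V) A) x by rewrite members_cover.
  by exists (A `&` B) => //; exists A, B.
exists (OpenCover Mo Mc); split=> C [A [B [UA VB ->]]].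
  by exists A; split=> //; exact: subIsetl.
by exists B; split=> //; exact: subIsetr.
Qed.

Lemma nerve_map_id U (h : refines U U) u : nerve_map h u = u.
Proof.
have hid : projection U U id by move=> B UB; split.
rewrite -[u]reprK (nerve_mapE h hid); congr (\pi_(nerve_H1 U)%qT _).
exact: val_inj.
Qed.

Lemma nerve_map_comp U V W (hUV : refines U V) (hVW : refines V W)
  (hUW : refines U W) u : nerve_map hVW (nerve_map hUV u) = nerve_map hUW u.
Proof.
have [p hp] := refines_projection hUV; have [q hq] := refines_projection hVW.
have hpq : projection U W (p \o q).
  move=> C WC; have [Vq Cq] := hq _ WC; have [Up qp] := hp _ Vq.
  by split=> //=; apply: subset_trans Cq qp.
rewrite -[u]reprK (nerve_mapE _ hp) (nerve_mapE _ hq) (nerve_mapE _ hpq).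
by congr (\pi_(nerve_H1 W)%qT _); exact: val_inj.
Qed.

Definition cech_system : dirsystem :=
  @DirSystem open_cover refines nerve_H1
    (fun U V h => nerve_map h : {additive nerve_H1 U -> nerve_H1 V})
    (inhabits trivial_cover) refines_refl refines_trans refines_directed
    nerve_map_id nerve_map_comp.

Definition cech_H1 : zmodType := dirlim cech_system.

End Cech.

Record substitution (d : nat) := Substitution {
  subst_letter :> 'I_d -> seq 'I_d;
  subst_letter_neq0 : forall a, subst_letter a != [::] }.

Section Substitutions.
Variables (d : nat) (phi : substitution d).

Definition subst_word (u : seq 'I_d) : seq 'I_d := flatten (map phi u).

Definition transition_mx : 'M[int]_d :=
  \matrix_(i, j) (count_mem i (phi j))%:Z.

Definition primitive : Prop :=
  exists N, forall n, (N <= n)%N ->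
    forall i j : 'I_d, j \in iter n subst_word [:: i].

Definition occurs (u : seq 'I_d) : Prop :=
  exists n (i : 'I_d), infix u (iter n subst_word [:: i]).

Definition allowed (w : seq 'I_d) : Prop := forall u, infix u w -> occurs u.

Definition factor (w : int -> 'I_d) (i : int) (n : nat) : seq 'I_d :=
  mkseq (fun k => w (i + k%:Z)) n.

Definition biallowed (w : int -> 'I_d) : Prop :=
  forall i n, occurs (factor w i n).

(** [phi^m(w) = w] with the origin preserved: the image of every prefix of
    [w_0 w_1 ...] is a prefix of [w_0 w_1 ...], and the image of every suffix
    of [... w_(-2) w_(-1)] is a suffix of [... w_(-2) w_(-1)].  The lengths of
    these images are unbounded because [phi] is nonerasing. *)
Definition fixed_by_power (m : nat) (w : int -> 'I_d) : Prop :=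
  forall n : nat,
    (let u := iter m subst_word (factor w 0 n) in u = factor w 0 (size u)) /\
    (let u := iter m subst_word (factor w (- n%:Z) n) in
       u = factor w (- (size u)%:Z) (size u)).

Definition subst_periodic (w : int -> 'I_d) : Prop :=
  exists2 m, (0 < m)%N & fixed_by_power m w.

Definition shift_periodic (w : int -> 'I_d) : Prop :=
  exists2 p, (0 < p)%N & forall i, w (i + p%:Z) = w i.

Definition aperiodic : Prop :=
  exists w, [/\ biallowed w, subst_periodic w & ~ shift_periodic w].

(** The complex [S] is the finite graph with one edge
    [e_ab = [-eps, eps] x {ab}] for each allowed two-letter word [ab], where
    [eps] is half of [min omega_a / lambda].  The left endpoint of [e_ab] is the class of
    [(omega_a - eps, a)], which depends only on [a] and is encoded as [inl a];
    its right endpoint is the class of [(eps, b)], encoded as [inr b].  These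
    are the only identifications between points of the edges of [S]. *)
Definition S_edges : set ('I_d * 'I_d) := [set e | allowed [:: e.1; e.2]].

Definition left_end (e : 'I_d * 'I_d) : 'I_d + 'I_d := inl e.1.
Definition right_end (e : 'I_d * 'I_d) : 'I_d + 'I_d := inr e.2.

(** The defaults [e.1] and [e.2] are never used, as images are nonempty. *)
Definition edge_map (e : 'I_d * 'I_d) : 'I_d * 'I_d :=
  (last e.1 (phi e.1), head e.2 (phi e.2)).

(** The map [g|_S] carries edges onto edges, so the intersection of the images
    of [S] is the union of the edges lying in every image of the edge set. *)
Definition ER_edges : set ('I_d * 'I_d) :=
  \bigcap_n (iter n edge_map @` S_edges).

Definition ER_edge : finType := {e : 'I_d * 'I_d | `[< ER_edges e >]}.

Definition ER_vertex : pred ('I_d + 'I_d) := fun v =>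
  [exists e : ER_edge, (v == left_end (val e)) || (v == right_end (val e))].

Definition ER_adjacent : rel ('I_d + 'I_d) := fun u v =>
  [exists e : ER_edge, ((u == left_end (val e)) && (v == right_end (val e)))
                    || ((v == left_end (val e)) && (u == right_end (val e)))].

Definition ER_components : nat := n_comp ER_adjacent ER_vertex.

(** [H^1] of the graph [ER]: integer functions on edges modulo coboundaries of
    functions on vertices.  Values at vertices outside [ER] play no role. *)
Definition ER_coboundary : {pred {ffun ER_edge -> int}} := fun c =>
  `[< exists f : 'I_d + 'I_d -> int, forall e : ER_edge,
        c e = f (right_end (val e)) - f (left_end (val e)) >].

Lemma ER_coboundary_closed : zmod_closed ER_coboundary.
Proof.
split=> [|c c' /asboolP [f hf] /asboolP [f' hf']].
  by apply/asboolP; exists (fun=> 0) => e; rewrite ffunE subrr.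
apply/asboolP; exists (f - f') => e; rewrite !ffunE hf hf' !fctE; ring.
Qed.
HB.instance Definition _ :=
  GRing.isZmodClosed.Build {ffun ER_edge -> int} ER_coboundary
    ER_coboundary_closed.

Definition ER_H1 : zmodType := quotient ER_coboundary.

End Substitutions.

(** An eigenvalue equal to the spectral radius; for the transition matrix of a
    primitive substitution it is the unique dominant eigenvalue. *)
Definition perron_eigenvalue (R : realType) (n : nat) (A : 'M[R]_n) (lam : R)
    : Prop :=
  eigenvalue A lam /\
  forall mu : R[i], eigenvalue (map_mx (real_complex R) A) mu ->
    `|mu| <= real_complex R lam.

Definition tile (R : realType) (d : nat) : Type := (R * 'I_d)%type.

Section Tilings.
Variables (R : realType) (d : nat) (phi : substitution d) (omega : 'rV[R]_d).

(** The tile [(x, a)] is the translate by [x] of the prototile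
    [[0, omega_a]] labelled [a]. *)
Definition support (t : tile R d) : set R :=
  [set y | t.1 <= y <= t.1 + omega ord0 t.2].

Definition translate (e : R) (t : tile R d) : tile R d := (t.1 + e, t.2).

Record is_tiling (T : int -> tile R d) : Prop := {
  tiling_cover : \bigcup_i support (T i) = [set: R];
  tiling_meet : forall i, exists x,
    support (T i) `&` support (T (i + 1)) = [set x];
  tiling_ordered : forall i, (T i).1 < (T (i + 1)).1;
  tiling_origin : (support (T 0) `\` support (T 1)) 0 }.

Definition tiling_word (T : int -> tile R d) : int -> 'I_d := fun i => (T i).2.

Record tiling_space := Tiling {
  tiles :> int -> tile R d;
  tiles_tiling : is_tiling tiles;
  tiles_allowed : biallowed phi (tiling_word tiles) }.

HB.instance Definition _ := gen_eqMixin tiling_space.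
HB.instance Definition _ := gen_choiceMixin tiling_space.

Definition close (delta : R) (T T' : tiling_space) : Prop :=
  exists2 e : R, `|e| < delta &
    forall t : tile R d,
      (exists2 y, support t y & `|y| < delta^-1) ->
      range T t <-> range (translate e \o T') t.

Definition tiling_nbhs (T : tiling_space) : set_system tiling_space :=
  [set P | exists2 delta : R, 0 < delta & [set T' | close delta T T'] `<=` P].

HB.instance Definition _ := hasNbhs.Build tiling_space tiling_nbhs.

Lemma translate0 : translate 0 = id.
Proof. by apply/funext => -[x a]; rewrite /translate /= addr0. Qed.

Lemma close_refl delta T : 0 < delta -> close delta T T.
Proof. by move=> d0; exists 0; rewrite ?normr0 // translate0. Qed.

Lemma close_le delta delta' T T' : 0 < delta -> delta <= delta' ->
  close delta T T' -> close delta' T T'.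
Proof.
move=> d0 dd [e ed h]; exists e; first exact: lt_le_trans ed dd.
move=> t [y ty yd]; apply: h; exists y => //; apply: lt_le_trans yd _.
by rewrite lef_pV2 // posrE; exact: lt_le_trans d0 dd.
Qed.

Lemma range_translate e e' (T : int -> tile R d) t :
  range (translate (e + e') \o T) t <-> range (translate e \o T) (translate (- e') t).
Proof.
split=> -[i _ /= h]; exists i => //=.
  by rewrite -h /translate /= addrA addrK.
by move: h; rewrite /translate; case: t => x a /= [hx <-]; rewrite addrA hx subrK.
Qed.

Lemma close_trans delta T T1 : 0 < delta -> close delta T T1 ->
  exists2 eta : R, 0 < eta & forall T2, close eta T1 T2 -> close delta T T2.
Proof.
move=> d0 [e ed h].
have di0 : 0 < delta^-1 by rewrite invr_gt0.
exists (Num.min (delta - `|e|) (delta^-1 + delta)^-1).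
  by rewrite lt_min subr_gt0 ed invr_gt0 addr_gt0.
set eta := Num.min _ _ => T2 [e2 e2eta h2].
have eta0 : 0 < eta by rewrite lt_min subr_gt0 ed invr_gt0 addr_gt0.
have eta1 : eta <= delta - `|e| by rewrite ge_min lexx.
have eta2 : delta^-1 + delta <= eta^-1.
  by rewrite -[leLHS]invrK lef_pV2 ?posrE ?invr_gt0 ?addr_gt0 // ge_min lexx orbT.
exists (e2 + e).
  have := ler_normD e2 e; move: e2eta eta1; lra.
move=> t [y ty yd]; rewrite (h t); last by exists y.
have t0 : range (translate e \o T1) t <-> range T1 (translate (- e) t).
  by have := range_translate 0 e T1 t; rewrite add0r translate0.
rewrite t0 range_translate; apply: h2; exists (y - e).
  by move: ty; rewrite /support /translate /= addrAC !lerD2r.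
have := ler_normB y e; lra.
Qed.

Fact tiling_nbhs_filter (T : tiling_space) : ProperFilter (nbhs T).
Proof.
split; first by move=> [delta d0 h]; exact: (h T (close_refl T d0)).
split.
- by exists 1.
- move=> P Q [dP P0 hP] [dQ Q0 hQ]; exists (Num.min dP dQ).
    by rewrite lt_min P0.
  move=> T' h; split.
    by apply: hP; apply: close_le h; rewrite ?lt_min ?P0 // ge_min lexx.
  by apply: hQ; apply: close_le h; rewrite ?lt_min ?P0 // ge_min lexx orbT.
- by move=> P Q PQ [delta d0 h]; exists delta => //; exact: subset_trans PQ.
Qed.

Fact tiling_nbhs_singleton (T : tiling_space) (P : set tiling_space) : nbhs T P -> P T.
Proof. by move=> [delta d0 h]; apply: h; exact: close_refl. Qed.

Fact tiling_nbhs_nbhs (T : tiling_space) (P : set tiling_space) : nbhs T P -> nbhs T (nbhs^~ P).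
Proof.
move=> [delta d0 h]; exists delta => // T1 TT1.
have [eta eta0 heta] := close_trans d0 TT1.
by exists eta => // T2 /heta /h.
Qed.

HB.instance Definition _ := Nbhs_isNbhsTopological.Build tiling_space
  tiling_nbhs_filter tiling_nbhs_singleton tiling_nbhs_nbhs.

End Tilings.

(* Main.v *)
(** A tiling is a word together with a phase, so a class in the first Cech group
    is a locally constant integer function on the allowed words, read off at
    the vertices of the tiling, modulo the functions u(x) - u(shift x).  By
    recognizability every allowed word is cut in a unique way into the blocks
    phi^n(y_i), and such a function is cohomologous to one that is carried by
    the left ends of the blocks of level n.  When the function only depends on
    the letter y_i of the block, these are the elements of the direct limit of
    A^t.  In general it also depends on the letters on both sides of a cut, and
    for n large only through the edge of the eventual range that they define;
    summing it around the origin of the words fixed by phi^M, one for each edge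
    of ER, gives an exact sequence

      lim A^t -> H^1(tiling space) -> H^1(ER) -> 0.

    The first map kills the classes of h(last letter of phi^M(a)) - h(first
    letter of phi^M(a)), where h is constant on the components of ER, and
    nothing else; they form the group G.  As H^1(ER) is free, the sequence
    splits. *)

Require Import Defs.
From HB Require Import structures.
From mathcomp Require Import all_boot all_order all_algebra.
From mathcomp Require Import all_classical all_reals topology normedtype.
From mathcomp Require Import ring lra zify.

Set Implicit Arguments.
Unset Strict Implicit.
Unset Printing Implicit Defensive.

Import Order.TTheory GRing.Theory Num.Theory.
Local Open Scope ring_scope.

(** * Parsing words *)

(** Recognizability is itself the main obstacle: it is derived from a defect theorem, first for
    substitutions that do not factor through a smaller alphabet, then by induction on the alphabet.
    Compactness turns the uniqueness of desubstitution into locality; here and elsewhere it takes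
    the form of limits along a free ultrafilter. Cocycles become functions on words because, on a
    fine cover, a cocycle has a primitive built tile by tile, which is locally constant except when
    a vertex crosses the origin; its jump there is the function on words. The fixed words suffice to
    test a function because, for large j, every word phi^(jM)(y) looks near its origin like the
    fixed word of one edge of ER. A transfer function evaluated at the fixed words, for a function
    carried by letters, depends only on the left letter of the edge and also only on the right one.
    It is therefore constant on components, which is how h arises. Constant functions h give the
    zero vector, whence k - 1 and not k. *)

Lemma int_bi_ind (P : int -> Prop) : P 0 -> (forall i : int, P i <-> P (i + 1)) ->
  forall i : int, P i.
Proof.
move=> P0 PS; elim/int_ind => [|n Pn|n Pn] //.
  by move: Pn; rewrite PS; have -> : n%:Z + 1 = n.+1 by lia.
apply/PS; suff -> : - n.+1%:Z + 1 = - n%:Z by [].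
by lia.
Qed.

(** The discrete integral of [g] from 0 to [i], oriented, so that [psumS] holds on both sides of
    0. *)
Definition psum (V : zmodType) (g : int -> V) (i : int) : V :=
  match i with
  | Posz n => \sum_(k < n) g k%:Z
  | Negz n => - \sum_(k < n.+1) g (- k.+1%:Z)
  end.

Lemma psum0 (V : zmodType) (g : int -> V) : psum g 0 = 0.
Proof. by rewrite /= big_ord0. Qed.

Lemma psumS (V : zmodType) (g : int -> V) (i : int) : psum g (i + 1) = psum g i + g i.
Proof.
case: i => n.
  have -> : Posz n + 1 = Posz n.+1 by lia.
  by rewrite /psum big_ord_recr.
case: n => [|n].
  have -> : Negz 0 + 1 = Posz 0 by lia.
  by rewrite /= big_ord0 big_ord_recr big_ord0 /= add0r addNr.
have -> : Negz n.+1 + 1 = Negz n by lia.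
by rewrite /psum [in RHS]big_ord_recr /= NegzE opprD subrK.
Qed.

Lemma psum_uniq (V : zmodType) (g P : int -> V) :
  (forall i : int, P (i + 1) = P i + g i) -> forall i : int, P i = P 0 + psum g i.
Proof.
move=> PS; apply: int_bi_ind => [|i]; first by rewrite psum0 addr0.
rewrite PS psumS addrA; split=> [->//|/addIr//].
Qed.

Definition shift (A : Type) (k : int) (x : int -> A) : int -> A :=
  fun i => x (i + k).

Lemma shift0 (A : Type) (x : int -> A) : shift 0 x = x.
Proof. by apply/funext => i; rewrite /shift addr0. Qed.

Lemma shiftD (A : Type) (k l : int) (x : int -> A) :
  shift k (shift l x) = shift (k + l) x.
Proof. by apply/funext => i; rewrite /shift addrA. Qed.

Section Extension.
Variables (A B : Type) (s : A -> seq B).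
Definition extend (w : seq A) : seq B := flatten (map s w).

Lemma extend_cat u v : extend (u ++ v) = extend u ++ extend v.
Proof. by rewrite /extend map_cat flatten_cat. Qed.
Lemma extend_cons a v : extend (a :: v) = s a ++ extend v.
Proof. by []. Qed.
Lemma extend1 a : extend [:: a] = s a.
Proof. by rewrite /extend /= cats0. Qed.
End Extension.

Lemma extend_comp (A B C : Type) (b : A -> seq B) (a : B -> seq C) w :
  extend a (extend b w) = extend (fun c => extend a (b c)) w.
Proof. by elim: w => //= c w IH; rewrite extend_cons extend_cat IH. Qed.

Definition nonerasing (A B : Type) (s : A -> seq B) : Prop :=
  forall a, (0 < size (s a))%N.

Lemma size_extend_ge (A B : Type) (s : A -> seq B) w : nonerasing s ->
  (size w <= size (extend s w))%N.
Proof.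
move=> ne; elim: w => //= a w IH; rewrite extend_cons size_cat.
by have := ne a; lia.
Qed.

Lemma nonerasing_comp (A B C : Type) (b : A -> seq B) (a : B -> seq C) :
  nonerasing a -> nonerasing b -> nonerasing (fun c => extend a (b c)).
Proof.
by move=> na nb c; apply: leq_trans (nb c) (size_extend_ge _ na).
Qed.

(** [parses s y pos x]: the bi-infinite word [x] is cut at the positions [pos]
    into the blocks [... s (y 0) s (y 1) ...]. *)
Record parses (A B : Type) (s : A -> seq B) (y : int -> A) (pos : int -> int)
    (x : int -> B) : Prop := Parses {
  parses_pos : forall i : int, pos (i + 1) = pos i + (size (s (y i)))%:Z;
  parses_nth : forall (i : int) (k : nat) b0, (k < size (s (y i)))%N ->
    x (pos i + k%:Z) = nth b0 (s (y i)) k }.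
Arguments parses_pos {A B s y pos x} _ i.
Arguments parses_nth {A B s y pos x} _ i [k] b0 _.

Section Cuts.
Variable pos : int -> int.
Hypothesis posS : forall i : int, pos i < pos (i + 1).

Lemma cut_mono_nat (i : int) (n : nat) : pos i + n%:Z <= pos (i + n%:Z).
Proof.
elim: n => [|n IH]; first by rewrite !addr0.
have := posS (i + n%:Z); have -> : i + n.+1 = i + n + 1 by lia.
by lia.
Qed.

Lemma cut_mono (i j : int) : i <= j -> pos i + (j - i) <= pos j.
Proof.
move=> ij; have := cut_mono_nat i (absz (j - i)).
have -> : i + (absz (j - i))%:Z = j by lia.
by lia.
Qed.

Lemma cut_lt (i j : int) : pos i < pos j -> i < j.
Proof. by move=> h; rewrite ltNge; apply/negP => H; have := cut_mono H; lia. Qed.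

Lemma cut_inj (i j : int) : pos i = pos j -> i = j.
Proof.
move=> h; apply/eqP; rewrite eq_le; apply/andP; split; rewrite leNgt;
  apply/negP => H; have := cut_mono (ltW H); lia.
Qed.

(** Consecutive cuts are at least 1 apart, so [pos] is unbounded on both sides; the search runs back
    from a cut beyond [z]. *)
Lemma locate (z : int) : exists i : int, pos i <= z < pos (i + 1).
Proof.
have [m hm] : exists m, pos m <= z.
  exists (- (absz z + absz (pos 0))%N%:Z).
  by have := @cut_mono (- (absz z + absz (pos 0))%N%:Z) 0; lia.
have [n hn] : exists n : nat, z < pos (m + n%:Z).
  exists (absz z + absz (pos m)).+1%N.
  by have := cut_mono_nat m (absz z + absz (pos m)).+1%N; lia.
elim: n hn => [|n IH] hn; first by move: hn; rewrite addr0; lia.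
case: (ltP z (pos (m + n%:Z))) => [/IH //|h].
exists (m + n%:Z); rewrite h /=.
by have -> : m + n%:Z + 1 = m + n.+1%:Z by lia.
Qed.
End Cuts.

Section Parses.
Variables (A B : Type) (s : A -> seq B).
Hypothesis ne : nonerasing s.

Lemma parses_lt y pos x : parses s y pos x -> forall i : int, pos i < pos (i + 1).
Proof. by move=> [h _] i; rewrite h; have := ne (y i); lia. Qed.

Lemma parses_exists y (k : int) : exists (pos : int -> int) x, pos 0 = k /\ parses s y pos x.
Proof.
have [pos [p0 posS]] : exists pos : int -> int,
    pos 0 = k /\ forall i : int, pos (i + 1) = pos i + (size (s (y i)))%:Z.
  exists (fun i => k + psum (fun i => (size (s (y i)))%:Z) i).
  by split=> [|i]; rewrite ?psum0 ?addr0 // psumS addrA.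
have posl i : pos i < pos (i + 1) by rewrite posS; have := ne (y i); lia.
have [b] : exists b : B, True.
  by have := ne (y 0); case: (s (y 0)) => // b *; exists b.
have /choice[loc hloc] := locate posl.
exists pos, (fun z => nth b (s (y (loc z))) (absz (z - pos (loc z)))); split.
  by [].
split=> // i k' b0 hk.
have -> : loc (pos i + k') = i.
  have /andP[h1 h2] := hloc (pos i + k'%:Z); have := posS i.
  have := posS (loc (pos i + k'%:Z)) => h3 h4.
  have : pos i < pos (loc (pos i + k'%:Z) + 1) by lia.
  move=> /(cut_lt posl) h5.
  have /(cut_lt posl) h6 : pos (loc (pos i + k'%:Z)) < pos (i + 1) by lia.
  by lia.
by rewrite (set_nth_default b0) //; [congr nth; lia|lia].
Qed.

Lemma parses_pos_uniq y pos pos' x x' (i0 : int) : parses s y pos x ->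
  parses s y pos' x' -> pos i0 = pos' i0 -> forall i : int, pos i = pos' i.
Proof.
move=> h h' e i.
have := psum_uniq (parses_pos h); have := psum_uniq (parses_pos h') => u' u.
by move: e; rewrite (u i) (u' i) (u i0) (u' i0); lia.
Qed.

Lemma parses_uniq y pos x x' : parses s y pos x -> parses s y pos x' -> x = x'.
Proof.
move=> h h'; apply/funext => z.
have [i /andP[h1 h2]] := locate (parses_lt h) z.
have := parses_pos h i => e.
have -> : z = pos i + (absz (z - pos i))%:Z by lia.
have [b] : exists b : B, True by exists (x 0).
by rewrite (parses_nth h _ b) ?(parses_nth h' _ b) //; lia.
Qed.

Lemma parses_eq y pos pos' x x' (i0 : int) : parses s y pos x -> parses s y pos' x' ->
  pos i0 = pos' i0 -> pos = pos' /\ x = x'.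
Proof.
move=> h h' e; have ep : pos = pos'.
  by apply/funext; apply: parses_pos_uniq h h' e.
by split=> //; move: h'; rewrite -ep; apply: parses_uniq h.
Qed.

Lemma parses_shift_source y pos x (m : int) : parses s y pos x ->
  parses s (shift m y) (fun i : int => pos (i + m)) x.
Proof.
move=> [h1 h2]; split=> [i|i k b0 hk].
  by have -> : i + 1 + m = i + m + 1 by lia.
exact: h2.
Qed.

Lemma parses_shift y pos x (k : int) : parses s y pos x ->
  parses s y (fun i => pos i - k) (shift k x).
Proof.
move=> [h1 h2]; split=> [i|i j b0 hk]; first by rewrite h1; lia.
by rewrite /shift -(h2 i j b0 hk); congr x; lia.
Qed.
End Parses.

Lemma parses_comp (A B C : Type) (b : A -> seq B) (a : B -> seq C) y pos z pos' x :
  parses b y pos z -> parses a z pos' x ->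
  parses (fun c => extend a (b c)) y (fun i => pos' (pos i)) x.
Proof.
move=> [h1 h2] [k1 k2].
(* The cut of [pos'] with index [pos i + n] lies just after the [a]-images of the first [n] letters
   of the block of [y i]. *)
have key i w (n : nat) : b (y i) = w -> forall v,
   w = take n w ++ v -> (n <= size w)%N ->
   pos' (pos i + n%:Z) = pos' (pos i) + (size (extend a (take n w)))%:Z.
  move=> <- v _; elim: n v => [|n IH] v hn.
    by rewrite take0 !addr0.
  have hlt : (n < size (b (y i)))%N by lia.
  have [c _] : exists c : B, True by exists (z 0).
  rewrite (take_nth c) // -cats1 extend_cat extend1 size_cat.
  have -> : pos i + n.+1 = pos i + n + 1 by lia.
  rewrite k1 IH //; last by lia.
  by rewrite (h2 i n c hlt); lia.
split=> [i|i k c0 hk].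
  rewrite h1 (key i (b (y i)) _ erefl [::]) ?take_size ?cats0 //.
suff H (w u : seq B) (k' : nat) : b (y i) = u ++ w -> (k' < size (extend a w))%N ->
  x (pos' (pos i) + (size (extend a u))%:Z + k'%:Z) = nth c0 (extend a w) k'.
  by have := H (b (y i)) [::] k erefl hk; rewrite addr0.
elim: w u k' => [|c w IH] u k' e //; rewrite extend_cons size_cat nth_cat => hk'.
have hu : (size u < size (b (y i)))%N by rewrite e size_cat /=; lia.
have zc : z (pos i + (size u)%:Z) = c.
  by rewrite (h2 _ _ c hu) e nth_cat ltnn subnn.
have tk : take (size u) (b (y i)) = u by rewrite e take_size_cat.
have pu := key i (b (y i)) (size u) erefl (drop (size u) (b (y i))).
rewrite tk in pu; have {}pu := pu ltac:(by rewrite e drop_size_cat) (ltnW hu).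
case: ifP => hc; first by rewrite -pu (k2 _ _ c0) zc.
rewrite -(IH (rcons u c)) ?cat_rcons //; last by lia.
by rewrite -cats1 extend_cat extend1 size_cat; congr x; lia.
Qed.

(** The intermediate word is rebuilt from [y] with its cut 0 at the origin. The composite parse has
    the same cut 0 as the given one, hence equals it. *)
Lemma parses_decomp (A B C : Type) (b : A -> seq B) (a : B -> seq C) y pos x :
  nonerasing a -> nonerasing b -> parses (fun c => extend a (b c)) y pos x ->
  exists (pos1 : int -> int) z (pos2 : int -> int), [/\ pos1 0 = 0, parses b y pos1 z, parses a z pos2 x &
    pos = (fun i => pos2 (pos1 i))].
Proof.
move=> na nb h.
have [pos1 [z [e1 h1]]] := parses_exists nb y 0.
have [pos2 [x' [e2 h2]]] := parses_exists na z (pos 0).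
have h3 := parses_comp h1 h2.
have e0 : pos 0 = pos2 (pos1 0) by rewrite e1 e2.
have [e3 e4] := parses_eq (nonerasing_comp na nb) h h3 e0.
by exists pos1, z, pos2; rewrite e4.
Qed.

(** Reflection about -1/2: the letter at z moves to -1 - z, while a cut at c moves to -c. It carries
    statements on right halves over to left halves. *)
Lemma parses_rev (A B : Type) (s : A -> seq B) y pos x :
  parses s y pos x ->
  parses (rev \o s) (fun i => y (- 1 - i)) (fun i => - pos (- i))
    (fun z => x (- 1 - z)).
Proof.
move=> [h1 h2]; split=> [i|i k b0 /=].
  have := h1 (- 1 - i); have -> : - 1 - i + 1 = - i by lia.
  have -> : - (i + 1) = - 1 - i by lia.
  by rewrite /= size_rev => ->; lia.
rewrite size_rev => hk; rewrite nth_rev // -h2; last by lia.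
have := h1 (- 1 - i); have -> : - 1 - i + 1 = - i by lia.
by move=> e; congr x; rewrite e; lia.
Qed.

Definition scons (A : Type) (a : A) (u : nat -> A) : nat -> A :=
  fun n => if n is m.+1 then u m else a.

Definition stail (A : Type) (u : nat -> A) : nat -> A := fun n => u n.+1.

Lemma mkseqS (A : Type) (u : nat -> A) n :
  mkseq u n.+1 = u 0%N :: mkseq (stail u) n.
Proof. by rewrite /mkseq /= -[1%N]addn0 iotaDl -map_comp. Qed.

(** [spells s u x]: the infinite word [x] is [s (u 0) s (u 1) ...]. *)
Definition spells (A B : Type) (s : A -> seq B) (u : nat -> A) (x : nat -> B) :=
  forall n, let w := extend s (mkseq u n) in w = mkseq x (size w).

Section Spells.
Variables (A B : Type) (s : A -> seq B).
Hypothesis ne : nonerasing s.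

Lemma spells_exists u : exists x, spells s u x.
Proof.
have [b _] : exists b : B, True.
  by have := ne (u 0%N); case: (s (u 0%N)) => // b *; exists b.
exists (fun k => nth b (extend s (mkseq u k.+1)) k) => n /=.
apply: (@eq_from_nth _ b) => [|k hk]; first by rewrite size_mkseq.
rewrite nth_mkseq //.
have pre m p : (m <= p)%N -> (k < size (extend s (mkseq u m)))%N ->
    nth b (extend s (mkseq u p)) k = nth b (extend s (mkseq u m)) k.
  move=> mp hm; rewrite -(subnKC mp) /mkseq iotaD map_cat extend_cat nth_cat.
  by rewrite ifT.
case: (leqP k.+1 n) => h; last by rewrite (pre n k.+1) // ltnW.
rewrite (pre k.+1 n) //; apply: leq_trans (size_extend_ge _ ne).
by rewrite size_mkseq.
Qed.

Lemma spells_nth u x k b0 : spells s u x -> (k < size (s (u 0%N)))%N ->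
  x k = nth b0 (s (u 0%N)) k.
Proof.
move=> h hk; have := h 1%N; rewrite /= /mkseq /= extend1 => ->.
by rewrite (nth_mkseq b0 x hk).
Qed.

Lemma spells_behead u x : spells s u x ->
  spells s (stail u) (fun k => x (size (s (u 0%N)) + k)%N).
Proof.
move=> h n /=; have /= := h n.+1; rewrite mkseqS extend_cons size_cat.
move=> /(congr1 (drop (size (s (u 0%N))))); rewrite drop_size_cat // => {1}->.
rewrite /mkseq -map_drop drop_iota addKn add0n -{1}[size (s _)]addn0 iotaDl.
by rewrite -map_comp.
Qed.

Lemma spells_uniq u x x' : spells s u x -> spells s u x' -> x = x'.
Proof.
move=> h h'; apply/funext => k.
have hk : (k < size (extend s (mkseq u k.+1)))%N.
  by apply: leq_trans (size_extend_ge _ ne); rewrite size_mkseq.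
have := congr1 (fun w => nth (x k) w k) (etrans (esym (h k.+1)) (h' k.+1)).
by rewrite !nth_mkseq.
Qed.

End Spells.

Lemma spells_comp (A B C : Type) (b : A -> seq B) (a : B -> seq C) u z x :
  spells b u z -> spells a z x -> spells (fun c => extend a (b c)) u x.
Proof.
move=> h h' n /=; rewrite -extend_comp.
have -> : extend b (mkseq u n) = mkseq z (size (extend b (mkseq u n))) := h n.
exact: h'.
Qed.

Lemma spells_head (A B : Type) (s : A -> seq B) u x b0 : nonerasing s ->
  spells s u x -> x 0%N = head b0 (s (u 0%N)).
Proof. by move=> ne h; rewrite (spells_nth b0 h (ne _)) nth0. Qed.

(** * Recognizability *)

Definition decomposes (A : finType) (C : Type) (s : A -> seq C)
    (B : finType) (b : A -> seq B) (a : B -> seq C) : Prop :=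
  [/\ nonerasing a, nonerasing b & forall c, s c = extend a (b c)].

Definition compatible (A : finType) (P : (nat -> A) -> (nat -> A) -> Prop) :=
  [set h : {ffun A -> bool} | `[< forall u v, P u v -> h (u 0%N) = h (v 0%N) >]].

(** A form of the defect theorem: the graph on the letters in which each pair
    of infinite words with the same image links its two first letters bounds,
    by its number of connected components, the size of an alphabet through
    which [s] factors.  The components are counted by the [bool]-valued
    functions constant on them. *)
Lemma defect (C : eqType) n : forall (A : finType) (s : A -> seq C)
    (P : (nat -> A) -> (nat -> A) -> Prop),
  nonerasing s -> (\sum_c size (s c) <= n)%N ->
  (forall u v, P u v -> exists x, spells s u x /\ spells s v x) ->
  exists B b a, @decomposes A C s B b a /\ (2 ^ #|B| <= #|compatible P|)%N.
Proof.
elim: n => [|n IH] A s P ne sz hP.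
  have A0 (c : A) : False.
    by have := ne c; move: sz; rewrite (bigD1 c) //=; lia.
  exists A, (fun c => [:: c]), s; split.
    by split=> // c; rewrite extend1.
  rewrite -card_bool -card_ffun; apply: subset_leq_card; apply/fintype.subsetP => h _.
  by rewrite inE; apply/asboolP => u; have := A0 (u 0%N).
have [[u [v [Puv huv]]]|nP] := pselect (exists u v, P u v /\ u 0%N <> v 0%N);
    last first.
  (* No pair has two different first letters: every function is compatible, and the trivial
     factorization has the right size. *)
  exists A, (fun c => [:: c]), s; split.
    by split=> // c; rewrite extend1.
  rewrite -card_bool -card_ffun; apply: subset_leq_card; apply/fintype.subsetP => h _.
  rewrite inE; apply/asboolP => u v Puv; congr (h _).
  by apply: contrapT => huv; apply: nP; exists u, v.
wlog le : u v P hP Puv huv / (size (s (u 0%N)) <= size (s (v 0%N)))%N.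
  move=> H; case: (leqP (size (s (u 0%N))) (size (s (v 0%N)))) => le.
    exact: (H u v P).
  have [B [b [a [h1 h2]]]] := H v u (fun u v => P v u)
    (fun x y h => let: ex_intro z (conj h1 h2) := hP y x h in
       ex_intro _ z (conj h2 h1)) Puv (nesym huv) (ltnW le).
  exists B, b, a; split=> //; apply: leq_trans h2 _.
  apply: subset_leq_card; apply/fintype.subsetP => h; rewrite !inE => /asboolP hh.
  by apply/asboolP => x y /hh ->.
have [c0 _] : exists c : C, True.
  by have := ne (u 0%N); case: (s (u 0%N)) => // b *; exists b.
have [x [xu xv]] := hP _ _ Puv.
have esv : s (v 0%N) = s (u 0%N) ++ drop (size (s (u 0%N))) (s (v 0%N)).
  rewrite -{1}(cat_take_drop (size (s (u 0%N))) (s (v 0%N))); congr (_ ++ _).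
  apply: (@eq_from_nth _ c0) => [|i]; rewrite size_takel // => hi.
  rewrite nth_take // -(spells_nth c0 xu hi) -(spells_nth c0 xv) //.
  exact: leq_trans hi le.
set a := u 0%N in huv le esv *; set b := v 0%N in huv le esv *.
(* If [a] and [b] have the same image, [b] is merged into [a]. Otherwise the prefix [s a] is split
   off [s b], and [b] is rewritten as the word [a b]. Both reduce the total length of the images. *)
case e : (drop (size (s a)) (s b)) esv => [|d0 d] esv.
  pose A' := {c : A | c != b}.
  have ab : a != b by apply/eqP.
  pose f (c : A) : A' := insubd (exist _ a ab : A') c.
  have fE (c : A) : c != b -> val (f c) = c by move=> h; rewrite /f val_insubd h.
  have fb : val (f b) = a by rewrite /f val_insubd eqxx.
  have sf c : s c = s (val (f c)).
    by case: (eqVneq c b) => [->|/fE ->//]; rewrite fb esv cats0.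
  pose P' u' v' := exists u v, [/\ P u v, u' = f \o u & v' = f \o v].
  have [] := IH A' (fun c => s (val c)) P'.
  - by move=> c; apply: ne.
  - move: sz; rewrite (bigD1 b) //= => sz.
    have : (\sum_(c : A') size (s (val c)) = \sum_(i | i != b) size (s i))%N.
      rewrite [RHS](reindex_onto val f) => [|i /fE //]; apply: eq_bigl => c.
      by rewrite (valP c) -val_eqE fE ?(valP c) //= eqxx.
    by move=> ->; rewrite -ltnS; apply: leq_trans sz; rewrite -[X in (X < _)%N]add0n ltn_add2r.
  - move=> u' v' [u1 [v1 [/hP[y [yu yv]] -> ->]]]; exists y.
    have H w : spells s w y -> spells (fun c : A' => s (val c)) (f \o w) y.
      move=> hw m; have := hw m; rewrite /extend /mkseq -!map_comp.
      by rewrite (@eq_map _ _ ((fun c : A' => s (val c)) \o (f \o w)) (s \o w)) //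
        => i /=; rewrite -sf.
    by split; apply: H.
  move=> B [b1 [a1 [[na nb hd] hB]]]; exists B, (b1 \o f), a1; split.
    by split=> // c; [exact: nb|rewrite sf hd].
  apply: leq_trans hB _.
  pose g (h : {ffun A' -> bool}) : {ffun A -> bool} := [ffun c => h (f c)].
  rewrite -(@card_imset _ _ g) => [|h1 h2 /ffunP e12].
    apply: subset_leq_card; apply/fintype.subsetP => _ /imsetP[h hh ->].
    move: hh; rewrite !inE => /asboolP hh; apply/asboolP => u1 v1 h1.
    rewrite !ffunE; apply: (hh (f \o u1) (f \o v1)).
    by exists u1, v1.
  apply/ffunP => c; have := e12 (val c); rewrite !ffunE.
  by have -> : f (val c) = c by apply: val_inj; rewrite fE // (valP c).
have nab : a == b = false by apply/eqP.
pose be (c : A) := if c == b then [:: a; b] else [:: c].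
pose al (c : A) := if c == b then d0 :: d else s c.
have sE c : s c = extend al (be c).
  rewrite /be; case: eqP => [->|/eqP nc]; last by rewrite extend1 /al (negbTE nc).
  by rewrite extend_cons extend1 /al eqxx nab.
have nal : nonerasing al by move=> c; rewrite /al; case: ifP.
have nbe : nonerasing be by move=> c; rewrite /be; case: ifP.
have hbe u1 u1' : spells be u1 u1' -> u1' 0%N = (if u1 0%N == b then a else u1 0%N).
  by move=> h; rewrite (spells_head a nbe h) /be; case: ifP.
have hal y u1 u1' : spells s u1 y -> spells be u1 u1' -> spells al u1' y.
  move=> h1 h2; have [y' h3] := spells_exists nal u1'.
  suff -> : y = y' by [].
  apply: (spells_uniq ne h1) => m /=.
  have := spells_comp h2 h3 m => /=.
  by rewrite (_ : extend s _ = extend (fun c => extend al (be c)) (mkseq u1 m)) //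
    /extend; congr flatten; apply: eq_map.
have [u' hu'] := spells_exists nbe u; have [v' hv'] := spells_exists nbe v.
(* Words that began with [b] now begin with [a], so their links no longer reach [b]. The added pair
   of tails links [b], the second letter of [v'], to a letter other than [b]; a compatible function
   is thus determined by its values off [b]. *)
pose P' u1' v1' := (exists u1 v1, [/\ P u1 v1, spells be u1 u1' & spells be v1 v1'])
   \/ (u1' = stail u' /\ v1' = stail v').
have u'0 : u' 0%N = a by rewrite (hbe _ _ hu') -/a nab.
have v'0 : v' 0%N = a by rewrite (hbe _ _ hv') -/b eqxx.
have v'1 : v' 1%N = b by rewrite (spells_nth a hv') -/b /be eqxx.
have u'1 : u' 1%N != b.
  have := spells_behead hu'; rewrite -/a {2}/be nab /= => /hbe; rewrite addn0 => ->.
  by case: ifP => [_|->//]; rewrite nab.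
have [] := IH A al P' nal.
- rewrite -ltnS; apply: leq_trans sz.
  rewrite (bigD1 b) //= [X in (_ < X)%N](bigD1 b) //= esv size_cat {1}/al eqxx.
  rewrite (eq_bigr (fun i => size (s i))) => [|c nc]; last by rewrite /al (negbTE nc).
  by rewrite -addnA -[X in (X < _)%N]add0n ltn_add2r; apply: ne.
- move=> u1' v1' [[u1 [v1 [h1 h2 h3]]]|[-> ->]].
    by have [y [yu yv]] := hP _ _ h1; exists y; split; [exact: hal h2|exact: hal h3].
  exists (fun k => x (size (al a) + k)%N); split.
    by have := spells_behead (hal _ _ _ xu hu'); rewrite u'0.
  by have := spells_behead (hal _ _ _ xv hv'); rewrite v'0.
move=> B [b1 [a1 [[na nb hd] hB]]].
exists B, (fun c => extend b1 (be c)), a1; split.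
  split=> // [|c]; first exact: nonerasing_comp.
  by rewrite sE extend_comp; congr flatten; apply: eq_map.
apply: leq_trans hB _.
pose g (h : {ffun A -> bool}) : {ffun A -> bool} :=
  [ffun c => h (if c == b then a else c)].
rewrite -(@card_in_imset _ _ g) => [|h1 h2 + + /ffunP e12].
  apply: subset_leq_card; apply/fintype.subsetP => _ /imsetP[h hh ->].
  move: hh; rewrite !inE => /asboolP hh; apply/asboolP => u1 v1 h1.
  have [u1' hu1] := spells_exists nbe u1; have [v1' hv1] := spells_exists nbe v1.
  rewrite !ffunE -(hbe _ _ hu1) -(hbe _ _ hv1); apply: hh.
  by left; exists u1, v1.
rewrite !inE => /asboolP k1 /asboolP k2.
have E c : c != b -> h1 c = h2 c.
  by move=> nc; have := e12 c; rewrite !ffunE (negbTE nc).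
apply/ffunP => c; case: (eqVneq c b) => [->|/E //].
have := k1 (stail u') (stail v'); have := k2 (stail u') (stail v').
rewrite /stail v'1 => <-; last by right.
by move=> <-; [apply: E|right].
Qed.

(** The elementary morphisms of Ehrenfeucht and Rozenberg, with nonerasing factors. *)
Definition elementary (A : finType) (C : Type) (s : A -> seq C) : Prop :=
  forall B b a, @decomposes A C s B b a -> (#|A| <= #|B|)%N.

Lemma card_punctured (A : finType) (c : A) : #|{: {e : A | e != c}}| = #|A|.-1.
Proof. by rewrite card_sig -(cardC1 c); apply: eq_card. Qed.

Lemma card_inj_ffun (T I : finType) (S : {set T}) (g : T -> {ffun I -> bool}) :
  {in S &, injective g} -> (#|S| <= 2 ^ #|I|)%N.
Proof.
by move=> gi; rewrite -(card_in_imset gi) -card_bool -card_ffun max_card.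
Qed.

Section Elementary.
Variables (A : finType) (C : eqType) (s : A -> seq C).
Hypotheses (ne : nonerasing s) (el : elementary s).

(** If the first letters differed, this single pair would already link two letters. A compatible
    function would be determined off [u 0], and [defect] would give a factorization through fewer
    than [#|A|] letters. *)
Lemma elementary_head u v x : spells s u x -> spells s v x -> u 0%N = v 0%N.
Proof.
move=> hu hv; apply/eqP; apply: contrapT => /negP uv.
have [|B [b [a [dec]]]] := @defect C _ A s (fun u' v' => u' = u /\ v' = v) ne (leqnn _).
  by move=> _ _ [-> ->]; exists x.
pose g (h : {ffun A -> bool}) : {ffun {e : A | e != u 0%N} -> bool} :=
  [ffun c => h (val c)].
have /card_inj_ffun : {in compatible (fun u' v' => u' = u /\ v' = v) &, injective g}.
  move=> h h'; rewrite !inE => /asboolP k /asboolP k' /ffunP e.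
  have E c : c != u 0%N -> h c = h' c.
    by move=> nc; have := e (exist _ c nc); rewrite !ffunE.
  apply/ffunP => c; case: (eqVneq c (u 0%N)) => [->|/E//].
  by rewrite (k u v) // (k' u v) //; apply: E; rewrite eq_sym.
rewrite card_punctured => h1 h2; have := leq_trans h2 h1.
rewrite leq_exp2l //; have := el dec; have : (0 < #|A|)%N by apply/card_gt0P; exists (u 0%N).
by lia.
Qed.

Lemma elementary_inj u v x : spells s u x -> spells s v x -> u = v.
Proof.
move=> hu hv; apply/funext => n.
elim: n u v x hu hv => [|n IH] u v x hu hv; first exact: elementary_head hu hv.
have e := elementary_head hu hv; apply: (IH (stail u) (stail v)).
  exact: spells_behead hu.
by rewrite e; apply: spells_behead hv.
Qed.

(** The overhang [w] is treated as the image of an additional letter. *)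
Lemma elementary_overhang (w : seq C) u u' v v' x x' y y' : w != [::] ->
  spells s u x -> spells s u' x' -> spells s v y -> spells s v' y' ->
  (forall n, mkseq x (size w + n) = w ++ mkseq x' n) ->
  (forall n, mkseq y (size w + n) = w ++ mkseq y' n) -> u 0%N = v 0%N.
Proof.
move=> w0 hu hu' hv hv' ex ey; apply/eqP; apply: contrapT => /negP uv.
pose t (c : option A) := if c is Some c' then s c' else w.
have net : nonerasing t by case=> [c|] /=; [exact: ne|rewrite lt0n size_eq0].
have tS z r : spells s z r -> spells t (Some \o z) r.
  by move=> h n; have := h n; rewrite /extend /mkseq -!map_comp.
have tN z r r' : spells s z r -> (forall n, mkseq r' (size w + n) = w ++ mkseq r n) ->
    spells t (scons None (Some \o z)) r'.
  move=> /tS h e [|n] //=; rewrite mkseqS /= extend_cons.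
  by rewrite size_cat e; congr cat; apply: h.
pose P a b := (a = scons None (Some \o u') /\ b = Some \o u) \/
              (a = scons None (Some \o v') /\ b = Some \o v).
have [|B [b [a [dec]]]] := @defect C _ _ t P net (leqnn _).
  by move=> _ _ [[-> ->]|[-> ->]]; [exists x|exists y]; split;
    do ?[exact: tS|exact: tN hu' ex|exact: tN hv' ey].
pose g (h : {ffun option A -> bool}) : {ffun {e : A | e != u 0%N} -> bool} :=
  [ffun c => h (Some (val c))].
have /card_inj_ffun : {in compatible P &, injective g}.
  move=> h h'; rewrite !inE => /asboolP k /asboolP k' /ffunP e.
  have E c : c != u 0%N -> h (Some c) = h' (Some c).
    by move=> nc; have := e (exist _ c nc); rewrite !ffunE.
  have EN : h None = h' None.
    have := k (scons None (Some \o v')) (Some \o v) (or_intror (conj erefl erefl)).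
    have := k' (scons None (Some \o v')) (Some \o v) (or_intror (conj erefl erefl)).
    by rewrite /= => -> ->; apply: E; rewrite eq_sym.
  apply/ffunP => -[c|//]; case: (eqVneq c (u 0%N)) => [->|/E//].
  have := k (scons None (Some \o u')) (Some \o u) (or_introl (conj erefl erefl)).
  have := k' (scons None (Some \o u')) (Some \o u) (or_introl (conj erefl erefl)).
  by rewrite /= => <- <-.
(* The additional letter, [u 0] and [v 0] lie in one component, so [option A] has at most [#|A| - 1]
   components. Restricted to the letters [Some c], the factorization contradicts elementarity. *)
rewrite card_punctured => h1 h2; have := leq_trans h2 h1; rewrite leq_exp2l //.
have : decomposes s (fun c => b (Some c)) a.
  by case: dec => na nb d; split=> [//|c|c]; [exact: nb|exact: (d (Some c))].
move=> /el; have : (0 < #|A|)%N by apply/card_gt0P; exists (u 0%N).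
by lia.
Qed.

End Elementary.

Lemma elementary_rev (A : finType) (C : Type) (s : A -> seq C) :
  elementary s -> elementary (rev \o s).
Proof.
move=> el B b a [na nb d]; apply: (el B (rev \o b) (rev \o a)); split.
- by move=> c /=; rewrite size_rev.
- by move=> c /=; rewrite size_rev.
have R w : extend (rev \o a) (rev w) = rev (extend a w).
  elim: w => // c w IH; rewrite rev_cons -cats1 extend_cat extend1 IH.
  by rewrite extend_cons rev_cat.
by move=> c; have := d c; rewrite /= => e; rewrite R -e revK.
Qed.

Lemma map_iota_mkseq (T : Type) (f : nat -> T) a n :
  map f (iota a n) = mkseq (fun k => f (a + k)%N) n.
Proof. by rewrite /mkseq -{1}[a]addn0 iotaDl -map_comp. Qed.

Lemma parses_spells (A B : Type) (s : A -> seq B) y pos x (i : int) :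
  parses s y pos x ->
  spells s (fun n => y (i + n%:Z)) (fun n => x (pos i + n%:Z)).
Proof.
move=> h n /=; elim: n i => [|n IH] i //.
rewrite mkseqS extend_cons size_cat /= /stail.
rewrite [X in extend s (mkseq X _)](_ : _ = fun m : nat => y (i + 1 + m%:Z)); last first.
  by apply/funext => m; congr y; lia.
rewrite {1}IH [in RHS]/mkseq iotaD map_cat add0n addr0; congr cat.
  apply: (@eq_from_nth _ (x 0)) => [|k hk]; first by rewrite size_map size_iota.
  by rewrite (nth_map 0%N) ?size_iota // nth_iota // (parses_nth h i (x 0)).
rewrite map_iota_mkseq; apply: eq_mkseq => k /=.
by rewrite (parses_pos h); congr x; lia.
Qed.

Lemma mkseq_overhang (B : Type) (x : int -> B) (p : int) (d n : nat) :
  mkseq (fun k => x (p + k%:Z)) (d + n) =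
  mkseq (fun k => x (p + k%:Z)) d ++ mkseq (fun k => x (p + d%:Z + k%:Z)) n.
Proof.
rewrite /mkseq iotaD map_cat add0n; congr cat; rewrite map_iota_mkseq.
by apply: eq_mkseq => k; congr x; lia.
Qed.

Section Synchronization.
Variables (A : finType) (s : A -> seq A).
Hypotheses (ne : nonerasing s) (el : elementary s).

(** Two parses without common cut: the word overhanging a cut of the first one,
    up to a later cut of the second one, determines everything to its right. *)
Lemma overhang_determines x n : forall y pos y' pos',
  parses s y pos x -> parses s y' pos' x -> (forall i j : int, pos i <> pos' j) ->
  forall i j i' j' : int, pos i < pos' i' -> pos' i' - pos i = pos' j' - pos j ->
  (forall k : nat, k%:Z < pos' i' - pos i -> x (pos i + k%:Z) = x (pos j + k%:Z)) ->
  forall k : nat, (k < n)%N -> x (pos i + k%:Z) = x (pos j + k%:Z).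
Proof.
elim/ltn_ind: n => n IH y pos y' pos' h h' nc i j i' j' lt e agree k kn.
have yij : y i = y j.
  pose d := absz (pos' i' - pos i).
  have := @elementary_overhang _ _ s ne el (mkseq (fun k => x (pos i + k%:Z)) d)
    _ _ _ _ _ _ _ _ _ (parses_spells i h) (parses_spells i' h')
    (parses_spells j h) (parses_spells j' h').
  rewrite /= !addr0; apply.
  - by rewrite -size_eq0 size_mkseq; lia.
  - move=> m; rewrite size_mkseq mkseq_overhang; congr cat.
    by apply: eq_mkseq => r; congr x; lia.
  - move=> m; rewrite size_mkseq mkseq_overhang; congr cat.
      apply: (@eq_from_nth _ (x 0)); rewrite !size_mkseq // => r hr.
      by rewrite !nth_mkseq // agree //; lia.
    by apply: eq_mkseq => r; congr x; lia.
have pi := parses_pos h i; have pj := parses_pos h j.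
rewrite -yij in pj.
have blk (r : nat) : (r < size (s (y i)))%N -> x (pos i + r%:Z) = x (pos j + r%:Z).
  by move=> hr; rewrite (parses_nth h i (x 0)) // (parses_nth h j (x 0)) -?yij.
have nei := ne (y i).
case: (ltnP k (size (s (y i)))) => [/blk //|hk].
(* If the block ends before the cut [i'], the rest of the overhang serves again. Otherwise the part
   of the block beyond that cut is the new overhang, and the two parses exchange their roles. *)
case: (ltgtP (pos (i + 1)) (pos' i')) => [lt1|lt1|/nc//].
  have := IH (n - size (s (y i)))%N _ y pos y' pos' h h' nc (i + 1) (j + 1) i' j' lt1
    _ _ (k - size (s (y i)))%N.
  have -> : pos (i + 1) + (k - size (s (y i)))%N%:Z = pos i + k%:Z by lia.
  have -> : pos (j + 1) + (k - size (s (y i)))%N%:Z = pos j + k%:Z by lia.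
  apply; [lia|lia| |lia] => r hr.
  have := agree (r + size (s (y i)))%N.
  have -> : pos (i + 1) + r%:Z = pos i + (r + size (s (y i)))%N%:Z by lia.
  have -> : pos (j + 1) + r%:Z = pos j + (r + size (s (y i)))%N%:Z by lia.
  by apply; lia.
pose d := absz (pos' i' - pos i).
have := IH (n - d)%N _ y' pos' y pos h' h _ i' j' (i + 1) (j + 1) lt1
    _ _ (k - d)%N.
have -> : pos' i' + (k - d)%N%:Z = pos i + k%:Z by lia.
have -> : pos' j' + (k - d)%N%:Z = pos j + k%:Z by lia.
apply; [lia|by move=> ? ? /esym/nc|lia| |lia] => r hr.
have := blk (r + d)%N.
have -> : pos' i' + r%:Z = pos i + (r + d)%N%:Z by lia.
have -> : pos' j' + r%:Z = pos j + (r + d)%N%:Z by lia.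
by apply; lia.
Qed.

Lemma common_cut_right y pos y' pos' x (i i' : int) :
  parses s y pos x -> parses s y' pos' x -> pos i = pos' i' ->
  forall k : nat, y (i + k%:Z) = y' (i' + k%:Z).
Proof.
move=> h h' e k.
have := parses_spells i' h'; rewrite -e => /(elementary_inj ne el (parses_spells i h)).
by move=> /(congr1 (fun f => f k)).
Qed.

End Synchronization.

Section ElementaryRecognizable.
Variables (A : finType) (s : A -> seq A).
Hypotheses (ne : nonerasing s) (el : elementary s).

Let ner : nonerasing (rev \o s).
Proof. by move=> a; rewrite /= size_rev. Qed.

Lemma common_cut_shift y pos y' pos' x (i i' : int) :
  parses s y pos x -> parses s y' pos' x -> pos i = pos' i' ->
  exists m : int, y' = shift m y /\ forall i : int, pos' i = pos (i + m).
Proof.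
move=> h h' e; exists (i - i').
have ye : y' = shift (i - i') y.
  apply/funext => k; rewrite /shift; case: (lerP i' k) => hk.
    have := common_cut_right ne el h h' e (absz (k - i')).
    have -> : i + absz (k - i') = k + (i - i') by lia.
    by have -> : i' + absz (k - i') = k by lia.
  have := common_cut_right ner (elementary_rev el) (parses_rev h) (parses_rev h')
    (i := - i) (i' := - i') _ (absz (i' - k - 1)%R).
  rewrite !opprK e => /(_ erefl).
  have -> : -1 - (- i + absz (i' - k - 1)%R) = k + (i - i') by lia.
  by have -> : -1 - (- i' + absz (i' - k - 1)%R) = k by lia.
split=> //; apply: (@parses_pos_uniq _ _ s y' pos' (fun k : int => pos (k + (i - i'))) x x i') => //.
  by rewrite ye; apply: parses_shift_source.
by rewrite -e; congr pos; lia.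
Qed.

(** Without common cut, attach to each cut its distances to the neighbouring cuts of the other parse
    and the letters within distance about [K], the greatest block length. Finitely many states are
    possible, and two cuts in the same state see the same word on both sides, so [x] would be
    periodic. *)
Lemma elementary_recognizable y pos y' pos' x :
  parses s y pos x -> parses s y' pos' x ->
  ~ (exists2 p : nat, (0 < p)%N & forall i : int, x (i + p%:Z) = x i) ->
  exists m : int, y' = shift m y /\ forall i : int, pos' i = pos (i + m).
Proof.
move=> h h' np.
have [[i [i' e]]|nc] := pselect (exists i i' : int, pos i = pos' i').
  exact: common_cut_shift h h' e.
have {}nc (i j : int) : pos i <> pos' j by move=> e; apply: nc; exists i, j.
exfalso; apply: np.
pose K := \max_a size (s a).
have KP a : (size (s a) <= K)%N by apply: leq_bigmax.
have /choice[loc hloc] : forall i : int, exists j : int, pos' j < pos i < pos' (j + 1).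
  move=> i; have [j /andP[h1 h2]] := locate (parses_lt ne h') (pos i).
  by exists j; rewrite h2 andbT lt_neqAle h1 andbT; apply/eqP => /esym/nc.
pose st (i : nat) : ('I_K.+1 * 'I_K.+1 * {ffun 'I_K.+1 -> A} * {ffun 'I_K.+1 -> A})%type :=
  (inord (absz (pos' (loc i + 1) - pos i)%R), inord (absz (pos i - pos' (loc i))),
   [ffun k : 'I_K.+1 => x (pos i + k%:Z)], [ffun k : 'I_K.+1 => x (pos i - 1 - k%:Z)]).
have : exists i j : nat, (i < j)%N /\ st i = st j.
  apply: contrapT => nst.
  pose N := #|{: ('I_K.+1 * 'I_K.+1 * {ffun 'I_K.+1 -> A} * {ffun 'I_K.+1 -> A})%type}|.
  have : injective (fun i : 'I_N.+1 => st i).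
    move=> i j e; apply/val_inj; case: (ltngtP (val i) (val j)) => // lt; exfalso; apply: nst.
      by exists i, j.
    by exists j, i.
  by move=> /card_codom => hc; have := max_card (mem (codom (fun i : 'I_N.+1 => st i))); rewrite hc card_ord ltnn.
move=> [i [j [ij [e1 e2 e3 e4]]]].
have small (t : int) : pos' (loc t + 1) - pos' (loc t) <= K%:Z.
  by rewrite (parses_pos h'); have := KP (y' (loc t)); lia.
have := hloc i; have := hloc j; have := small i; have := small j => sj si hj hi.
have {}e1 : pos' (loc i + 1) - pos i = pos' (loc j + 1) - pos j.
  move/(congr1 val): e1; rewrite /= !inordK; lia.
have {}e2 : pos i - pos' (loc i) = pos j - pos' (loc j).
  move/(congr1 val): e2; rewrite /= !inordK; lia.
have right k : x (pos i + k%:Z) = x (pos j + k%:Z).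
  apply: (overhang_determines ne el h h' nc (i' := loc i + 1) (j' := loc j + 1)
    _ e1 _ (ltnSn k)); first by lia.
  move=> r hr; have rK : (r < K.+1)%N by lia.
  by move/ffunP/(_ (Ordinal rK)): e3; rewrite !ffunE.
have left k : x (pos i - 1 - k%:Z) = x (pos j - 1 - k%:Z).
  have := @overhang_determines _ _ ner (elementary_rev el) _ k.+1 _ _ _ _
    (parses_rev h) (parses_rev h') _ (- i%:Z) (- j%:Z) (- loc i) (- loc j) _ _ _ k (ltnSn k).
  rewrite !opprK => H.
  have -> : pos i - 1 - k%:Z = -1 - (- pos i + k%:Z) by lia.
  have -> : pos j - 1 - k%:Z = -1 - (- pos j + k%:Z) by lia.
  apply: H; [by move=> a b /oppr_inj/nc|by lia|by lia|move=> r hr].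
  have rK : (r < K.+1)%N by lia.
  move/ffunP/(_ (Ordinal rK)): e4; rewrite !ffunE /=.
  have -> : pos i - 1 - r%:Z = -1 - (- pos i + r%:Z) by lia.
  by have -> : pos j - 1 - r%:Z = -1 - (- pos j + r%:Z) by lia.
have lt : pos i%:Z < pos j%:Z.
  by have := cut_mono (parses_lt ne h) (i := i%:Z) (j := j%:Z); lia.
exists (absz (pos j%:Z - pos i%:Z)) => [|z]; first by lia.
case: (lerP (pos i) z) => hz.
  have := right (absz (z - pos i)).
  have -> : pos i + absz (z - pos i) = z by lia.
  by move=> ->; congr x; lia.
have := left (absz (pos i - 1 - z)%R).
have -> : pos i - 1 - (absz (pos i - 1 - z)%R)%:Z = z by lia.
by move=> ->; congr x; lia.
Qed.
End ElementaryRecognizable.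

(** A substitution that is not elementary is [a \o b] with a smaller alphabet
    [B] in the middle; the shift generated by [b] on [Y] satisfies the same
    hypotheses with respect to [b \o a]. *)
Lemma recognizable n : forall (A : finType) (s : A -> seq A) (Y : (int -> A) -> Prop),
  (#|A| <= n)%N -> nonerasing s ->
  (forall k y, Y y -> Y (shift k y)) ->
  (forall y pos x, Y y -> parses s y pos x -> Y x) ->
  (forall x, Y x -> exists y pos, Y y /\ parses s y pos x) ->
  (forall x, Y x -> ~ exists2 p : nat, (0 < p)%N & forall i : int, x (i + p%:Z) = x i) ->
  forall y pos y' pos' x, Y y -> Y y' -> parses s y pos x -> parses s y' pos' x ->
  exists m : int, y' = shift m y /\ forall i : int, pos' i = pos (i + m).
Proof.
elim: n => [|n IH] A s Y cA ne Ysh Yim Ypre Yap y pos y' pos' x Yy Yy' h h'.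
  have : (0 < #|A|)%N by apply/card_gt0P; exists (y 0).
  by lia.
have [el|] := pselect (elementary s).
  exact: elementary_recognizable ne el _ _ _ _ _ h h' (Yap _ (Yim _ _ _ Yy h)).
move=> /existsNP[B] /existsNP[b] /existsNP[a] /not_implyP[[na nb dec] /negP].
rewrite -ltnNge => BA.
have se : s = fun c => extend a (b c) by apply/funext.
pose Z z := exists y pos, Y y /\ parses b y pos z.
pose t c := extend b (a c).
have net : nonerasing t by apply: nonerasing_comp.
have rec : forall y pos y' pos' x, Z y -> Z y' -> parses t y pos x -> parses t y' pos' x ->
    exists m : int, y' = shift m y /\ forall i : int, pos' i = pos (i + m).
  apply: (IH B t Z) => //; first by lia.
  - move=> k z [y1 [p1 [h1 h2]]]; exists y1, (fun i : int => p1 i - k).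
    by split=> //; apply: parses_shift.
  - move=> z p z' [y1 [p1 [h1 h2]]] /parses_decomp -/(_ nb na)[p2 [y2 [p3 [_ h3 h4 _]]]].
    exists y2, p3; split=> //; apply: (Yim y1 (fun i => p2 (p1 i))) => //.
    by rewrite se; apply: parses_comp h2 h3.
  - move=> z [y1 [p1 [/Ypre[y2 [p2 [Yy2]]] +] h1]].
    rewrite se => /parses_decomp -/(_ na nb)[p3 [z3 [p4 [_ h3 h4 _]]]].
    exists z3, (fun i => p1 (p4 i)); split; first by exists y2, p3.
    exact: parses_comp h4 h1.
  (* A period [p] of [z] gives its [a]-image, which lies in [Y], the period [p3 p - p3 0]. *)
  - move=> z [y1 [p1 [h1 h2]]] [p p0 per].
    have [p3 [x3 [_ h3]]] := parses_exists na z 0.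
    apply: (Yap x3).
      apply: (Yim y1 (fun i => p3 (p1 i))) => //.
      by rewrite se; apply: parses_comp h2 h3.
    have zp : shift p%:Z z = z by apply/funext => i; rewrite /shift per.
    have := parses_shift_source p%:Z h3; rewrite zp => h4.
    have lt : p3 0 < p3 p%:Z by have := cut_mono (parses_lt na h3) (i := 0) (j := p%:Z); lia.
    exists (absz (p3 p%:Z - p3 0)%R) => [|i]; first by lia.
    have [|_] := parses_eq (i0 := 0) na (parses_shift (p3 p%:Z - p3 0) h4) h3.
      by rewrite add0r; lia.
    by move=> /(congr1 (fun f => f i)); rewrite /shift => <-; congr x3; lia.
rewrite se in h h'.
have [p1 [z [p2 [_ h1 h2 pe]]]] := parses_decomp na nb h.
have [p1' [z' [p2' [_ h1' h2' pe']]]] := parses_decomp na nb h'.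
(* A further application of [b] turns the two parses of [x] by [a] into parses of [w] by [t], which
   compares [z] with [z']. Then [y] and [y'] are desubstituted by [a], so that [z] has two parses by
   [t], which compares [y] with [y']. *)
have [p3 [w [_ h3]]] := parses_exists nb x 0.
have Zz : Z z by exists y, p1.
have Zz' : Z z' by exists y', p1'.
have [m [zz' e1]] := rec _ _ _ _ _ Zz Zz' (parses_comp h2 h3) (parses_comp h2' h3).
have {}e1 (i : int) : p2' i = p2 (i + m).
  by apply: (cut_inj (parses_lt nb h3)); apply: e1.
have pre v : Y v -> exists u p, Z u /\ parses a u p v.
  move=> /Ypre[v1 [q1 [Yv1]]]; rewrite se => /parses_decomp -/(_ na nb)[q2 [u [q3 [_ g1 g2 _]]]].
  by exists u, q3; split=> //; exists v1, q2.
have [u [p4 [Zu h4]]] := pre _ Yy; have [u' [p4' [Zu' h4']]] := pre _ Yy'.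
have h5 := parses_shift (- m) h1'; rewrite zz' shiftD addNr shift0 in h5.
have [m' [uu' e2]] := rec _ _ _ _ _ Zu Zu' (parses_comp h4 h1) (parses_comp h4' h5).
pose r := p4 m' - p4' 0.
rewrite uu' in h4'.
have [|e3 e4] := parses_eq (i0 := 0) na (parses_shift r (parses_shift_source m' h4)) h4'.
  by rewrite add0r /r; lia.
have e5 (i : int) : p1' i + m = p1 (i + r).
  have := @parses_pos_uniq _ _ b y' (fun i : int => p1' i - - m) (fun i : int => p1 (i + r)) z z (p4' 0) h5.
  rewrite -e4 => /(_ (parses_shift_source r h1)) H.
  have := e2 0; rewrite add0r => e6.
  have -> : p1' i + m = p1' i - - m by lia.
  by apply: H; rewrite e6; congr p1; rewrite /r; lia.
exists r; rewrite -e4; split=> // i.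
by rewrite pe' pe e1 e5.
Qed.

(** * Allowed words *)

Local Open Scope classical_set_scope.
Local Open Scope ring_scope.

Definition agree (A : Type) (N : nat) (x y : int -> A) : Prop :=
  forall k : int, - N%:Z <= k < N%:Z -> x k = y k.

Lemma agree_sym (A : Type) N (x y : int -> A) : agree N x y -> agree N y x.
Proof. by move=> h k /h ->. Qed.

Lemma agree_trans (A : Type) N (x y z : int -> A) :
  agree N x y -> agree N y z -> agree N x z.
Proof. by move=> h h' k hk; rewrite h ?h'. Qed.

Lemma agree_le (A : Type) M N (x y : int -> A) : (M <= N)%N -> agree N x y -> agree M x y.
Proof. by move=> MN h k hk; apply: h; lia. Qed.

Lemma agree_shift (A : Type) N (x y : int -> A) (k : int) :
  agree (N + absz k) x y -> agree N (shift k x) (shift k y).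
Proof. by move=> h j hj; apply: h; lia. Qed.

Lemma agree_factor d N (x y : int -> 'I_d) :
  agree N x y <-> Defs.factor x (- N%:Z) (N + N) = Defs.factor y (- N%:Z) (N + N).
Proof.
split=> [h|h k hk]; first by apply/eq_in_map => k; rewrite mem_iota => hk; apply: h; lia.
have hk' : (absz (k + N%:Z)%R < N + N)%N by lia.
have := congr1 (fun w => nth (x 0) w (absz (k + N%:Z)%R)) h.
by rewrite !nth_mkseq //; have -> : - N%:Z + (absz (k + N%:Z)%R)%:Z = k by lia.
Qed.

Lemma psum_agree (V : zmodType) N (g g' : int -> V) : agree N g g' ->
  forall i : int, - N%:Z <= i <= N%:Z -> psum g i = psum g' i.
Proof.
move=> h [n|n] hn /=; last congr (- _); apply: eq_bigr => k _; apply: h;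
  have := ltn_ord k; lia.
Qed.

(** * Compactness of spaces of words along a free ultrafilter *)

Section UltraLimit.
Variable (U : set_system nat).
Hypotheses (UU : UltraFilter U) (Uoo : forall N, U [set n | (N <= n)%N]).

Lemma ultra_finite (A : finType) (f : nat -> A) : exists a, U [set n | f n = a].
Proof.
apply: contrapT => nA.
have : forall s : seq A, U [set n | f n \notin s].
  elim=> [|a s IH]; first by apply: filterS filterT.
  have [Ua|Ua] := @in_ultra_setVsetC _ U [set n | f n = a] UU.
    by exfalso; apply: nA; exists a.
  apply: filterS (filterI IH Ua) => n [/= h1 h2].
  by rewrite inE negb_or h1 andbT; apply/eqP.
by move=> /(_ (enum A)) /filter_ex [n /=]; rewrite mem_enum.
Qed.

Lemma ultra_all (P : nat -> nat -> Prop) (m : nat) :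
  (forall i, (i < m)%N -> U [set n | P i n]) ->
  U [set n | forall i, (i < m)%N -> P i n].
Proof.
elim: m => [|m IH] h; first by apply: filterS filterT.
have h1 := h m (ltnSn m).
have h2 : U [set n | forall i, (i < m)%N -> P i n] by apply: IH => i im; apply: h; lia.
apply: filterS (filterI h1 h2) => n [/= h3 h4] i; rewrite ltnS leq_eqVlt.
by case/orP => [/eqP -> //|/h4].
Qed.

Definition ultralimit (A : Type) (x_ : nat -> int -> A) (x : int -> A) : Prop :=
  forall N, U [set n | agree N (x_ n) x].

Lemma ultralimit_exists (A : finType) (x_ : nat -> int -> A) :
  exists x, ultralimit x_ x.
Proof.
have /choice[x hx] : forall k : int, exists a, U [set n | x_ n k = a].
  by move=> k; apply: ultra_finite.
exists x => N.
have h (i : nat) : (i < N + N)%N -> U [set n | x_ n (i%:Z - N%:Z) = x (i%:Z - N%:Z)].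
  by move=> _; apply: hx.
apply: filterS (ultra_all h) => n /= hn k hk.
have -> : k = (absz (k + N%:Z)%R)%:Z - N%:Z by lia.
by apply: hn; lia.
Qed.

Lemma ultralimit_eq (A : finType) (x_ y_ : nat -> int -> A) x y :
  ultralimit x_ x -> ultralimit y_ y -> (forall n, agree n (x_ n) (y_ n)) -> x = y.
Proof.
move=> hx hy h; apply/funext => k.
have N : - (absz k).+1%:Z <= k < (absz k).+1%:Z by lia.
have [n [[/= h1 h2] h3]] := filter_ex (filterI (filterI (hx (absz k).+1) (hy (absz k).+1)) (Uoo (absz k).+1)).
by rewrite -(h1 _ N) -(h2 _ N) (agree_le h3 (h n)).
Qed.

Lemma ultra_bounded (p_ : nat -> int) (K : nat) :
  (forall n, - K%:Z <= p_ n <= K%:Z) -> exists p, U [set n | p_ n = p].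
Proof.
move=> h; have [i hi] := ultra_finite (fun n => inord (absz (p_ n + K%:Z)%R) : 'I_(K + K).+1).
exists ((val i)%:Z - K%:Z); apply: filterS hi => n /= /(congr1 val) /=.
by rewrite inordK; have := h n; lia.
Qed.

Lemma parses_ultralimit (A : finType) (s : A -> seq A) y_ p_ x_ y p x :
  nonerasing s -> (forall n, parses s (y_ n) (p_ n) (x_ n)) ->
  ultralimit y_ y -> ultralimit x_ x -> U [set n | p_ n 0 = p] ->
  exists pos : int -> int, pos 0 = p /\ parses s y pos x.
Proof.
move=> ne h hy hx hp.
have [pos [x' [pos0 h']]] := parses_exists ne y p.
exists pos; split=> //; suff -> : x = x' by [].
apply/funext => z; have [i /andP[iz zi]] := locate (parses_lt ne h') z.
have [n [[/= ay ax] ep]] := filter_ex (filterI (filterI (hy (absz i).+2) (hx (absz z).+1)) hp).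
have e (k : int) : - (absz i).+2%:Z <= k <= (absz i).+2%:Z -> p_ n k = pos k.
  move=> hk; rewrite (psum_uniq (parses_pos (h n))) (psum_uniq (parses_pos h')).
  by rewrite ep pos0; congr (_ + _); apply: psum_agree hk => j /ay ->.
have ei : p_ n i = pos i by apply: e; lia.
have yi : y_ n i = y i by apply: ay; lia.
have sz := parses_pos h' i.
have hk : (absz (z - pos i)%R < size (s (y i)))%N by lia.
rewrite -ax; last by lia.
have -> : z = pos i + (absz (z - pos i)%R)%:Z by lia.
by rewrite (parses_nth h' i (x 0)) // -{1}ei (parses_nth (h n) i (x 0)) yi.
Qed.

End UltraLimit.

Lemma free_ultrafilter : exists U : set_system nat,
  UltraFilter U /\ forall N, U [set n | (N <= n)%N].
Proof.
have [U [UU h]] := ultraFilterLemma eventually_filter.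
by exists U; split=> // N; apply: h; exists N.
Qed.

Lemma extend_infix (A B : eqType) (s : A -> seq B) u v :
  infix u v -> infix (extend s u) (extend s v).
Proof.
by move=> /infixP[p [q ->]]; rewrite !extend_cat; apply/infixP; exists (extend s p), (extend s q).
Qed.

Lemma mkseqS_rcons (T : Type) (f : nat -> T) n :
  mkseq f n.+1 = rcons (mkseq f n) (f n).
Proof. by rewrite /mkseq -addn1 iotaD map_cat cats1. Qed.

Lemma parses_size (A B : Type) (s : A -> seq B) y pos x (i : int) (n : nat) :
  parses s y pos x ->
  pos (i + n%:Z) = pos i + (size (extend s (mkseq (fun k => y (i + k%:Z)) n)))%:Z.
Proof.
move=> h; elim: n => [|n IH]; first by rewrite !addr0.
have -> : i + n.+1%:Z = i + n%:Z + 1 by lia.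
rewrite (parses_pos h) IH mkseqS_rcons -cats1 extend_cat extend1 size_cat.
by lia.
Qed.

Section Language.
Variables (d : nat) (phi : substitution d).
Implicit Types (x y : int -> 'I_d) (u v : seq 'I_d).

Lemma size_factor x i n : size (Defs.factor x i n) = n.
Proof. by rewrite size_mkseq. Qed.

Lemma factor_cat x (i : int) m n :
  Defs.factor x i (m + n) = Defs.factor x i m ++ Defs.factor x (i + m%:Z) n.
Proof. exact: mkseq_overhang. Qed.

Lemma factor_shift x (i k : int) n : Defs.factor (shift k x) i n = Defs.factor x (i + k) n.
Proof. by apply: eq_mkseq => j; rewrite /shift; congr x; lia. Qed.

Lemma factor_infix x (i j : int) m n : i <= j -> j + m%:Z <= i + n%:Z ->
  infix (Defs.factor x j m) (Defs.factor x i n).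
Proof.
move=> ij jm; apply/infixP.
exists (Defs.factor x i (absz (j - i)%R)),
  (Defs.factor x (j + m%:Z) (absz (i + n%:Z - j - m%:Z)%R)).
have -> : n = (absz (j - i)%R + (m + absz (i + n%:Z - j - m%:Z)%R))%N by lia.
rewrite !factor_cat; have -> : i + (absz (j - i)%R)%:Z = j by lia.
by congr (_ ++ (_ ++ Defs.factor _ _ _)); lia.
Qed.

Lemma parses_factor (s : 'I_d -> seq 'I_d) y pos x (i : int) n : parses s y pos x ->
  extend s (Defs.factor y i n) =
  Defs.factor x (pos i) (size (extend s (Defs.factor y i n))).
Proof. by move=> h; apply: (parses_spells i h). Qed.

Definition power (n : nat) (a : 'I_d) : seq 'I_d := iter n (subst_word phi) [:: a].

Lemma iter_extend n u : iter n (subst_word phi) u = extend (power n) u.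
Proof.
elim: n u => [|n IH] u /=; first by elim: u => //= a u {1}->.
by rewrite IH; apply: extend_comp.
Qed.

Lemma powerD m n : power (m + n) = (fun c => extend (power m) (power n c)).
Proof. by apply/funext => c; rewrite /power iterD iter_extend. Qed.

Lemma power1 : power 1 = phi.
Proof. by apply/funext => c; rewrite /power /= /subst_word /= cats0. Qed.

Lemma nonerasing_subst : nonerasing phi.
Proof. by move=> a; rewrite lt0n size_eq0 subst_letter_neq0. Qed.

Lemma nonerasing_power n : nonerasing (power n).
Proof.
elim: n => [|n IH]; first by [].
rewrite -addn1 powerD => a; apply: (nonerasing_comp IH); rewrite power1; exact: nonerasing_subst.
Qed.

Lemma occurs_infix u v : infix u v -> occurs phi v -> occurs phi u.
Proof. by move=> uv [n [i h]]; exists n, i; apply: infix_trans h. Qed.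

Lemma allowedP u : allowed phi u <-> occurs phi u.
Proof. by split=> [|h v vu]; [apply; apply: infix_refl|apply: occurs_infix h]. Qed.

Lemma occurs_power n u : occurs phi u -> occurs phi (extend (power n) u).
Proof.
move=> [m [i h]]; exists (n + m)%N, i; rewrite iterD [X in infix _ X]iter_extend.
exact: extend_infix.
Qed.

Lemma biallowed_shift k x : biallowed phi x -> biallowed phi (shift k x).
Proof. by move=> h i n; rewrite factor_shift. Qed.

Lemma biallowed_image n y pos x : biallowed phi y -> parses (power n) y pos x ->
  biallowed phi x.
Proof.
move=> hy h z m; have lt := parses_lt (@nonerasing_power n) h.
have [i /andP[iz _]] := locate lt z; have [j /andP[_ zj]] := locate lt (z + m%:Z).
have ij : i < j + 1 by apply: (cut_lt lt); lia.
have e := parses_size i (absz (j + 1 - i)%R) h.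
have ej : i + (absz (j + 1 - i)%R)%:Z = j + 1 by lia.
rewrite ej in e.
apply: occurs_infix (occurs_power n (hy i (absz (j + 1 - i)%R))).
by rewrite (parses_factor i _ h); apply: factor_infix; rewrite ?e // -?e; lia.
Qed.

(** Each window of [x] occurs in the image of some phi^n(i). The finite preimages, recentred at the
    block that contains the origin, converge along the ultrafilter to a preimage of all of [x]. *)
Lemma biallowed_preimage1 x : biallowed phi x ->
  exists y pos, biallowed phi y /\ parses phi y pos x.
Proof.
move=> hx; have [U [UU Uoo]] := free_ultrafilter.
pose K := \max_a size (phi a).
have KP a : (size (phi a) <= K)%N by apply: leq_bigmax.
have ne := nonerasing_subst.
have /choice[f hf] : forall r : nat, exists t : (int -> 'I_d) * (int -> int) * (int -> 'I_d),
    [/\ parses phi t.1.1 t.1.2 t.2, agree r t.2 x, - K%:Z <= t.1.2 0 <= K%:Z &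
     forall (i : int) n, - r%:Z <= t.1.2 i -> t.1.2 (i + n%:Z) <= r%:Z ->
       occurs phi (Defs.factor t.1.1 i n)].
  move=> r.
  (* The radius [r.+1] makes the window at least two letters long, which excludes the iterate 0. *)
  have [[|n] [i /infixP[s1 [s2 e]]]] := hx (- r.+1%:Z) (r.+1 + r.+1)%N.
    by move/(congr1 size): e; rewrite !size_cat size_factor /=; lia.
  pose w := iter n (subst_word phi) [:: i].
  (* Outside [w] the word [V] is filled with [i] and need not be allowed; hence only the factors
     with cuts in [-r, r] are claimed to occur. *)
  pose V (k : int) := if k is Posz m then nth i w m else i.
  have Vw : Defs.factor V 0 (size w) = w.
    by rewrite -[RHS](mkseq_nth i); apply: eq_mkseq => k; rewrite add0r.
  have [pos [X [pos0 h]]] := parses_exists ne V 0.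
  have eX := parses_factor 0 (size w) h; rewrite Vw pos0 in eX.
  have {}eX : Defs.factor X 0 (size (s1 ++ Defs.factor x (- r.+1%:Z) (r.+1 + r.+1) ++ s2))
      = s1 ++ Defs.factor x (- r.+1%:Z) (r.+1 + r.+1) ++ s2.
    by rewrite -e; apply: esym.
  have [z zE] : exists z : int, z = (size s1)%:Z + r.+1%:Z by eexists.
  have [j /andP[jz zj]] := locate (parses_lt ne h) z.
  exists (shift j V, (fun k : int => pos (k + j) - z), shift z X); split=> /=.
  - exact: parses_shift (parses_shift_source _ h).
  - move=> k hk; have hk' : (absz (k + r.+1%:Z)%R < r.+1 + r.+1)%N by lia.
    have := congr1 (fun w => nth i w (size s1 + absz (k + r.+1%:Z)%R)%N) eX.
    cbv beta; rewrite [X in _ = X -> _]nth_cat ltnNge leq_addr addKn nth_cat size_factor hk'.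
    rewrite !nth_mkseq //; last by rewrite !size_cat size_factor; lia.
    move=> E; rewrite /shift.
    have -> : k + z = 0 + (size s1 + absz (k + r.+1%:Z)%R)%N%:Z by rewrite zE; lia.
    by rewrite E; congr x; lia.
  - by rewrite add0r; have := parses_pos h j; have := KP (V j); lia.
  - move=> k m hk hm; rewrite factor_shift.
    have lt := parses_lt ne h.
    have k0 : 0 <= k + j.
      by rewrite leNgt; apply/negP => ng; have := cut_mono lt (ltW ng); rewrite pos0; lia.
    have km : k + j + m%:Z <= (size w)%:Z.
      rewrite leNgt; apply/negP => lt2.
      have := cut_mono lt (ltW lt2).
      have := parses_size 0 (size w) h; rewrite add0r pos0 add0r -/(Defs.factor V 0 _) Vw => ->.
      have -> : size (extend phi w) = (size s1 + ((r.+1 + r.+1) + size s2))%N.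
        by have := congr1 size e; rewrite !size_cat size_factor.
      have -> : k + j + m%:Z = k + m%:Z + j by lia.
      by lia.
    have ow : occurs phi w by exists n, i; apply: infix_refl.
    rewrite -Vw in ow; apply: occurs_infix ow; exact: factor_infix.
have [y hy] := ultralimit_exists UU (fun r => (f r).1.1).
have [hf1 hf2 hf3 hf4] := all_and4 hf.
have [p hp] := ultra_bounded (p_ := fun r => (f r).1.2 0) UU hf3.
have hxl : ultralimit U (fun r => (f r).2) x.
  move=> N; apply: filterS (Uoo N) => r /= Nr.
  exact: agree_le (hf2 r).
have [pos [pos0 h]] := parses_ultralimit UU ne hf1 hy hxl hp.
exists y, pos; split=> // i n.
pose N := (absz i + n)%N.
have [r [[/= h1 h2] h3]] := filter_ex (filterI (filterI (hy N.+1) hp) (Uoo (K + K * N.+1).+1)).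
have -> : Defs.factor y i n = Defs.factor (f r).1.1 i n.
  by apply/eq_in_map => k; rewrite mem_iota => hk; apply/esym/h1; rewrite /N; lia.
have g1 := hf1 r; have g2 := hf3 r; rewrite h2 in g2; have g3 := hf4 r.
(* Cuts of index at most [N] stay in a window fixed in advance, so for large [r] the factor lies in
   the controlled part of the approximation. *)
have bnd (m : int) : - N%:Z <= m <= N%:Z -> - (K + K * N)%N%:Z <= (f r).1.2 m <= (K + K * N)%N%:Z.
  have up (m' : nat) : (f r).1.2 m'%:Z <= K%:Z + (K * m')%N%:Z.
    elim: m' => [|m' IH]; first by rewrite h2; lia.
    have -> : m'.+1%:Z = m'%:Z + 1 :> int by lia.
    by rewrite (parses_pos g1); have := KP ((f r).1.1 m'%:Z); rewrite mulnS; lia.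
  have dn (m' : nat) : - K%:Z - (K * m')%N%:Z <= (f r).1.2 (- m'%:Z).
    elim: m' => [|m' IH]; first by rewrite oppr0 h2; lia.
    have := parses_pos g1 (- m'.+1%:Z); have -> : - m'.+1%:Z + 1 = - m'%:Z :> int by lia.
    by have := KP ((f r).1.1 (- m'.+1%:Z)); rewrite mulnS; lia.
  have lt := parses_lt ne g1.
  move=> /andP[m1 m2]; have := up N; have := dn N.
  by have := cut_mono lt m1; have := cut_mono lt m2; lia.
have b1 := bnd i ltac:(rewrite /N; lia); have b2 := bnd (i + n%:Z) ltac:(rewrite /N; lia).
have KN : (K * N.+1 = K + K * N)%N by rewrite mulnS.
by apply: g3; lia.
Qed.

Lemma biallowed_preimage n x : biallowed phi x ->
  exists y pos, biallowed phi y /\ parses (power n) y pos x.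
Proof.
elim: n x => [|n IH] x hx.
  exists x, id; split=> //; split=> [i|i k b0] //=.
  by rewrite ltnS leqn0 => /eqP ->; rewrite addr0.
have [z [p [hz h1]]] := IH _ hx; have [y [q [hy h2]]] := biallowed_preimage1 hz.
exists y, (fun i => p (q i)); split=> //.
by rewrite -addn1 powerD power1; apply: parses_comp h2 h1.
Qed.

End Language.

Lemma infix_factor d (x : int -> 'I_d) u (p : int) m : infix u (Defs.factor x p m) ->
  exists i : int, Defs.factor x i (size u) = u.
Proof.
move=> /infixP[s1 [s2 e]]; exists (p + (size s1)%:Z).
have em : m = (size s1 + (size u + size s2))%N.
  by move/(congr1 size): e; rewrite size_factor !size_cat.
move: e; rewrite em !factor_cat => /eqP; rewrite eqseq_cat ?size_factor //.
by move=> /andP[_]; rewrite eqseq_cat ?size_factor // => /andP[/eqP].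
Qed.

Lemma biallowed_ultralimit d (phi : substitution d) (U : set_system nat) x_ x :
  UltraFilter U -> ultralimit U x_ x ->
  (forall n, biallowed phi (x_ n)) -> biallowed phi x.
Proof.
move=> UU hx hb i n; have [r /= h] := filter_ex (hx (absz i + n).+1).
suff -> : Defs.factor x i n = Defs.factor (x_ r) i n by apply: hb.
by apply/eq_in_map => k; rewrite mem_iota => hk; apply/esym/h; lia.
Qed.

(** * Minimality, aperiodicity, and uniqueness and locality of desubstitution *)

Section Recognizability.
Variables (d : nat) (phi : substitution d).
Hypotheses (prim : primitive phi) (aper : aperiodic phi).
Implicit Types (x y : int -> 'I_d).

(** Minimality: [x] is made of blocks phi^(n+N)(b), and by primitivity each of them contains every
    phi^n(a). *)
Lemma occurs_everywhere x u : biallowed phi x -> occurs phi u ->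
  exists i : int, Defs.factor x i (size u) = u.
Proof.
move=> hx [n [a ua]]; have [N hN] := prim.
have [y [pos [_ h]]] := biallowed_preimage (n + N) hx.
have /= := parses_factor 0 1 h.
have -> : extend (power phi (n + N)) (Defs.factor y 0 1) = power phi (n + N) (y 0).
  by rewrite /Defs.factor /mkseq /= extend1 addr0.
move=> e; apply: (@infix_factor _ _ _ (pos 0) (size (power phi (n + N) (y 0)))).
apply: infix_trans ua _; rewrite -e powerD.
rewrite -[iter _ _ _]/(power phi n a) -[power phi n a]extend1.
by apply: extend_infix; rewrite infix1s; apply: (hN N (leqnn _)).
Qed.

(** All factors of length p + 1 of the given aperiodic word occur in [x], so a period of [x] would
    be one of that word. *)
Lemma biallowed_aperiodic x : biallowed phi x ->
  ~ exists2 p : nat, (0 < p)%N & forall i : int, x (i + p%:Z) = x i.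
Proof.
move=> hx [p p0 per]; have [w [hw _ nw]] := aper; apply: nw; exists p => // i.
have [j] := occurs_everywhere hx (hw i p.+1); rewrite size_factor => e.
have e0 := congr1 (fun u => nth (x 0) u 0%N) e.
have ep := congr1 (fun u => nth (x 0) u p) e.
rewrite !nth_mkseq // in ep; rewrite !nth_mkseq // !addr0 in e0.
by rewrite -ep per e0.
Qed.

Lemma biallowed_exists : exists x, biallowed phi x.
Proof. by have [w [hw _ _]] := aper; exists w. Qed.

Lemma biallowed_factor u : occurs phi u ->
  exists2 x, biallowed phi x & Defs.factor x 0 (size u) = u.
Proof.
move=> hu; have [x hx] := biallowed_exists.
have [i e] := occurs_everywhere hx hu; exists (shift i x).
  exact: biallowed_shift.
by rewrite factor_shift add0r.
Qed.

Lemma recognizable_power n y pos y' pos' x :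
  biallowed phi y -> biallowed phi y' ->
  parses (power phi n) y pos x -> parses (power phi n) y' pos' x ->
  exists m : int, y' = shift m y /\ forall i : int, pos' i = pos (i + m).
Proof.
apply: (@recognizable #|'I_d| _ (power phi n) (biallowed phi)) => //.
- exact: nonerasing_power.
- by move=> k z; apply: biallowed_shift.
- by move=> z p x'; apply: biallowed_image.
- exact: biallowed_preimage.
- exact: biallowed_aperiodic.
Qed.

(** Aperiodicity forces two letters and primitivity puts all of them in phi^N(a), so phi^N at least
    doubles lengths. *)
Lemma size_power_large L : exists n0, forall n a, (n0 <= n)%N -> (L <= size (power phi n a))%N.
Proof.
have [N hN] := prim.
have d2 : (1 < d)%N.
  have [w [_ _ nw]] := aper; rewrite ltnNge; apply/negP => d1; apply: nw.
  exists 1%N => // i; apply/val_inj => /=.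
  by have := ltn_ord (w (i + 1%N%:Z)); have := ltn_ord (w i); lia.
have two a : (2 <= size (power phi N a))%N.
  apply: leq_trans d2 _; rewrite -[d in (d <= _)%N]card_ord cardE.
  by apply: uniq_leq_size (enum_uniq _) _ => b _; apply: hN.
have twice u : (2 * size u <= size (extend (power phi N) u))%N.
  elim: u => // a u IH; rewrite extend_cons size_cat /=; have := two a; lia.
have big k a : (k < size (power phi (k * N) a))%N.
  elim: k => // k IH; rewrite mulSn powerD; have := twice (power phi (k * N) a); lia.
exists (L * N)%N => n a hn; rewrite -(subnK hn) powerD.
apply: leq_trans (ltnW (big L a)) _.
exact: size_extend_ge (@nonerasing_power _ phi _).
Qed.

(** [y] is the desubstitution of [x], indexed so that the origin of [x] lies in
    the block of [y 0]. *)
Definition addressed n x y pos : Prop :=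
  [/\ biallowed phi y, parses (power phi n) y pos x & pos 0 <= 0 < pos 1].

Lemma addressed_exists n x : biallowed phi x -> exists y pos, addressed n x y pos.
Proof.
move=> hx; have [y [pos [hy h]]] := biallowed_preimage n hx.
have [i hi] := locate (parses_lt (@nonerasing_power _ phi n) h) 0.
exists (shift i y), (fun j : int => pos (j + i)); split.
- exact: biallowed_shift.
- exact: parses_shift_source.
- by rewrite add0r addrC.
Qed.

Lemma addressed_uniq n x y pos y' pos' : addressed n x y pos ->
  addressed n x y' pos' -> y = y' /\ pos = pos'.
Proof.
move=> [hy h p01] [hy' h' p01'].
have [m [-> e]] := recognizable_power hy hy' h h'.
have lt := parses_lt (@nonerasing_power _ phi n) h.
suff m0 : m = 0.
  by rewrite m0 shift0; split=> //; apply/funext => i; rewrite e m0 addr0.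
move: p01 p01'; rewrite !e add0r => /andP[a1 a2] /andP[a3 a4].
have lt1 : 0 < 1 + m by apply: (cut_lt lt); apply: le_lt_trans a1 a4.
have lt2 : m < 1 by apply: (cut_lt lt); apply: le_lt_trans a3 a2.
by lia.
Qed.

Lemma addressed_local n R : exists r, forall x x' y y' pos pos',
  addressed n x y pos -> addressed n x' y' pos' -> agree r x x' ->
  pos 0 = pos' 0 /\ agree R y y'.
Proof.
apply: contrapT => nr; have [U [UU Uoo]] := free_ultrafilter.
have ne := @nonerasing_power _ phi n.
have /choice[f hf] : forall r, exists f : ((int -> 'I_d) * (int -> 'I_d) * (int -> int)) *
    ((int -> 'I_d) * (int -> 'I_d) * (int -> int)),
    [/\ addressed n f.1.1.1 f.1.1.2 f.1.2, addressed n f.2.1.1 f.2.1.2 f.2.2,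
       agree r f.1.1.1 f.2.1.1 &
       ~ (f.1.2 0 = f.2.2 0 /\ agree R f.1.1.2 f.2.1.2)].
  move=> r; apply: contrapT => nf; apply: nr; exists r => x x' y y' pos pos' h h' a.
  by apply: contrapT => np; apply: nf; exists ((x, y, pos), (x', y', pos')).
have [h1 h2 h3 h4] := all_and4 hf.
have lim (x_ y_ : nat -> int -> 'I_d) (p_ : nat -> int -> int) : (forall r, addressed n (x_ r) (y_ r) (p_ r)) ->
    exists x y p pos, [/\ ultralimit U x_ x, ultralimit U y_ y, pos 0 = p,
      U [set r | p_ r 0 = p] & addressed n x y pos].
  move=> h; have [g1 g2 g3] := all_and3 h.
  have [x hx] := ultralimit_exists UU x_; have [y hy] := ultralimit_exists UU y_.
  pose K := \max_a size (power phi n a).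
  have KP a : (size (power phi n a) <= K)%N by apply: leq_bigmax.
  have [p hp] : exists p, U [set r | p_ r 0 = p].
    apply: (@ultra_bounded _ UU (fun r => p_ r 0) K) => r.
    have := g3 r; have := parses_pos (g2 r) 0; rewrite add0r.
    by have := KP (y_ r 0); lia.
  have [pos [pos0 hpos]] := parses_ultralimit UU ne g2 hy hx hp.
  exists x, y, p, pos; split=> //; split=> //.
    exact: biallowed_ultralimit hy g1.
  have [r [/= e1 e2]] := filter_ex (filterI hp (hy 1%N)).
  have q1 : pos 1 = p + (size (power phi n (y 0)))%:Z.
    by have := parses_pos hpos 0; rewrite pos0.
  have q2 : p_ r 1 = p + (size (power phi n (y 0)))%:Z.
    by have := parses_pos (g2 r) 0; rewrite e1 (e2 0).
  by have := g3 r; rewrite e1 q2 pos0 q1.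
have [x [y [p [pos [hx hy p0 hp ad]]]]] := lim _ _ _ h1.
have [x' [y' [p' [pos' [hx' hy' p0' hp' ad']]]]] := lim _ _ _ h2.
have exx := ultralimit_eq UU Uoo hx hx' h3; rewrite -exx in ad'.
have [ey ep] := addressed_uniq ad ad'.
have [r [[[/= e1 e2] e3] e4]] := filter_ex (filterI (filterI (filterI hp hp') (hy R)) (hy' R)).
apply: (h4 r); split; first by rewrite e1 e2 -p0 -p0' ep.
by apply: agree_trans e3 _; rewrite ey; apply: agree_sym.
Qed.

End Recognizability.

(** * Locally constant functions up to coboundary *)

Section LocallyConstant.
Variables (d : nat) (phi : substitution d).

Definition locconst (V : Type) (f : (int -> 'I_d) -> V) : Prop :=
  exists r, forall x x', biallowed phi x -> biallowed phi x' -> agree r x x' -> f x = f x'.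

(** The difference is taken with the preceding word, so that [f x] is the change of [u] across the
    vertex at the origin of [x]. *)
Definition coboundary (f : (int -> 'I_d) -> int) : Prop :=
  exists2 u, locconst u & forall x, biallowed phi x -> f x = u x - u (shift (-1) x).

End LocallyConstant.

Section Cohomologous.
Variables (d : nat) (phi : substitution d).
Local Notation locconst := (locconst phi).
Local Notation coboundary := (coboundary phi).
Local Notation Omega := (biallowed phi).
Implicit Types (x y : int -> 'I_d) (f g : (int -> 'I_d) -> int).

Lemma locconst_le V (f : (int -> 'I_d) -> V) r r' : (r <= r')%N ->
  (forall x x', Omega x -> Omega x' -> agree r x x' -> f x = f x') ->
  forall x x', Omega x -> Omega x' -> agree r' x x' -> f x = f x'.
Proof. by move=> rr h x x' hx hx' /(agree_le rr); apply: h. Qed.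

Lemma locconst_op2 V1 V2 V (op : V1 -> V2 -> V)
    (f1 : (int -> 'I_d) -> V1) (f2 : (int -> 'I_d) -> V2) : locconst f1 -> locconst f2 ->
  locconst (fun x => op (f1 x) (f2 x)).
Proof.
move=> [r1 h1] [r2 h2]; exists (maxn r1 r2) => x x' hx hx' ag; congr op.
  by apply: (locconst_le _ h1) ag; rewrite ?leq_maxl.
by apply: (locconst_le _ h2) ag; rewrite ?leq_maxr.
Qed.

Lemma locconst_cst V (v : V) : locconst (fun _ => v).
Proof. by exists 0%N. Qed.

Lemma locconst_shift V (f : (int -> 'I_d) -> V) (k : int) : locconst f ->
  locconst (fun x => f (shift k x)).
Proof.
move=> [r h]; exists (r + absz k)%N => x x' hx hx' ag.
by apply: h; [exact: biallowed_shift|exact: biallowed_shift|exact: agree_shift].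
Qed.

Lemma locconst_sum f (n : nat) (k : nat -> int) : locconst f ->
  locconst (fun x => \sum_(i < n) f (shift (k i) x)).
Proof.
move=> hf; elim: n => [|n IH].
  by exists 0%N => x x' _ _ _; rewrite !big_ord0.
have [r hr] := locconst_op2 +%R IH (locconst_shift (k n) hf).
by exists r => x x' hx hx' ag; rewrite !big_ord_recr; exact: hr.
Qed.

Lemma coboundary_eq f g : (forall x, Omega x -> f x = g x) -> coboundary f -> coboundary g.
Proof. by move=> e [u hu h]; exists u => // x hx; rewrite -e // h. Qed.

Lemma coboundary0 : coboundary (fun _ => 0).
Proof. by exists (fun _ => 0) => [|x _]; [exact: locconst_cst|rewrite subrr]. Qed.

Lemma coboundaryB f g : coboundary f -> coboundary g -> coboundary (fun x => f x - g x).
Proof.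
move=> [u hu h] [v hv k]; exists (fun x => u x - v x) => [|x hx].
  exact: (locconst_op2 (fun a b => a - b)).
by rewrite h // k //; ring.
Qed.

Lemma coboundary_next u : locconst u -> coboundary (fun x => u (shift 1 x) - u x).
Proof.
move=> hu; exists (fun x => u (shift 1 x)) => [|x _]; first exact: locconst_shift.
by rewrite shiftD subrr shift0.
Qed.

Definition cohomologous f g : Prop := coboundary (fun x => f x - g x).

Lemma cohomologous_refl f : cohomologous f f.
Proof. by apply: coboundary_eq coboundary0 => x _; rewrite subrr. Qed.

Lemma cohomologous_sym f g : cohomologous f g -> cohomologous g f.
Proof.
by move=> h; apply: coboundary_eq (coboundaryB coboundary0 h) => x _; ring.
Qed.

Lemma cohomologous_trans g f h : cohomologous f g -> cohomologous g h -> cohomologous f h.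
Proof.
move=> fg /cohomologous_sym gh; apply: coboundary_eq (coboundaryB fg gh) => x _; ring.
Qed.

Lemma cohomologous_eq f g : (forall x, Omega x -> f x = g x) -> cohomologous f g.
Proof. by move=> e; apply: coboundary_eq coboundary0 => x hx; rewrite e // subrr. Qed.

End Cohomologous.

(** * Images of words under the powers of the substitution *)

Section Images.
Variables (d : nat) (phi : substitution d).
Local Notation Omega := (biallowed phi).
Local Notation pw := (power phi).
Implicit Types (x y : int -> 'I_d).

Lemma image_exists n y : exists px : (int -> int) * (int -> 'I_d),
  px.1 0 = 0 /\ parses (pw n) y px.1 px.2.
Proof.
by have [pos [x h]] := parses_exists (@nonerasing_power _ phi n) y 0; exists (pos, x).
Qed.

(** The word [phi^n(y)], with its origin at the beginning of [phi^n(y 0)]. *)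
Definition image n y : int -> 'I_d := (projT1 (cid (image_exists n y))).2.
Definition cuts n y : int -> int := (projT1 (cid (image_exists n y))).1.

Lemma cuts0 n y : cuts n y 0 = 0.
Proof. by rewrite /cuts; case: cid => ? []. Qed.

Lemma image_parses n y : parses (pw n) y (cuts n y) (image n y).
Proof. by rewrite /cuts /image; case: cid => ? []. Qed.

Lemma cutsS n y (i : int) : cuts n y (i + 1) = cuts n y i + (size (pw n (y i)))%:Z.
Proof. exact: parses_pos (image_parses n y) i. Qed.

Lemma cuts1 n y : cuts n y 1 = (size (pw n (y 0)))%:Z.
Proof. by have := cutsS n y 0; rewrite cuts0 !add0r. Qed.

Lemma cuts_lt n y (i : int) : cuts n y i < cuts n y (i + 1).
Proof. exact: (parses_lt (@nonerasing_power _ phi n) (image_parses n y)). Qed.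

Lemma cuts_psum n y (i : int) : cuts n y i = psum (fun j => (size (pw n (y j)))%:Z) i.
Proof. by rewrite (psum_uniq (cutsS n y)) cuts0 add0r. Qed.

Lemma image_biallowed n y : Omega y -> Omega (image n y).
Proof. by move=> hy; apply: biallowed_image hy (image_parses n y). Qed.

Lemma image_shift n y (i : int) : image n (shift i y) = shift (cuts n y i) (image n y).
Proof.
have h := parses_shift (cuts n y i) (parses_shift_source i (image_parses n y)).
have [|_ //] := parses_eq (@nonerasing_power _ phi n) (image_parses n (shift i y)) h (i0 := 0).
by rewrite cuts0 add0r subrr.
Qed.

Lemma image_image n m y : image n (image m y) = image (n + m) y.
Proof.
have h := parses_comp (image_parses m y) (image_parses n (image m y)); rewrite -powerD in h.
have [|_ //] := parses_eq (@nonerasing_power _ phi (n + m)) h (image_parses (n + m) y) (i0 := 0).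
by rewrite !cuts0.
Qed.

Lemma image_right n y (k : nat) b0 : (k < size (pw n (y 0%R)))%N ->
  image n y k%:Z = nth b0 (pw n (y 0)) k.
Proof. by move=> hk; rewrite -(parses_nth (image_parses n y) 0 b0 hk) cuts0 add0r. Qed.

Lemma image_left n y (k : nat) b0 : (k < size (pw n (y (-1)%R)))%N ->
  image n y (- k.+1%:Z) = nth b0 (rev (pw n (y (-1)))) k.
Proof.
move=> hk; rewrite nth_rev // -(parses_nth (image_parses n y) (-1) b0); last by lia.
have := cutsS n y (-1); rewrite addNr cuts0 => e; congr (image _ _ _); lia.
Qed.

(** No letter is erased, so the blocks of the letters in [-N, N) cover at least [-N, N). *)
Lemma image_agree n N y y' : agree N y y' -> agree N (image n y) (image n y').
Proof.
move=> ag k hk; have ne := @nonerasing_power _ phi n.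
have [i /andP[ik ki]] := locate (cuts_lt n y) k.
have ce (j : int) : - N%:Z <= j <= N%:Z -> cuts n y j = cuts n y' j.
  by move=> hj; rewrite !cuts_psum; apply: psum_agree hj => l /ag ->.
have hi : - N%:Z <= i < N%:Z.
  have c0 := cuts0 n y; apply/andP; split.
    rewrite leNgt; apply/negP => lt.
    have := @cut_mono _ (cuts_lt n y) (i + 1) 0 ltac:(lia); rewrite c0; lia.
  rewrite ltNge; apply/negP => lt.
  by have := @cut_mono _ (cuts_lt n y) 0 i ltac:(lia); rewrite c0; lia.
have sz := cutsS n y i.
have hk' : (absz (k - cuts n y i)%R < size (pw n (y i)))%N by lia.
have -> : k = cuts n y i + (absz (k - cuts n y i)%R)%:Z by lia.
rewrite (parses_nth (image_parses n y) i (y 0)) // [in RHS]ce; last by lia.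
have ci : cuts n y i = cuts n y' i by apply: ce; lia.
by rewrite (parses_nth (image_parses n y') i (y 0)) -ag // -ci.
Qed.

End Images.

(** * Functions carried by the blocks of a given level *)

Section Induced.
Variables (d : nat) (phi : substitution d).
Hypotheses (prim : primitive phi) (aper : aperiodic phi).
Local Notation locconst := (locconst phi).
Local Notation coboundary := (coboundary phi).
Local Notation cohomologous := (cohomologous phi).
Local Notation Omega := (biallowed phi).
Local Notation pw := (power phi).
Local Notation image := (image phi).
Local Notation cuts := (cuts phi).
Local Notation addressed := (addressed phi).
Implicit Types (x y : int -> 'I_d) (f g : (int -> 'I_d) -> int).

Lemma shift_eq (i j : int) y : i = j -> shift i y = shift j y.
Proof. by move=> ->. Qed.

Lemma address_exists n x : exists yp : (int -> 'I_d) * (int -> int),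
  Omega x -> addressed n x yp.1 yp.2.
Proof.
have [hx|nx] := pselect (Omega x); last by exists (x, id).
by have [y [pos h]] := addressed_exists n hx; exists (y, pos).
Qed.

Definition source n x : int -> 'I_d := (projT1 (cid (address_exists n x))).1.
Definition blocks n x : int -> int := (projT1 (cid (address_exists n x))).2.

Lemma sourceP n x : Omega x -> addressed n x (source n x) (blocks n x).
Proof. by rewrite /source /blocks; case: cid => ? h /h. Qed.

Lemma source_uniq n x y pos : addressed n x y pos -> source n x = y /\ blocks n x = pos.
Proof.
move=> h; have hx : Omega x by case: h => [hy h _]; apply: biallowed_image hy h.
exact: (addressed_uniq prim aper (sourceP n hx) h).
Qed.

Lemma addressed_image n y (k : nat) : Omega y -> (k < size (pw n (y 0%R)))%N ->
  addressed n (shift k%:Z (image n y)) y (fun i => cuts n y i - k%:Z).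
Proof.
move=> hy hk; split=> //; first exact: parses_shift (image_parses _ _ _).
by rewrite cuts0 cuts1; lia.
Qed.

Lemma image_source n x : Omega x -> exists k : nat,
  [/\ (k < size (pw n (source n x 0%R)))%N, x = shift k%:Z (image n (source n x)) &
    blocks n x = (fun i => cuts n (source n x) i - k%:Z)].
Proof.
move=> hx; have [hy h /andP[p0 p1]] := sourceP n hx.
set y := source n x in hy h *; set pos := blocks n x in h p0 p1 *.
have e : blocks n x 1 = pos 0 + (size (pw n (y 0)))%:Z by have := parses_pos h 0.
have p1' : 0 < blocks n x 1 := p1.
have hk : (absz (pos 0%R) < size (pw n (y 0%R)))%N by lia.
have [|ep ex] := parses_eq (@nonerasing_power _ phi n) h
    (parses_shift (absz (pos 0%R))%:Z (image_parses phi n y)) (i0 := 0).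
  by rewrite cuts0; lia.
by exists (absz (pos 0%R)); split.
Qed.

(** The function on words supported on the beginnings of the blocks of level
    [n] which takes there the value of [g] on the word of these blocks. *)
Definition induce n g x : int := if blocks n x 0 == 0 then g (source n x) else 0.

Lemma induce_image n g y : Omega y -> induce n g (image n y) = g y.
Proof.
move=> hy; have hk := @nonerasing_power _ phi n (y 0).
have := addressed_image hy hk; rewrite shift0 => /source_uniq[e1 e2].
by rewrite /induce e1 e2 cuts0 subr0 eqxx.
Qed.

Lemma induce_inside n g y (k : nat) : Omega y -> (k < size (pw n (y 0%R)))%N -> (0 < k)%N ->
  induce n g (shift k%:Z (image n y)) = 0.
Proof.
move=> hy hk k0; have /source_uniq[e1 e2] := addressed_image hy hk.
by rewrite /induce e2 cuts0 ifF //; lia.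
Qed.

Lemma source_local n R : exists r, forall x x', Omega x -> Omega x' -> agree r x x' ->
  blocks n x 0 = blocks n x' 0 /\ agree R (source n x) (source n x').
Proof.
have [r hr] := addressed_local prim aper n R; exists r => x x' hx hx'.
exact: (hr _ _ _ _ _ _ (sourceP n hx) (sourceP n hx')).
Qed.

Lemma source_biallowed n x : Omega x -> Omega (source n x).
Proof. by move=> /(sourceP n)[]. Qed.

Lemma locconst_source V (u : (int -> 'I_d) -> V) n : locconst u ->
  locconst (fun x => u (source n x)).
Proof.
move=> [R hu]; have [r hr] := source_local n R; exists r => x x' hx hx' /(hr _ _ hx hx')[_].
by apply: hu; exact: source_biallowed.
Qed.

Lemma locconst_induce n g : locconst g -> locconst (induce n g).
Proof.
move=> [R hg]; have [r hr] := source_local n R; exists r => x x' hx hx' /(hr _ _ hx hx')[e ag].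
by rewrite /induce e; case: ifP => // _; apply: hg => //; exact: source_biallowed.
Qed.

Lemma source_previous n x : Omega x -> blocks n x 0 <> 0 ->
  source n (shift (-1) x) = source n x.
Proof.
move=> hx; have [hy h /andP[p0 p1]] := sourceP n hx => nz.
have hp : 0 < blocks n x 1 := p1.
have hz : blocks n x 0 < 0 by rewrite lt_neqAle p0 andbT; apply/eqP.
apply: (proj1 (@source_uniq n _ _ (fun i => blocks n x i + 1) _)); split=> //.
  exact: (parses_shift (-1) h).
by apply/andP; split; lia.
Qed.

(** The transfer function composed with [source n] is constant along a block and changes by [g] from
    one block to the next. *)
Lemma induce_coboundary n g : coboundary g -> coboundary (induce n g).
Proof.
move=> [u hu h]; exists (fun x => u (source n x)) => [|x hx]; first exact: locconst_source.
rewrite /induce; case: eqP => [e|/(source_previous hx) ->]; last by rewrite subrr.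
have hy := source_biallowed n hx; rewrite h //; congr (_ - u _).
have [_ p _] := sourceP n hx.
have := parses_shift_source (-1) (parses_shift (-1) p) => q.
have [_ p1 _] := sourceP n hx.
symmetry; apply: (proj1 (@source_uniq n _ _ (fun i => blocks n x (i + -1) - -1) _)); split=> //.
  exact: biallowed_shift.
have e' := parses_pos p (0 - 1); rewrite subrK e in e'.
have pos := @nonerasing_power _ phi n (source n x (0 - 1)%R).
rewrite subrr e; move: (blocks n x (0 - 1)) e' pos => b; lia.
Qed.

Lemma induceB n g g' x : induce n (fun y => g y - g' y) x = induce n g x - induce n g' x.
Proof. by rewrite /induce; case: ifP => // _; rewrite subr0. Qed.

Lemma induce_cohomologous n g g' : cohomologous g g' -> cohomologous (induce n g) (induce n g').
Proof.
by move=> /(induce_coboundary n); apply: coboundary_eq => x _; exact: induceB.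
Qed.

Definition block_sum n f y : int := \sum_(i < size (pw n (y 0))) f (shift i%:Z (image n y)).

(** The values of [f] along a block are all moved to its left end; the transfer function is minus
    the sum of the values still to come in the block. *)
Lemma cohomologous_induce n f : locconst f -> cohomologous f (induce n (block_sum n f)).
Proof.
(* [blocks n x 1] is the distance to the next cut, so [len x] counts the letters of the block
   strictly to the right of the origin. *)
move=> hf; pose len x := (absz (blocks n x 1%R)).-1.
pose u x := - \sum_(i < len x) f (shift i.+1%:Z x).
exists u.
  pose K := \max_a size (pw n a).
  have lenK x : Omega x -> (len x <= K)%N.
    move=> hx; have [k [hk _ e]] := image_source n hx; rewrite /len e cuts1.
    have : (size (pw n (source n x 0)) <= K)%N by apply: leq_bigmax.
    by lia.
  have [r1 h1] := source_local n 1.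
  have /choice[r2 h2] : forall i : nat, exists r, forall x x', Omega x -> Omega x' -> agree r x x' ->
      f (shift i.+1%:Z x) = f (shift i.+1%:Z x').
    by move=> i; have [r hr] := locconst_shift i.+1%:Z hf; exists r.
  exists (maxn r1 (\max_(i < K) r2 i)) => x x' hx hx' ag.
  have [e0 ag0] := h1 _ _ hx hx' (agree_le (leq_maxl _ _) ag).
  have el : len x = len x'.
    have [_ p _] := sourceP n hx; have [_ p' _] := sourceP n hx'.
    have e1 : blocks n x 1 = blocks n x 0 + (size (pw n (source n x 0)))%:Z by have := parses_pos p 0.
    have e1' : blocks n x' 1 = blocks n x' 0 + (size (pw n (source n x' 0)))%:Z by have := parses_pos p' 0.
    by rewrite /len e1 e1' e0 (ag0 0).
  rewrite /u -el; congr (- _); apply: eq_bigr => i _; apply: h2 => //.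
  apply: agree_le ag; apply: leq_trans (leq_maxr _ _).
  have iK : (i < K)%N by apply: leq_trans (ltn_ord i) (lenK _ hx).
  by rewrite (@leq_bigmax _ (fun i : 'I_K => r2 i) (Ordinal iK)).
move=> x hx; have [k [hk ex eb]] := image_source n hx.
have hy := source_biallowed n hx; have [y ey] : exists y, y = source n x by eexists.
rewrite -ey in hk ex eb hy.
pose P m := \sum_(i < m) f (shift i%:Z (image n y)).
have PS m : P m.+1 = P m + f (shift m%:Z (image n y)) by rewrite /P big_ord_recr.
have Pdiff z (m L : nat) : (forall i : nat, shift i.+1%:Z z = shift (m + i)%N%:Z (image n y)) ->
    \sum_(i < L) f (shift i.+1%:Z z) = P (m + L)%N - P m.
  move=> hz; elim: L => [|L IH]; first by rewrite big_ord0 addn0 subrr.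
  by rewrite big_ord_recr /= IH addnS PS hz; ring.
have len_x : len x = (size (pw n (y 0%R)) - k.+1)%N by rewrite /len eb cuts1; lia.
have ux : u x = P k.+1 - P (size (pw n (y 0%R))).
  rewrite /u (Pdiff x k.+1) => [|i]; last by rewrite ex shiftD; apply: shift_eq; lia.
  by rewrite len_x subnKC // opprB.
have fx : f x = P k.+1 - P k by rewrite PS ex; ring.
rewrite ux fx /induce eb cuts0 sub0r.
case: k hk ex eb len_x ux fx => [|k] hk ex eb len_x ux fx.
  (* The origin is at a cut, so the preceding letter ends its block and nothing is left to sum. *)
  have -> : u (shift (-1) x) = 0.
    have ne1 := @nonerasing_power _ phi n (y (-1)).
    have hy1 := biallowed_shift (-1) hy.
    have hk1 : (((size (pw n (y (-1)%R))).-1) < size (pw n (shift (-1) y 0%R)))%N.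
      by rewrite /shift add0r; lia.
    have ad := addressed_image hy1 hk1.
    have c1 := cutsS phi n y (-1); rewrite addNr cuts0 in c1.
    have exx : shift (-1) x = shift (size (pw n (y (-1)%R))).-1%:Z (image n (shift (-1) y)).
      by rewrite image_shift shiftD ex shift0; apply: shift_eq; lia.
    rewrite -exx in ad; have [_ e2] := source_uniq ad.
    rewrite /u /len e2 cuts1 /shift add0r (_ : (absz _).-1 = 0%N) ?big_ord0 ?oppr0 //; lia.
  rewrite oppr0 eqxx -ey /block_sum -/(P _); have -> : P 0%N = 0 by rewrite /P big_ord0.
  by ring.
case: eqP => [/eqP|_]; first by rewrite oppr_eq0.
have nz : blocks n x 0 <> 0 by rewrite eb cuts0; lia.
have es := source_previous hx nz.
have hx' : Omega (shift (-1) x) by apply: biallowed_shift.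
have hk' : (k < size (pw n (y 0%R)))%N by lia.
have ad := addressed_image hy hk'.
have exx : shift (-1) x = shift k%:Z (image n y).
  by rewrite ex shiftD; apply: shift_eq; lia.
rewrite -exx in ad; have [_ e2] := source_uniq ad.
have -> : u (shift (-1) x) = P k.+1 - P (size (pw n (y 0%R))).
  rewrite /u (Pdiff _ k.+1) => [|i]; last by rewrite exx shiftD; apply: shift_eq; lia.
  rewrite /len e2 cuts1.
  have -> : (absz ((size (pw n (y 0)))%:Z - k%:Z)%R).-1 = (size (pw n (y 0%R)) - k.+1)%N by lia.
  by rewrite subnKC // opprB.
by ring.
Qed.

Lemma induce_induce n m g x : Omega x -> induce n (induce m g) x = induce (n + m) g x.
Proof.
move=> hx; have [hy p /andP[p0 p1]] := sourceP n hx.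
have [hz q /andP[q0 q1]] := sourceP m hy.
set y := source n x in hy p q q0 q1 *; set z := source m y in hz q *.
have lt := parses_lt (@nonerasing_power _ phi n) p.
have pc := parses_comp q p; rewrite -powerD in pc.
have /source_uniq[e1 e2] : addressed (n + m) x z (fun i => blocks n x (blocks m y i)).
  split=> //; apply/andP; split.
    have := cut_mono lt q0; lia.
  have q1' : 1 <= blocks m y 1 by lia.
  by apply: lt_le_trans p1 _; apply: le_trans (cut_mono lt q1'); rewrite lerDl; lia.
rewrite /induce e1 e2 -/y -/z.
have -> : (blocks n x (blocks m y 0) == 0) = (blocks n x 0 == 0) && (blocks m y 0 == 0).
  apply/eqP/andP => [e|[/eqP e1' /eqP e2']]; last by rewrite e2' e1'.
  have := cut_mono lt q0; rewrite e => h.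
  by split; apply/eqP; lia.
by case: ifP.
Qed.

End Induced.

Lemma big_extend (A B : Type) (s : A -> seq B) (F : B -> int) w :
  \sum_(b <- extend s w) F b = \sum_(a <- w) \sum_(b <- s a) F b.
Proof.
elim: w => [|a w IH]; first by rewrite !big_nil.
by rewrite extend_cons big_cat big_cons IH.
Qed.

Lemma sum_count_mem (A : finType) (F : A -> int) (w : seq A) :
  \sum_a (count_mem a w)%:Z * F a = \sum_(a <- w) F a.
Proof.
elim: w => [|b w IH]; first by rewrite big_nil big1 // => a _; rewrite mul0r.
rewrite big_cons -IH (eq_bigr (fun a => (b == a)%:Z * F a + (count_mem a w)%:Z * F a)); last first.
  by move=> a _; rewrite /= PoszD mulrDl.
rewrite big_split (bigD1 b) //= eqxx mul1r big1 ?addr0 // => a.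
by rewrite eq_sym => /negbTE ->; rewrite mul0r.
Qed.

Section Letters.
Variables (d : nat) (phi : substitution d).
Local Notation A := (transition_mx phi).

Definition letter_fun (v : 'cV[int]_d) (y : int -> 'I_d) : int := v (y 0) 0.

Lemma sum_power m a (v : 'cV[int]_d) :
  \sum_(b <- power phi m a) v b 0 = (A^T ^+ m *m v) a 0.
Proof.
elim: m v => [|m IH] v; first by rewrite big_seq1 expr0 mul1mx.
rewrite -[m.+1]add1n powerD power1 big_extend addnC addn1 exprSr -mulmxE -mulmxA -IH.
apply: eq_bigr => b _; rewrite !mxE -sum_count_mem; apply: eq_bigr => c _.
by rewrite !mxE.
Qed.

Lemma block_sum_letter m v y :
  block_sum phi m (letter_fun v) y = letter_fun (A^T ^+ m *m v) y.
Proof.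
rewrite /letter_fun -sum_power (big_nth (y 0)) big_mkord; apply: eq_bigr => i _.
by rewrite /shift add0r (image_right (y 0)).
Qed.

Lemma locconst_letter v : locconst phi (letter_fun v).
Proof. by exists 1%N => x x' _ _ ag; rewrite /letter_fun (ag 0). Qed.

End Letters.

(** * The eventual range *)

Section EventualRange.
Variables (d : nat) (phi : substitution d).
Hypotheses (prim : primitive phi) (aper : aperiodic phi).
Local Notation Omega := (biallowed phi).
Local Notation pw := (power phi).
Local Notation image := (image phi).
Implicit Types (x y : int -> 'I_d).

Definition first_letter n (a : 'I_d) : 'I_d := head a (pw n a).
Definition last_letter n (a : 'I_d) : 'I_d := last a (pw n a).

Lemma head_extend (s : 'I_d -> seq 'I_d) w a : nonerasing s -> (0 < size w)%N ->
  head a (extend s w) = head a (s (head a w)).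
Proof.
by case: w => //= b w ne _; rewrite extend_cons; have := ne b; case: (s b).
Qed.

Lemma last_extend (s : 'I_d -> seq 'I_d) w a : nonerasing s -> (0 < size w)%N ->
  last a (extend s w) = last a (s (last a w)).
Proof.
case/lastP: w => // w b ne _; rewrite -cats1 extend_cat extend1 !last_cat /=.
by have := ne b; case: (s b).
Qed.

Lemma first_letterD m n a : first_letter (m + n) a = first_letter m (first_letter n a).
Proof.
rewrite /first_letter powerD head_extend ?nonerasing_power //; last exact: nonerasing_power.
by have := @nonerasing_power _ phi m (head a (pw n a)); case: (pw m _).
Qed.

Lemma last_letterD m n a : last_letter (m + n) a = last_letter m (last_letter n a).
Proof.
rewrite /last_letter powerD last_extend ?nonerasing_power //; last exact: nonerasing_power.
by have := @nonerasing_power _ phi m (last a (pw n a)); case/lastP: (pw m _) => // w b; rewrite !last_rcons.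
Qed.

Lemma iter_edge_map n e : iter n (edge_map phi) e = (last_letter n e.1, first_letter n e.2).
Proof.
elim: n => [|n IH]; first by case: e.
by rewrite iterS IH -add1n last_letterD first_letterD /edge_map /= /last_letter /first_letter power1.
Qed.

Lemma S_edges_biallowed y : Omega y -> S_edges phi (y (-1), y 0).
Proof.
move=> hy; apply/allowedP; have := hy (-1) 2%N.
by rewrite /Defs.factor /mkseq /= addr0 addNr.
Qed.

Lemma S_edges_exists e : S_edges phi e -> exists y, [/\ Omega y, y (-1) = e.1 & y 0 = e.2].
Proof.
move=> /allowedP /(biallowed_factor prim aper)[x hx]; rewrite /Defs.factor /mkseq /= !add0r.
move=> [h1 h2]; exists (shift 1 x); split; first exact: biallowed_shift.
  by rewrite /shift addNr.
by rewrite /shift add0r.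
Qed.

Lemma letter_exists a : exists2 y, Omega y & y 0 = a.
Proof.
have h : occurs phi [:: a] by exists 0%N, a; apply: infix_refl.
have [x hx] := biallowed_factor prim aper h; rewrite /Defs.factor /mkseq /= addr0 => -[e].
by exists x.
Qed.

Lemma image_edge n y : (image n y (-1), image n y 0) = (last_letter n (y (-1)), first_letter n (y 0)).
Proof.
have p0 := @nonerasing_power _ phi n (y 0); have p1 := @nonerasing_power _ phi n (y (-1)).
congr (_, _).
  by rewrite (image_left (k := 0) (y (-1))) // nth_rev // subn1 nth_last.
by rewrite (image_right (k := 0) (y 0)) // nth0.
Qed.

Lemma S_edges_iter n e : S_edges phi e -> S_edges phi (iter n (edge_map phi) e).
Proof.
move=> /S_edges_exists[y [hy h1 h2]]; rewrite iter_edge_map -h1 -h2 -image_edge.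
exact/S_edges_biallowed/image_biallowed.
Qed.

(** At such a level the first and last letter maps are idempotent, so every positive multiple of [M]
    gives the same maps; the condition on lengths makes blocks grow with the multiple. *)
Definition stable_level M : Prop :=
  [/\ forall a, first_letter (M + M) a = first_letter M a,
      forall a, last_letter (M + M) a = last_letter M a &
      forall a, (1 < size (pw M a))%N].

Lemma stable_level_exists : exists2 M, (0 < M)%N & stable_level M.
Proof.
have [n0 hn0] := size_power_large prim aper 2.
pose F n : {ffun 'I_d * 'I_d -> 'I_d * 'I_d} := [ffun e => iter n (edge_map phi) e].
have [i [j [ij eF]]] : exists i j : nat, (i < j)%N /\ F i = F j.
  apply: contrapT => nij.
  pose N := #|{ffun 'I_d * 'I_d -> 'I_d * 'I_d}|.
  have : injective (fun i : 'I_N.+1 => F i).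
    move=> i j e; apply/val_inj; case: (ltngtP (val i) (val j)) => // lt; exfalso; apply: nij.
      by exists i, j.
    by exists j, i.
  by move=> /card_codom => hc; have := max_card (mem (codom (fun i : 'I_N.+1 => F i))); rewrite hc card_ord ltnn.
have eFn n : (i <= n)%N -> F (n + (j - i))%N = F n.
  move=> hn; apply/ffunP => e; rewrite !ffunE.
  have -> : (n + (j - i) = (n - i) + j)%N by lia.
  have -> : (n = (n - i) + i)%N by lia.
  rewrite !iterD; congr iter; first lia.
  by move/ffunP/(_ e): eF; rewrite !ffunE.
have eFk k n : (i <= n)%N -> F (n + k * (j - i))%N = F n.
  by move=> hn; elim: k => [|k IH]; rewrite ?addn0 // mulSn addnCA addnC eFn //; lia.
(* A multiple of the period [j - i] beyond the preperiod [i] gives idempotence; being at least [n0],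
   it also makes the blocks long. *)
pose M := ((i + n0).+1 * (j - i))%N.
have M1 : (i <= M)%N by rewrite /M; nia.
have M2 : (n0 <= M)%N by rewrite /M; nia.
have M0 : (0 < M)%N by rewrite /M muln_gt0 /=; lia.
exists M => //.
have idem a : F (M + M)%N (a, a) = F M (a, a) by rewrite {2}/M eFk.
split=> a; last exact: hn0.
  by have := congr1 snd (idem a); rewrite !ffunE !iter_edge_map.
by have := congr1 fst (idem a); rewrite !ffunE !iter_edge_map.
Qed.

Variable M : nat.
Hypotheses (M_gt0 : (0 < M)%N) (stable : stable_level M).

Local Notation p := (first_letter M).
Local Notation q := (last_letter M).

Lemma first_letter_mul j a : (0 < j)%N -> first_letter (j * M) a = p a.
Proof.
have [h _ _] := stable.
case: j => // j _; elim: j => [|j IH]; first by rewrite mul1n.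
by rewrite mulSn first_letterD IH -first_letterD h.
Qed.

Lemma last_letter_mul j a : (0 < j)%N -> last_letter (j * M) a = q a.
Proof.
have [_ h _] := stable.
case: j => // j _; elim: j => [|j IH]; first by rewrite mul1n.
by rewrite mulSn last_letterD IH -last_letterD h.
Qed.

Lemma first_letter_idem a : p (p a) = p a.
Proof. by have [h _ _] := stable; rewrite -first_letterD h. Qed.

Lemma last_letter_idem a : q (q a) = q a.
Proof. by have [_ h _] := stable; rewrite -last_letterD h. Qed.

Lemma size_power_mul j a : (j < size (pw (j * M) a))%N.
Proof.
elim: j a => // j IH a; rewrite mulSn powerD.
have [_ _ two] := stable.
have twice u : (2 * size u <= size (extend (pw M) u))%N.
  by elim: u => // b u IHu; rewrite extend_cons size_cat /=; have := two b; lia.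
by have := twice (pw (j * M) a); have := IH a; lia.
Qed.

(** The iterate [M] of the edge map equals every iterate of order (n+1)M, so its image lies in the
    image of each iterate n: the intersection is reached at [M]. *)
Lemma ER_edgesP e : ER_edges phi e <->
  exists2 e', S_edges phi e' & e = (q e'.1, p e'.2).
Proof.
split=> [h|[e' he' ->] n _].
  have [e' he' <-] := h M I; exists e' => //; exact: iter_edge_map.
exists (iter ((n.+1) * M - n) (edge_map phi) e'); first exact: S_edges_iter.
rewrite -iterD iter_edge_map; have -> : (n + (n.+1 * M - n) = n.+1 * M)%N by nia.
by rewrite first_letter_mul // last_letter_mul.
Qed.

Lemma ER_edges_biallowed y : Omega y -> ER_edges phi (q (y (-1)), p (y 0)).
Proof. by move=> hy; apply/ER_edgesP; exists (y (-1), y 0) => //; exact: S_edges_biallowed. Qed.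

Lemma ER_edges_exists e : ER_edges phi e -> exists y, [/\ Omega y, q (y (-1)) = e.1 & p (y 0) = e.2].
Proof.
move=> /ER_edgesP[e' /S_edges_exists[y [hy h1 h2]] ->]; exists y.
by rewrite h1 h2.
Qed.

Lemma ER_edges_fixed e : ER_edges phi e -> q e.1 = e.1 /\ p e.2 = e.2.
Proof.
by move=> /ER_edges_exists[y [_ <- <-]]; rewrite last_letter_idem first_letter_idem.
Qed.

(** The bi-infinite word fixed by [phi^M] with letters [e.1] and [e.2] around
    the origin. *)
Definition fixed_word (e : 'I_d * 'I_d) (k : int) : 'I_d :=
  match k with
  | Posz n => nth e.2 (pw (n * M) e.2) n
  | Negz n => nth e.1 (rev (pw (n * M) e.1)) n
  end.

Lemma power_prefix i j a : (i < j)%N -> exists w, pw (j * M) a = pw (i * M) (p a) ++ w.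
Proof.
move=> ij; have -> : (j * M = i * M + (j - i) * M)%N by nia.
have := @nonerasing_power _ phi ((j - i) * M)%N a.
have : first_letter ((j - i) * M) a = p a by apply: first_letter_mul; lia.
rewrite powerD /first_letter; case: (pw ((j - i) * M) a) => //= b w -> _.
by exists (extend (pw (i * M)) w); rewrite extend_cons.
Qed.

Lemma power_suffix i j a : (i < j)%N -> exists w, pw (j * M) a = w ++ pw (i * M) (q a).
Proof.
move=> ij; have -> : (j * M = i * M + (j - i) * M)%N by nia.
have := @nonerasing_power _ phi ((j - i) * M)%N a.
have : last_letter ((j - i) * M) a = q a by apply: last_letter_mul; lia.
rewrite powerD /last_letter; case/lastP: (pw ((j - i) * M) a) => // w b.
rewrite last_rcons => -> _; exists (extend (pw (i * M)) w).
by rewrite -cats1 extend_cat extend1.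
Qed.

(** Near a cut of level [j * M] only the edge of ER defined by the letters around it matters, and
    the visible radius grows with [j]. This reduces local data at a cut to the finite graph. *)
Lemma image_fixed_word N j y : (N < j)%N ->
  agree N (image (j * M) y) (fixed_word (q (y (-1)), p (y 0))).
Proof.
move=> Nj [k|k] hk.
  have [w e] := @power_prefix k j (y 0) ltac:(lia).
  have sk := size_power_mul k (p (y 0)).
  rewrite (image_right (p (y 0))) e ?size_cat ?ltn_addr //.
  by rewrite nth_cat sk.
have [w e] := @power_suffix k j (y (-1)) ltac:(lia).
have sk := size_power_mul k (q (y (-1))).
rewrite NegzE (image_left (q (y (-1)))) e ?size_cat ?ltn_addl //.
by rewrite rev_cat nth_cat size_rev sk -NegzE.
Qed.

Lemma fixed_word_biallowed e : ER_edges phi e -> Omega (fixed_word e).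
Proof.
move=> /ER_edges_exists[y [hy h1 h2]] i n.
have := @image_fixed_word (absz i + n) (absz i + n).+1 y (ltnSn _).
rewrite h1 h2 -surjective_pairing => ag.
suff -> : Defs.factor (fixed_word e) i n = Defs.factor (image ((absz i + n).+1 * M) y) i n.
  exact: image_biallowed.
by apply/eq_in_map => k; rewrite mem_iota => hk; apply/esym/ag; lia.
Qed.

Lemma fixed_word_right e e' (k : int) : e.2 = e'.2 -> 0 <= k -> fixed_word e k = fixed_word e' k.
Proof. by case: k => // k /= ->. Qed.

Lemma fixed_word_left e e' (k : int) : e.1 = e'.1 -> k < 0 -> fixed_word e k = fixed_word e' k.
Proof. by case: k => // k /= ->. Qed.

Lemma image_fixed e j : ER_edges phi e -> image (j * M) (fixed_word e) = fixed_word e.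
Proof.
move=> /ER_edges_exists[y [hy h1 h2]]; apply/funext => k.
pose N := (absz k).+1.
have ag1 := @image_fixed_word N N.+1 y (ltnSn _).
have ag2 := @image_fixed_word N (j + N.+1) y ltac:(lia).
rewrite h1 h2 -surjective_pairing in ag1 ag2.
rewrite -(image_agree phi (j * M) ag1); last by rewrite /N; lia.
by rewrite image_image -mulnDl ag2 //; rewrite /N; lia.
Qed.

End EventualRange.

(** * The exact sequence for functions on words *)

Section Exactness.
Variables (d : nat) (phi : substitution d).
Hypotheses (prim : primitive phi) (aper : aperiodic phi).
Local Notation locconst := (locconst phi).
Local Notation coboundary := (coboundary phi).
Local Notation cohomologous := (cohomologous phi).
Local Notation Omega := (biallowed phi).
Local Notation pw := (power phi).
Local Notation image := (image phi).
Local Notation cuts := (cuts phi).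
Local Notation ER := (ER_edges phi).
Local Notation A := (transition_mx phi).
Local Notation induce := (induce phi).
Implicit Types (x y : int -> 'I_d) (f g : (int -> 'I_d) -> int) (e : 'I_d * 'I_d).

Lemma induce_eval n g y (i K : int) : Omega y -> cuts n y K <= i < cuts n y (K + 1) ->
  induce n g (shift i (image n y)) = if i == cuts n y K then g (shift K y) else 0.
Proof.
move=> hy /andP[h1 h2]; have hK := biallowed_shift K hy.
have c1 := cutsS phi n y K.
have -> : shift i (image n y) = shift (absz (i - cuts n y K)%R)%:Z (image n (shift K y)).
  by rewrite image_shift shiftD; apply: shift_eq; lia.
have sz : (absz (i - cuts n y K)%R < size (pw n (shift K y 0%R)))%N.
  by rewrite /shift add0r; lia.
case: eqP => [->|ne]; last by rewrite induce_inside //; lia.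
by rewrite subrr shift0 induce_image.
Qed.

(** In a block of level n + m, only the left ends of the blocks of level n contribute, one for each
    letter of phi^m(y 0). *)
Lemma block_sum_induce n m g y : Omega y ->
  block_sum phi (n + m) (induce n g) y = block_sum phi m g y.
Proof.
move=> hy; have hz := image_biallowed m hy; set z := image m y in hz.
have ce : size (pw (n + m) (y 0)) = absz (cuts n z (size (pw m (y 0)))%:Z).
  have := parses_comp (image_parses phi m y) (image_parses phi n z); rewrite -powerD => h.
  have [|e _] := parses_eq (@nonerasing_power _ phi (n + m)) h (image_parses phi (n + m) y) (i0 := 0).
    by rewrite !cuts0.
  by have := congr1 (fun c => absz (c 1)) e; rewrite !cuts1 => ->.
have step K : \sum_(i < absz (cuts n z K%:Z)) induce n g (shift i%:Z (image n z)) =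
    \sum_(k < K) g (shift k%:Z z).
  elim: K => [|K IH]; first by rewrite cuts0 !big_ord0.
  have c1 := cutsS phi n z K%:Z; have -> : K.+1%:Z = K%:Z + 1 by lia.
  have c0 : 0 <= cuts n z K%:Z.
    by have := @cut_mono _ (cuts_lt phi n z) 0 K%:Z isT; rewrite cuts0; lia.
  have -> : absz (cuts n z (K%:Z + 1)) = (absz (cuts n z K%:Z) + size (pw n (z K%:Z)))%N by lia.
  rewrite big_split_ord /= IH big_ord_recr /=; congr (_ + _).
  have hzk := biallowed_shift K%:Z hz.
  have := @nonerasing_power _ phi n (z K%:Z).
  case es : (size (pw n (z K%:Z))) => [|L] // _; rewrite big_ord_recl big1 => [|i _].
    rewrite addr0 addn0 -(induce_image prim aper n g hzk) image_shift.
    by congr (induce _ _ _); apply: shift_eq; lia.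
  have -> : shift (absz (cuts n z K%:Z) + lift ord0 i)%N%:Z (image n z) =
      shift i.+1%:Z (image n (shift K%:Z z)).
    by rewrite image_shift shiftD; apply: shift_eq; rewrite lift0; lia.
  by rewrite induce_inside // /shift add0r es ltnS ltn_ord.
rewrite /block_sum ce -step; apply: eq_bigr => i _.
by rewrite -image_image.
Qed.

(** This is what makes the map from the direct limit compatible with its transition maps. *)
Lemma cohomologous_level n m v :
  cohomologous (induce n (letter_fun v)) (induce (n + m) (letter_fun (A^T ^+ m *m v))).
Proof.
have h := cohomologous_induce prim aper m (locconst_letter phi v).
apply: cohomologous_trans (induce_cohomologous prim aper n h) _.
apply: cohomologous_eq => x hx; rewrite induce_induce //.
by congr (induce _ _ _); apply/funext => y; exact: block_sum_letter.
Qed.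

Lemma locconst_image V (u : (int -> 'I_d) -> V) n : locconst u -> locconst (fun y => u (image n y)).
Proof.
move=> [r h]; exists r => x x' hx hx' ag; apply: h; try exact: image_biallowed.
exact: image_agree.
Qed.

Definition radius f r : Prop :=
  forall x x', Omega x -> Omega x' -> agree r x x' -> f x = f x'.

Lemma radius_le f r r' : (r <= r')%N -> radius f r -> radius f r'.
Proof. by move=> rr; apply: locconst_le. Qed.

Variable M : nat.
Hypotheses (M_gt0 : (0 < M)%N) (stable : stable_level phi M).
Local Notation p := (first_letter phi M).
Local Notation q := (last_letter phi M).
Local Notation fixed_word := (fixed_word phi M).

Definition window_sum f r e : int := \sum_(i < r + r) f (shift (i%:Z - r%:Z) (fixed_word e)).

Definition potential (c : 'I_d * 'I_d -> int) : Prop :=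
  exists F : 'I_d + 'I_d -> int, forall e, ER e -> c e = F (inr e.2) - F (inl e.1).

Lemma potential_eq c c' : (forall e, ER e -> c e = c' e) -> potential c -> potential c'.
Proof. by move=> h [F hF]; exists F => e he; rewrite -h // hF. Qed.

Lemma potentialB c c' : potential c -> potential c' -> potential (fun e => c e - c' e).
Proof.
move=> [F hF] [F' hF']; exists (fun v => F v - F' v) => e he.
by rewrite hF // hF' //; ring.
Qed.

Lemma choose_edge (V : Type) (c : 'I_d * 'I_d -> V) (k : 'I_d * 'I_d -> 'I_d) (v0 : V) :
  (forall e e', ER e -> ER e' -> k e = k e' -> c e = c e') ->
  exists F : 'I_d -> V, forall e, ER e -> F (k e) = c e.
Proof.
move=> h; have /choice[F hF] : forall a, exists v, forall e, ER e -> k e = a -> c e = v.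
  move=> a; have [[e [he ea]]|ne] := pselect (exists e, ER e /\ k e = a).
    by exists (c e) => e' he' ea'; apply: h => //; rewrite ea ea'.
  by exists v0 => e he ea; exfalso; apply: ne; exists e.
by exists F => e he; rewrite -(hF (k e) e).
Qed.

(** A left and a right vertex are never identified, so the values of a potential on the two kinds of
    vertices can be chosen separately. *)
Lemma potential_halves (a b : 'I_d * 'I_d -> int) :
  (forall e e', ER e -> ER e' -> e.2 = e'.2 -> a e = a e') ->
  (forall e e', ER e -> ER e' -> e.1 = e'.1 -> b e = b e') ->
  potential (fun e => a e + b e).
Proof.
move=> /(choose_edge (k := snd) 0)[Fa ha] /(choose_edge (k := fst) 0)[Fb hb].
exists (fun v => match v with inr c => Fa c | inl c => - Fb c end) => e he.
by rewrite ha // hb // opprK.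
Qed.

Lemma shift_fixed_right f r (k : int) e e' : radius f r -> ER e -> ER e' -> e.2 = e'.2 ->
  r%:Z <= k -> f (shift k (fixed_word e)) = f (shift k (fixed_word e')).
Proof.
move=> h he he' e2 rk; apply: h.
- exact/biallowed_shift/fixed_word_biallowed.
- exact/biallowed_shift/fixed_word_biallowed.
- by move=> i hi; apply: fixed_word_right => //; lia.
Qed.

Lemma shift_fixed_left f r (k : int) e e' : radius f r -> ER e -> ER e' -> e.1 = e'.1 ->
  k <= - r%:Z -> f (shift k (fixed_word e)) = f (shift k (fixed_word e')).
Proof.
move=> h he he' e1 rk; apply: h.
- exact/biallowed_shift/fixed_word_biallowed.
- exact/biallowed_shift/fixed_word_biallowed.
- by move=> i hi; apply: fixed_word_left => //; lia.
Qed.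

Lemma window_sum_split f r e : window_sum f r e =
  \sum_(i < r) f (shift i%:Z (fixed_word e)) +
  \sum_(i < r) f (shift (i%:Z - r%:Z) (fixed_word e)).
Proof.
rewrite /window_sum big_split_ord addrC; congr (_ + _); apply: eq_bigr => i _ /=.
by congr f; apply: shift_eq; lia.
Qed.

(** Each new term is at distance at least the radius from the origin, so it reads one half of the
    fixed word. Hence the class in H^1(ER) does not depend on the window. *)
Lemma window_sum_radius f r r' : radius f r -> (r <= r')%N ->
  potential (fun e => window_sum f r' e - window_sum f r e).
Proof.
move=> h rr; rewrite -(subnKC rr); elim: (r' - r)%N => [|n IH].
  by exists (fun _ => 0) => e _; rewrite addn0 !subrr.
have hr : radius f (r + n) by apply: radius_le h; rewrite leq_addr.
have H : potential (fun e => f (shift (r + n)%N%:Z (fixed_word e)) +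
    f (shift (- (r + n).+1%:Z) (fixed_word e))).
  apply: potential_halves => e e' he he' ee.
    by apply: (shift_fixed_right hr).
  by apply: (shift_fixed_left hr) => //; lia.
(* (H - H) - H is -H, so this adds [H] by subtractions. *)
have := potentialB IH (potentialB (potentialB H H) H); apply: potential_eq => e he.
have -> : window_sum f (r + n.+1) e = window_sum f (r + n) e +
   (f (shift (r + n)%N%:Z (fixed_word e)) + f (shift (- (r + n).+1%:Z) (fixed_word e))).
  rewrite addnS /window_sum addnS addSn big_ord_recl big_ord_recr /=.
  transitivity (f (shift (- (r + n).+1%:Z) (fixed_word e)) + (window_sum f (r + n) e +
    f (shift (r + n)%N%:Z (fixed_word e)))); last by rewrite /window_sum; ring.
  congr (_ + (_ + _)).
  - by congr f; apply: shift_eq; lia.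
  - by apply: eq_bigr => i _; congr f; apply: shift_eq; rewrite /bump /=; lia.
  - by congr f; apply: shift_eq; rewrite /bump /=; lia.
by ring.
Qed.

Lemma window_sum_coboundary f r : coboundary f -> radius f r -> potential (window_sum f r).
Proof.
(* The sum telescopes to two values of [u]; with [r'] above [R] each of them reads one half of the
   fixed word. *)
move=> [u [R hu] h] hr; pose r' := maxn r R.+1.
suff H : potential (window_sum f r').
  apply: potential_eq (potentialB H (window_sum_radius hr (leq_maxl r R.+1))) => e _.
  by rewrite -/r'; ring.
have tel (n : nat) e : ER e -> \sum_(i < n) f (shift (i%:Z - r'%:Z) (fixed_word e)) =
    u (shift (n%:Z - 1 - r'%:Z) (fixed_word e)) - u (shift (- 1 - r'%:Z) (fixed_word e)).
  move=> he; elim: n => [|n IH]; first by rewrite big_ord0 sub0r subrr.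
  rewrite big_ord_recr /= IH h; last exact/biallowed_shift/fixed_word_biallowed.
  rewrite shiftD (shift_eq _ (_ : n.+1%:Z - 1 - r'%:Z = n%:Z - r'%:Z)); last by lia.
  by rewrite (shift_eq _ (_ : -1 + (n%:Z - r'%:Z) = n%:Z - 1 - r'%:Z)); [ring|lia].
have /potential_eq : forall e, ER e -> u (shift (r'%:Z - 1) (fixed_word e)) + - u (shift (- 1 - r'%:Z) (fixed_word e)) = window_sum f r' e.
  move=> e he; rewrite /window_sum tel //; congr (u _ - _); apply: shift_eq; lia.
apply; apply: potential_halves => e e' he he' ee; last congr (- _).
  apply: (hu); [exact/biallowed_shift/fixed_word_biallowed|exact/biallowed_shift/fixed_word_biallowed|].
  by move=> i hi; apply: fixed_word_right => //; rewrite /r'; lia.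
apply: (hu); [exact/biallowed_shift/fixed_word_biallowed|exact/biallowed_shift/fixed_word_biallowed|].
by move=> i hi; apply: fixed_word_left => //; rewrite /r'; lia.
Qed.

Lemma cuts_fixed_right n e e' (k : int) : e.2 = e'.2 -> 0 <= k ->
  cuts n (fixed_word e) k = cuts n (fixed_word e') k.
Proof.
case: k => // k e2 _; rewrite !cuts_psum /psum; apply: eq_bigr => i _.
by rewrite (@fixed_word_right _ _ _ e e').
Qed.

Lemma cuts_fixed_left n e e' (k : int) : e.1 = e'.1 -> k <= 0 ->
  cuts n (fixed_word e) k = cuts n (fixed_word e') k.
Proof.
move=> e1 k0; case: k k0 => [[|//]|k] _; first by rewrite !cuts0.
rewrite !cuts_psum /psum; congr (- _); apply: eq_bigr => i _.
by rewrite (@fixed_word_left _ _ _ e e').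
Qed.

(** A fixed word is its own image with a cut at the origin, so no block straddles the origin and the
    blocks to its right come from the right half alone. *)
Lemma induce_fixed_right j g e e' (i : int) : ER e -> ER e' -> e.2 = e'.2 -> 0 <= i ->
  (forall K : int, cuts (j * M) (fixed_word e) K = i ->
     g (shift K (fixed_word e)) = g (shift K (fixed_word e'))) ->
  induce (j * M) g (shift i (fixed_word e)) = induce (j * M) g (shift i (fixed_word e')).
Proof.
move=> he he' e2 i0 hg; have lt := cuts_lt phi (j * M) (fixed_word e).
have [K hK] := locate lt i; have /andP[K1 K2] := hK.
have K0 : 0 <= K.
  rewrite leNgt; apply/negP => ng; have := @cut_mono _ lt (K + 1) 0 ltac:(lia).
  by rewrite cuts0; lia.
have hK' : cuts (j * M) (fixed_word e') K <= i < cuts (j * M) (fixed_word e') (K + 1).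
  by rewrite -(@cuts_fixed_right _ e e' K e2) // -(@cuts_fixed_right _ e e' (K + 1) e2) //; lia.
rewrite -{1}(image_fixed prim aper M_gt0 stable j he) -{1}(image_fixed prim aper M_gt0 stable j he').
rewrite (induce_eval _ (fixed_word_biallowed prim aper M_gt0 stable he) hK).
rewrite (induce_eval _ (fixed_word_biallowed prim aper M_gt0 stable he') hK').
rewrite -(@cuts_fixed_right _ e e' _ e2) //; case: eqP => // eK.
by apply: hg; rewrite -eK.
Qed.

Lemma induce_fixed_left j g e e' (i : int) : ER e -> ER e' -> e.1 = e'.1 -> i < 0 ->
  (forall K : int, K < 0 -> g (shift K (fixed_word e)) = g (shift K (fixed_word e'))) ->
  induce (j * M) g (shift i (fixed_word e)) = induce (j * M) g (shift i (fixed_word e')).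
Proof.
move=> he he' e1 i0 hg; have lt := cuts_lt phi (j * M) (fixed_word e).
have [K hK] := locate lt i; have /andP[K1 K2] := hK.
have K0 : K < 0.
  rewrite ltNge; apply/negP => ng; have := @cut_mono _ lt 0 K ng.
  by rewrite cuts0; lia.
have hK' : cuts (j * M) (fixed_word e') K <= i < cuts (j * M) (fixed_word e') (K + 1).
  by rewrite -(@cuts_fixed_left _ e e' K e1) -?(@cuts_fixed_left _ e e' (K + 1) e1) //; lia.
rewrite -{1}(image_fixed prim aper M_gt0 stable j he) -{1}(image_fixed prim aper M_gt0 stable j he').
rewrite (induce_eval _ (fixed_word_biallowed prim aper M_gt0 stable he) hK).
rewrite (induce_eval _ (fixed_word_biallowed prim aper M_gt0 stable he') hK').
rewrite -(@cuts_fixed_left _ e e' _ e1) //; last by lia.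
by case: eqP => // _; exact: hg.
Qed.

Lemma letter_fixed_right j v e e' (i : int) : ER e -> ER e' -> e.2 = e'.2 -> 0 <= i ->
  induce (j * M) (letter_fun v) (shift i (fixed_word e)) =
  induce (j * M) (letter_fun v) (shift i (fixed_word e')).
Proof.
move=> he he' e2 i0; apply: induce_fixed_right => // K hK.
rewrite /letter_fun /shift add0r (@fixed_word_right _ _ _ e e') //.
have lt := cuts_lt phi (j * M) (fixed_word e).
rewrite leNgt; apply/negP => ng; have := @cut_mono _ lt K 0 (ltW ng).
by rewrite cuts0; lia.
Qed.

Lemma letter_fixed_left j v e e' (i : int) : ER e -> ER e' -> e.1 = e'.1 -> i < 0 ->
  induce (j * M) (letter_fun v) (shift i (fixed_word e)) =
  induce (j * M) (letter_fun v) (shift i (fixed_word e')).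
Proof.
move=> he he' e1 i0; apply: induce_fixed_left => // K hK.
by rewrite /letter_fun /shift add0r (@fixed_word_left _ _ _ e e').
Qed.

Lemma window_sum_letter j v r : potential (window_sum (induce (j * M) (letter_fun v)) r).
Proof.
apply: (@potential_eq (fun e =>
  \sum_(i < r) induce (j * M) (letter_fun v) (shift i%:Z (fixed_word e)) +
  \sum_(i < r) induce (j * M) (letter_fun v) (shift (i%:Z - r%:Z) (fixed_word e)))).
  by move=> e _; rewrite window_sum_split.
apply: potential_halves => e e' he he' ee; apply: eq_bigr => i _.
  exact: letter_fixed_right.
by apply: letter_fixed_left => //; have := ltn_ord i; lia.
Qed.

(** The induced function reads the edge around each cut of level [M]. At the origin of the fixed
    word this is [c e], and at any other cut both letters lie in the same half. *)
Lemma window_sum_surjective (c : 'I_d * 'I_d -> int) : exists f r,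
  [/\ locconst f, radius f r & potential (fun e => window_sum f r e - c e)].
Proof.
pose g y := c (q (y (-1)), p (y 0)).
have lg : locconst g.
  by exists 1%N => x x' _ _ ag; rewrite /g !ag.
have lf := locconst_induce prim aper (1 * M) lg; have [r hr] := lf.
set f := induce (1 * M) g in lf hr.
have hr1 : radius f r.+1 by apply: radius_le hr.
exists f, r.+1; split=> //.
apply: (@potential_eq (fun e =>
  \sum_(i < r) f (shift i.+1%:Z (fixed_word e)) +
  \sum_(i < r.+1) f (shift (i%:Z - r.+1%:Z) (fixed_word e)))).
  move=> e he; rewrite window_sum_split [X in _ = X + _ - _]big_ord_recl shift0.
  have -> : f (fixed_word e) = c e.
    rewrite -{1}(image_fixed prim aper M_gt0 stable 1 he) /f (induce_image prim aper); last exact: fixed_word_biallowed.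
    have [e1 e2] := ER_edges_fixed prim aper M_gt0 stable he.
    by rewrite /g /= e1 e2 -surjective_pairing.
  have -> : \sum_(i < r) f (shift (lift ord0 i)%:Z (fixed_word e)) =
    \sum_(i < r) f (shift i.+1%:Z (fixed_word e)) by [].
  by ring.
apply: potential_halves => e e' he he' ee; apply: eq_bigr => i _.
  apply: induce_fixed_right => // K hK; rewrite /g /shift.
  have lt := cuts_lt phi (1 * M) (fixed_word e).
  have K1 : 0 < K.
    rewrite ltNge; apply/negP => ng; have := @cut_mono _ lt K 0 ng.
    by rewrite cuts0; lia.
  by rewrite !(@fixed_word_right _ _ _ e e') //; lia.
apply: induce_fixed_left => //; first by have := ltn_ord i; lia.
by move=> K hK; rewrite /g /shift !(@fixed_word_left _ _ _ e e') //; lia.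
Qed.

(** On a long block, the sum of [f] is its sum over the middle of the block, a
    function of the letter, and the sums over the windows at the two ends,
    which are differences of a potential. *)
Lemma window_sum_kernel f r : radius f r -> potential (window_sum f r) ->
  exists2 j, (0 < j)%N & exists v, cohomologous f (induce (j * M) (letter_fun v)).
Proof.
(* Blocks of level [j * M] are longer than 2r, which leaves room for both windows, and agree with
   fixed words up to radius 2r, which covers a window of width 2r and the radius of [f]. *)
move=> hr [F hF]; pose j := (r + r).+1; exists j => //.
have [N NE] : exists N, N = (j * M)%N by eexists.
have big a : (r + r < size (pw N a))%N.
  by rewrite NE; exact: ltnW (size_power_mul M_gt0 stable j a).
have lf : locconst f by exists r.
pose P y m := \sum_(i < m) f (shift i%:Z (image N y)).
have PD y m n : P y (m + n)%N = P y m + \sum_(i < n) f (shift (m + i)%N%:Z (image N y)).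
  by rewrite /P big_split_ord.
have shift1 y m : \sum_(i < m) f (shift (size (pw N (y 0%R)) + i)%N%:Z (image N y)) = P (shift 1 y) m.
  apply: eq_bigr => i _; rewrite image_shift shiftD cuts1; congr f; apply: shift_eq; lia.
pose mid y := \sum_(i < size (pw N (y 0%R)) - (r + r)) f (shift (r + i)%N%:Z (image N y)).
have /choice[ya hya] : forall a, exists y, Omega y /\ y 0 = a.
  by move=> a; have [y hy ya] := letter_exists prim aper a; exists y.
have midE y : Omega y -> mid y = mid (ya (y 0)).
  move=> hy; have [ha e0] := hya (y 0); rewrite /mid e0; apply: eq_bigr => i _.
  apply: hr; [exact/biallowed_shift/image_biallowed|exact/biallowed_shift/image_biallowed|].
  move=> k hk; rewrite /shift.
  have -> : k + (r + i)%N%:Z = (absz (k + (r + i)%N%:Z)%R)%:Z by lia.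
  have hi := ltn_ord i.
  have hk' : (absz (k + (r + i)%N%:Z)%R < size (pw N (y 0%R)))%N by lia.
  by rewrite !(image_right (y 0)) ?e0.
(* The window across the cut between the blocks of [y 0] and [y 1] has the sum prescribed by the
   potential. *)
have edge y : Omega y -> \sum_(i < r + r) f (shift (size (pw N (y 0%R)) - r + i)%N%:Z (image N y)) =
    F (inr (p (y 1))) - F (inl (q (y 0))).
  move=> hy; have he := ER_edges_biallowed prim aper M_gt0 stable (biallowed_shift 1 hy).
  rewrite /shift addNr add0r in he; rewrite -(hF _ he) /window_sum; apply: eq_bigr => i _.
  have hb := big (y 0).
  have -> : shift (size (pw N (y 0%R)) - r + i)%N%:Z (image N y) =
      shift (i%:Z - r%:Z) (image N (shift 1 y)).
    by rewrite image_shift shiftD cuts1; apply: shift_eq; lia.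
  apply: hr.
  - exact/biallowed_shift/image_biallowed/biallowed_shift.
  - exact/biallowed_shift/fixed_word_biallowed.
  - have := @image_fixed_word _ _ _ M_gt0 stable (r + r) j (shift 1 y) (ltnSn _).
    rewrite -NE /shift addNr add0r => ag k hk; apply: ag.
    by have := ltn_ord i; lia.
pose v : 'cV[int]_d := \col_a (mid (ya a) + F (inr (p a)) - F (inl (q a))).
(* The block sum depends on [y 1] only through the right end of that window; [G] carries this part
   over to the block of [y 1]. *)
pose G y := F (inr (p (y 0))) - P y r.
exists v; rewrite -NE.
apply: cohomologous_trans (cohomologous_induce prim aper N lf) _.
apply: induce_cohomologous => //.
have lG : locconst G.
  apply: (locconst_op2 (fun a b => a - b)).
    by exists 1%N => x x' _ _ ag; rewrite (ag 0).
  exact: (@locconst_image _ (fun x => \sum_(i < r) f (shift i%:Z x)) N (locconst_sum r Posz lf)).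
apply: coboundary_eq (coboundary_next lG) => y hy.
have sz := big (y 0).
have e1 : P y (size (pw N (y 0%R)) + r)%N = P y (size (pw N (y 0%R))) + P (shift 1 y) r.
  by rewrite PD shift1.
have e2 : P y (size (pw N (y 0%R)) + r)%N = P y r + mid y + (F (inr (p (y 1))) - F (inl (q (y 0)))).
  rewrite -edge // /mid -PD.
  have -> : (size (pw N (y 0%R)) + r = (r + (size (pw N (y 0%R)) - (r + r))) + (r + r))%N by lia.
  rewrite PD; congr (_ + _); apply: eq_bigr => i _; congr f; apply: shift_eq; lia.
rewrite /letter_fun mxE -midE // /block_sum -/(P y _) /G.
have -> : shift 1 y 0 = y 1 by rewrite /shift add0r.
have -> : P y (size (pw N (y 0%R))) =
    P y r + mid y + (F (inr (p (y 1))) - F (inl (q (y 0)))) - P (shift 1 y) r.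
  by rewrite -e2 e1 addrK.
by ring.
Qed.

Definition vertex_difference (h : 'I_d + 'I_d -> int) : 'cV[int]_d :=
  \col_a (h (inl (q a)) - h (inr (p a))).

Definition edge_constant (h : 'I_d + 'I_d -> int) : Prop :=
  forall e, ER e -> h (inl e.1) = h (inr e.2).

Lemma edge_constant_word h y : edge_constant h -> Omega y -> h (inl (q (y 0))) = h (inr (p (y 1))).
Proof.
move=> hh hy; have := hh _ (ER_edges_biallowed prim aper M_gt0 stable (biallowed_shift 1 hy)).
by rewrite /shift /= addNr add0r.
Qed.

Lemma letter_vertex_difference h y : edge_constant h -> Omega y ->
  letter_fun (vertex_difference h) y = h (inr (p (y 1))) - h (inr (p (y 0))).
Proof. by move=> hh hy; rewrite /letter_fun mxE (edge_constant_word hh hy). Qed.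

(** The sum over phi^M(a) telescopes, since consecutive letters span an edge of ER, and the values
    at its two ends are unchanged because the letter maps are idempotent. *)
Lemma vertex_difference_fixed h j : edge_constant h ->
  A^T ^+ (j * M) *m vertex_difference h = vertex_difference h.
Proof.
move=> hh; elim: j => [|j IH]; first by rewrite mul0n expr0 mul1mx.
rewrite mulSn exprD -mulmxE -mulmxA IH.
apply/colP => a; have [y hy ya] := letter_exists prim aper a.
have := block_sum_letter phi M (vertex_difference h) y; rewrite /letter_fun ya => <-.
have tel n : \sum_(i < n) letter_fun (vertex_difference h) (shift i%:Z (image M y)) =
    h (inr (p (image M y n%:Z))) - h (inr (p (image M y 0))).
  elim: n => [|n IHn]; first by rewrite big_ord0 subrr.
  rewrite big_ord_recr /= IHn letter_vertex_difference //; last first.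
    exact/biallowed_shift/image_biallowed.
  rewrite /shift add0r; have -> : 1 + n%:Z = n.+1%:Z :> int by lia.
  by ring.
rewrite /block_sum tel -cuts1.
have fl z : image M z 0 = p (z 0) by have [] := image_edge phi M z.
have -> : image M y (cuts M y 1) = image M (shift 1 y) 0 by rewrite image_shift /shift add0r.
rewrite !fl !(first_letter_idem stable) !mxE /shift add0r -ya.
by rewrite (edge_constant_word hh hy).
Qed.

Lemma vertex_difference_coboundary h n : edge_constant h ->
  coboundary (induce n (letter_fun (vertex_difference h))).
Proof.
move=> hh; apply: induce_coboundary => //.
have lt : locconst (fun y : int -> 'I_d => h (inr (p (y 0)))).
  by exists 1%N => x x' _ _ ag; rewrite (ag 0).
apply: coboundary_eq (coboundary_next lt) => y hy.
by rewrite letter_vertex_difference // /shift add0r.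
Qed.

(** If the vector is zero, [h] does not change along an allowed word, and every letter occurs in
    that word. *)
Lemma vertex_difference_eq0 h : edge_constant h -> vertex_difference h = 0 ->
  exists c, forall e, ER e -> h (inr e.2) = c.
Proof.
move=> hh h0; have [y hy] := biallowed_exists aper.
have step (k : int) : h (inr (p (y (k + 1)))) = h (inr (p (y k))).
  have := letter_vertex_difference hh (biallowed_shift k hy).
  rewrite h0 /letter_fun mxE /shift add0r (addrC 1 k) => /esym/eqP.
  by rewrite subr_eq0 => /eqP.
have const : forall k : int, h (inr (p (y k))) = h (inr (p (y 0))).
  by apply: int_bi_ind => // k; rewrite step.
exists (h (inr (p (y 0)))) => e he.
have [z [hz _ <-]] := ER_edges_exists prim aper M_gt0 stable he.
have hb : occurs phi [:: z 0] by exists 0%N, (z 0); apply: infix_refl.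
have [i] := occurs_everywhere prim hy hb.
by rewrite /Defs.factor /mkseq /= addr0 => -[<-]; exact: const.
Qed.

Lemma coboundary_letter n v : coboundary (induce n (letter_fun v)) ->
  exists m j h, [/\ (n + m = j * M)%N, (0 < j)%N, edge_constant h &
    A^T ^+ m *m v = vertex_difference h].
Proof.
(* The level is raised to a multiple of [M], where the induced function on a fixed word splits into
   its two halves. *)
move=> h0; pose j0 := n.+1; pose m0 := (j0 * M - n)%N.
have nm : (n + m0 = j0 * M)%N by rewrite /m0 /j0; nia.
pose v' := A^T ^+ m0 *m v; pose f := induce (j0 * M) (letter_fun v').
have [u [r0 hu] fu] : coboundary f.
  have := cohomologous_level n m0 v; rewrite nm -/v' -/f => h1.
  by apply: coboundary_eq (coboundaryB h0 h1) => x _; ring.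
pose t x := u (shift (-1) x); pose r := r0.+1.
have ht : radius t r.
  move=> x x' hx hx' ag; apply: hu; try exact: biallowed_shift.
  by apply: agree_shift; rewrite addn1.
have ft x : Omega x -> f x = t (shift 1 x) - t x.
  by move=> hx; rewrite /t shiftD addNr shift0 fu.
have tel n' x : Omega x -> \sum_(i < n') f (shift i%:Z x) = t (shift n'%:Z x) - t x.
  move=> hx; elim: n' => [|n' IH]; first by rewrite big_ord0 shift0 subrr.
  rewrite big_ord_recr /= IH ft; last exact: biallowed_shift.
  rewrite shiftD (shift_eq x (_ : 1 + n'%:Z = n'.+1%:Z)); last by lia.
  by ring.
(* Sum [f] from the origin to the distant right: the sum and the far value of [t] read only the
   right half, hence so does [t] at the origin. [const1] is the mirror image. Together they make [t]
   constant on components. *)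
have const2 e e' : ER e -> ER e' -> e.2 = e'.2 -> t (fixed_word e) = t (fixed_word e').
  move=> he he' e2; have he1 := fixed_word_biallowed prim aper M_gt0 stable he.
  have he1' := fixed_word_biallowed prim aper M_gt0 stable he'.
  have q1 := tel r _ he1; have q2 := tel r _ he1'.
  have q3 := shift_fixed_right ht he he' e2 (lexx _).
  have q4 : \sum_(i < r) f (shift i%:Z (fixed_word e)) = \sum_(i < r) f (shift i%:Z (fixed_word e')).
    by apply: eq_bigr => i _; exact: letter_fixed_right.
  by move: q1 q2; rewrite q4 q3 => -> /addrI/oppr_inj.
have const1 e e' : ER e -> ER e' -> e.1 = e'.1 -> t (fixed_word e) = t (fixed_word e').
  move=> he he' e1; have he1 := fixed_word_biallowed prim aper M_gt0 stable he.
  have he1' := fixed_word_biallowed prim aper M_gt0 stable he'.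
  have q1 := tel r _ (biallowed_shift (- r%:Z) he1); have q2 := tel r _ (biallowed_shift (- r%:Z) he1').
  have q3 := shift_fixed_left ht he he' e1 (lexx _).
  have q4 : \sum_(i < r) f (shift i%:Z (shift (- r%:Z) (fixed_word e))) =
      \sum_(i < r) f (shift i%:Z (shift (- r%:Z) (fixed_word e'))).
    apply: eq_bigr => i _; rewrite !shiftD; apply: letter_fixed_left => //.
    by have := ltn_ord i; lia.
  by move: q1 q2; rewrite q4 q3 !shiftD !addrN !shift0 => -> /addIr.
have [h1 hh1] := choose_edge 0 const1; have [h2 hh2] := choose_edge 0 const2.
pose h (w : 'I_d + 'I_d) := match w with inl a => h1 a | inr b => h2 b end.
(* With [r.+1] more multiples of [M], [t] at the ends of a block cannot distinguish the word from a
   fixed word, and the block sum telescopes to [h] at the two ends. *)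
exists (m0 + r.+1 * M)%N, (j0 + r.+1)%N, h; split.
- by rewrite addnA nm mulnDl.
- by [].
- by move=> e he; rewrite /h hh1 // hh2.
rewrite addnC exprD -mulmxE -mulmxA -/v'.
apply/colP => a; have [y hy ya] := letter_exists prim aper a.
have := block_sum_letter phi (r.+1 * M) v' y; rewrite {2}/letter_fun ya => <-.
rewrite -(block_sum_induce (j0 * M) (r.+1 * M) (letter_fun v') hy) -/f -mulnDl.
set N := ((j0 + r.+1) * M)%N.
rewrite /block_sum tel; last exact: image_biallowed.
have tE z : Omega z -> t (image N z) = t (fixed_word (q (z (-1)), p (z 0))).
  move=> hz; apply: ht; first exact: image_biallowed.
    exact/fixed_word_biallowed/ER_edges_biallowed.
  by apply: image_fixed_word => //; rewrite /j0; lia.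
have -> : shift (size (pw N (y 0%R)))%:Z (image N y) = image N (shift 1 y).
  by rewrite image_shift cuts1.
have E1 := ER_edges_biallowed prim aper M_gt0 stable hy.
have E2 := ER_edges_biallowed prim aper M_gt0 stable (biallowed_shift 1 hy).
rewrite !tE //; last exact: biallowed_shift.
rewrite -(hh1 _ E2) -(hh2 _ E1) mxE /h /shift /= addNr.
by rewrite ya.
Qed.

End Exactness.

(** * Cech classes and their jumps *)

(** Closure under differences reduces single-valuedness to the case of 0. The maps below are thus
    defined through arbitrary representatives. *)
Lemma additive_of_relation (U V : zmodType) (rel : U -> V -> Prop) :
  (forall u v u' v', rel u v -> rel u' v' -> rel (u - u') (v - v')) ->
  (forall u, exists v, rel u v) -> (forall v, rel 0 v -> v = 0) ->
  exists f : {additive U -> V}, forall u, rel u (f u).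
Proof.
move=> relB /choice[f hf] rel0.
have fB : zmod_morphism f.
  move=> u v; apply/esym/eqP; rewrite -subr_eq0; apply/eqP/rel0.
  by have := relB _ _ _ _ (relB _ _ _ _ (hf u) (hf v)) (hf (u - v)); rewrite subrr.
pose F : {additive U -> V} := HB.pack f (GRing.isZmodMorphism.Build U V f fB).
by exists F.
Qed.

Lemma zmod_iso_of_relation (U V : zmodType) (rel : U -> V -> Prop) :
  (forall u v u' v', rel u v -> rel u' v' -> rel (u - u') (v - v')) ->
  (forall u, exists v, rel u v) -> (forall v, rel 0 v -> v = 0) ->
  (forall v, exists u, rel u v) -> (forall u, rel u 0 -> u = 0) ->
  zmod_iso U V.
Proof.
move=> relB tot rel0 surj inj.
have [f hf] := additive_of_relation relB tot rel0; exists f.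
have /choice[g hg] := surj; exists g => [u|v].
  apply/eqP; rewrite -subr_eq0; apply/eqP/inj.
  by have := relB _ _ _ _ (hg (f u)) (hf u); rewrite subrr.
apply/eqP; rewrite -subr_eq0; apply/eqP/rel0.
by have := relB _ _ _ _ (hf (g v)) (hg v); rewrite subrr.
Qed.

Lemma kernel_zmodClosed (U V : zmodType) (f : {additive U -> V}) :
  exists G : zmodClosed U, forall u, (u \in G) = (f u == 0).
Proof.
pose K : {pred U} := fun u => f u == 0.
have KB : zmod_closed K.
  split=> [|u v]; rewrite !unfold_in /K ?raddf0 //.
  by move=> /eqP e /eqP e'; rewrite raddfB e e' subrr.
pose G : zmodClosed U := HB.pack K (GRing.isZmodClosed.Build U K KB).
by exists G.
Qed.

Lemma quotient_eq0 (V : zmodType) (G : zmodClosed V) (v : V) :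
  (\pi_(quotient G)%qT v = 0) <-> v \in G.
Proof.
have -> : (0 : quotient G) = \pi_(quotient G)%qT 0 by rewrite raddf0.
split=> [/eqP|h]; last apply/eqP; by rewrite -Quotient.idealrBE subr0.
Qed.

Lemma to_dirlimB (D : dirsystem) i (x y : ds_obj (d:=D) i) :
  to_dirlim x - to_dirlim y = to_dirlim (x - y).
Proof.
by rewrite -to_dirlimD -to_dirlimN.
Qed.

Lemma to_dirlim_eq0 (D : dirsystem) i (x : ds_obj (d:=D) i) :
  to_dirlim x = 0 <-> exists k (h : ds_le i k), ds_map h x = 0.
Proof.
have -> : (0 : dirlim D) = to_dirlim (0 : ds_obj (d:=D) i) by rewrite to_dirlim0.
rewrite to_dirlim_eq; split=> [[k [hi [hj e]]]|[k [h e]]].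
  by exists k, hi; rewrite e raddf0.
by exists k, h, h; rewrite e raddf0.
Qed.

Section CechClasses.
Variable X : topologicalType.
Implicit Types (J : X -> X -> int) (g : X -> int).

Definition has_jump J (A : set X) g : Prop :=
  forall p, A p -> \forall q \near p, g q = g p + J p q.

Definition cech_class (U : open_cover X) (c : Z1 U) : cech_H1 X :=
  @to_dirlim (cech_system X) U (\pi_(nerve_H1 U)%qT c).

Lemma cech_classP (xi : cech_H1 X) : exists U (c : Z1 U), xi = cech_class c.
Proof.
have [U [x ->]] := to_dirlimP xi; exists U, (repr x).
by rewrite /cech_class reprK.
Qed.

Lemma cech_classB U (c c' : Z1 U) : cech_class c - cech_class c' = cech_class (c - c').
Proof. by rewrite to_dirlimB /cech_class raddfB. Qed.

Lemma cech_class_pullback U V p (hp : projection U V p) (c : Z1 U) :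
  cech_class (pullback hp c) = cech_class c.
Proof.
have h : refines U V by move=> B VB; exists (p B); apply: hp.
by rewrite /cech_class -(nerve_mapE h hp) (@to_dirlim_map (cech_system X) U V h).
Qed.

Lemma cech_class_eq0 U (c : Z1 U) : cech_class c = 0 <->
  exists V p (hp : projection U V p), pullback hp c \in @coboundary1 X V.
Proof.
split=> [/to_dirlim_eq0[V [h]]|[V [p [hp]]]].
  have [p hp] := refines_projection h.
  by rewrite /= (nerve_mapE h hp) => /quotient_eq0 e; exists V, p, hp.
move=> /quotient_eq0; rewrite -(cech_class_pullback hp) /cech_class => ->.
exact: (@to_dirlim0 (cech_system X) V).
Qed.

(** A cocycle [c] of class [xi] together with functions [g A] whose differences
    are the values of [c]; the germs of the [g A], which are described by
    their common jump function, determine [xi]. *)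
Definition represents J (xi : cech_H1 X) : Prop :=
  exists (U : open_cover X) (c : Z1 U) (g : set X -> X -> int),
    [/\ xi = cech_class c, forall A, members U A -> has_jump J A (g A) &
        forall A B p, members U A -> members U B -> A p -> B p ->
          val c A B = g B p - g A p].

Lemma cover_member (U : open_cover X) p : exists2 A, members U A & A p.
Proof.
have : [set: X] p by [].
by rewrite -(members_cover U) => -[A UA Ap]; exists A.
Qed.

Lemma member_nbhs (U : open_cover X) A p : members U A -> A p -> nbhs p A.
Proof. by move=> UA Ap; apply: open_nbhs_nbhs; split=> //; apply: members_open UA. Qed.

Lemma representsB J J' xi xi' : represents J xi -> represents J' xi' ->
  represents (fun p q => J p q - J' p q) (xi - xi').
Proof.
move=> [U [c [g [-> hg hc]]]] [U' [c' [g' [-> hg' hc']]]].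
have [V [/refines_projection[p hp] /refines_projection[p' hp']]] := refines_directed U U'.
exists V, (pullback hp c - pullback hp' c'), (fun A q => g (p A) q - g' (p' A) q); split.
- by rewrite -cech_classB !cech_class_pullback.
- move=> A VA q Aq; have [Up Ap] := hp _ VA; have [Up' Ap'] := hp' _ VA.
  near=> r; rewrite (near (hg _ Up q (Ap _ Aq))) // (near (hg' _ Up' q (Ap' _ Aq))) //.
  by rewrite opprD addrACA.
- move=> A B q VA VB Aq Bq.
  have [UA sA] := hp _ VA; have [UA' sA'] := hp' _ VA.
  have [UB sB] := hp _ VB; have [UB' sB'] := hp' _ VB.
  have -> : val (pullback hp c - pullback hp' c') A B =
    val c (p A) (p B) - val c' (p' A) (p' B) by [].
  rewrite (hc _ _ q UA UB (sA _ Aq) (sB _ Bq)) (hc' _ _ q UA' UB' (sA' _ Aq) (sB' _ Bq)).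
  by lia.
Unshelve. all: by end_near. Qed.

Lemma represents_near J J' xi : (forall p, \forall q \near p, J p q = J' p q) ->
  represents J xi -> represents J' xi.
Proof.
move=> e [U [c [g [-> hg hc]]]]; exists U, c, g; split=> // A UA p Ap.
near=> q; rewrite -(near (e p)) //; exact: (near (hg A UA p Ap)).
Unshelve. all: by end_near. Qed.

(** The sections are locally constant, so their level sets refine the cover, and there the cocycle
    is the difference of the levels. *)
Lemma represents0 xi : represents (fun _ _ => 0) xi -> xi = 0.
Proof.
move=> [U [c [g [-> hg hc]]]].
pose level A (n : int) := A `&` [set p | g A p = n].
pose M := [set B | exists A n, members U A /\ B = level A n].
have Mo B : M B -> open B.
  move=> [A [n [UA ->]]]; rewrite openE => p [Ap gp].
  rewrite /interior; near=> q; split; first exact: (near (member_nbhs UA Ap)).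
  by rewrite /= (near (hg A UA p Ap)) // addr0.
have Mc : \bigcup_(B in M) B = [set: X].
  rewrite -subTset => p _; have [A UA Ap] := cover_member U p.
  by exists (level A (g A p)) => //; exists A, (g A p).
pose V := OpenCover Mo Mc.
have /choice[t ht] : forall B, exists t : set X * int,
    members V B -> members U t.1 /\ B = level t.1 t.2.
  move=> B; case: (pselect (M B)) => [[A [n h]]|nB]; first by exists (A, n).
  by exists (B, 0).
have hp : projection U V (fun B => (t B).1).
  by move=> B VB; have [UB e] := ht B VB; split=> //; rewrite {1}e => q [].
apply/cech_class_eq0; exists V, (fun B => (t B).1), hp; apply/asboolP.
exists (fun B => (t B).2) => A B VA VB [q [Aq Bq]] /=.
have [UA eA] := ht A VA; have [UB eB] := ht B VB.
rewrite eA in Aq; rewrite eB in Bq; have [Aq1 Aq2] := Aq; have [Bq1 Bq2] := Bq.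
have := hc _ _ q UA UB Aq1 Bq1.
by move: Aq2 Bq2 => /= -> ->.
Unshelve. all: by end_near. Qed.

(** If the cocycle is the coboundary of [f] on a refinement, the sections corrected by [f] agree on
    overlaps and glue. *)
Lemma represents_trivial J : represents J 0 <-> exists g, has_jump J [set: X] g.
Proof.
split=> [[U [c [g [/esym/cech_class_eq0[V [p [hp /asboolP[f hf]]]] hg hc]]]]|[g hg]].
  have /choice[m hm] : forall q, exists A, members V A /\ A q.
    by move=> q; have [A VA Aq] := cover_member V q; exists A.
  pose G q := g (p (m q)) q - f (m q).
  have GE B q : members V B -> B q -> G q = g (p B) q - f B.
    move=> VB Bq; have [Vm mq] := hm q.
    have := hf _ _ Vm VB (ex_intro _ q (conj mq Bq)).
    have -> : val (pullback hp c) (m q) B = val c (p (m q)) (p B) by [].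
    have [Um sm] := hp _ Vm; have [UB sB] := hp _ VB.
    by rewrite (hc _ _ q Um UB (sm _ mq) (sB _ Bq)) /G; lia.
  exists G => q _; have [Vm mq] := hm q; have [Um sm] := hp _ Vm.
  near=> r; rewrite (GE (m q) q) // (GE (m q) r) //; last first.
    exact: (near (member_nbhs Vm mq)).
  by rewrite (near (hg _ Um q (sm _ mq))) // addrAC.
exists (trivial_cover X), 0, (fun=> g); split=> // [|A _ p _|A B p _ _ _ _].
- rewrite /cech_class raddf0; apply/esym; exact: (@to_dirlim0 (cech_system X)).
- exact: hg.
- by rewrite subrr.
Unshelve. all: by end_near. Qed.

Lemma represents_exists J (I : Type) (A : I -> set X) (g : I -> X -> int) :
  (forall i, open (A i)) -> (forall p, exists i, A i p) ->
  (forall i, has_jump J (A i) (g i)) ->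
  (forall i j, exists n : int, forall p, A i p -> A j p -> g j p - g i p = n) ->
  exists xi, represents J xi.
Proof.
move=> Ao Ac hg hn.
have {hn}[n hn] : exists n : I -> I -> int,
    forall i j p, A i p -> A j p -> g j p - g i p = n i j.
  by exists (fun i j => projT1 (cid (hn i j))) => i j; case: cid.
have Uo B : range A B -> open B by move=> [i _ <-].
have Uc : \bigcup_(B in range A) B = [set: X].
  by rewrite -subTset => p _; have [i Aip] := Ac p; exists (A i) => //; exists i.
pose U := OpenCover Uo Uc.
have [p0|noX] := pselect (exists p : X, True); last first.
  exists (cech_class (0 : Z1 U)), U, 0, (fun _ _ => 0).
  by split=> // B _ p; exfalso; apply: noX; exists p.
have {p0}[i0 _] : exists i : I, True by have [p _] := p0; have [i _] := Ac p; exists i.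
(* Members of a cover are bare sets, so an index must be chosen for each of them. *)
have /choice[idx hidx] : forall B, exists i, range A B -> A i = B.
  by move=> B; case: (pselect (range A B)) => [[i _ <-]|nB]; [exists i|exists i0].
have cc : (fun B B' => n (idx B) (idx B')) \in cocycle1 U.
  apply/asboolP => B1 B2 B3 /hidx e1 /hidx e2 /hidx e3 [p [[]]].
  rewrite -{1}e1 -{1}e2 -{1}e3 => h1 h2 h3.
  by rewrite -(hn _ _ p h2 h3) -(hn _ _ p h1 h3) -(hn _ _ p h1 h2); lia.
pose c : Z1 U := exist (fun b : cochain1 X => b \in cocycle1 U) _ cc.
exists (cech_class c), U, c, (fun B => g (idx B)); split=> // [B /hidx {1}<- //|].
move=> B B' p /hidx e /hidx e' Bp B'p.
by rewrite (hn (idx B) (idx B') p) // ?e ?e'.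
Qed.

End CechClasses.

(** * The cohomology of the tiling space *)

Section TilingTopology.
Variables (R : realType) (d : nat) (phi : substitution d) (omega : 'rV[R]_d).
Hypothesis omega_gt0 : forall a, 0 < omega ord0 a.
Implicit Types (x : int -> 'I_d) (T : tiling_space phi omega).

Let wd (a : 'I_d) : R := omega ord0 a.

Definition vertex x : int -> R := psum (fun i => omega ord0 (x i)).

Lemma vertexS x (i : int) : vertex x (i + 1) = vertex x i + wd (x i).
Proof. exact: psumS. Qed.

Lemma vertex0 x : vertex x 0 = 0.
Proof. exact: psum0. Qed.

Lemma vertex_shift x (j i : int) : vertex (shift j x) i = vertex x (i + j) - vertex x j.
Proof.
have := @psum_uniq _ (fun i => omega ord0 (shift j x i)) (fun i => vertex x (i + j)) _ i.
rewrite /= add0r => ->; first by rewrite addrC addKr.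
by move=> k; rewrite addrAC vertexS.
Qed.

Lemma omega_min : exists2 m : R, 0 < m & forall a, m <= wd a.
Proof.
have pos : 0 < \sum_a (wd a)^-1 + 1.
  by apply: ltr_wpDl => //; apply: sumr_ge0 => a _; rewrite invr_ge0 ltW // omega_gt0.
(* The inverse of a sum of inverses lies below each width; the term 1 keeps it positive even for an
   empty alphabet. *)
exists (\sum_a (wd a)^-1 + 1)^-1 => [|a]; first by rewrite invr_gt0.
rewrite -[leRHS]invrK lef_pV2 ?posrE ?invr_gt0 ?omega_gt0 //.
rewrite (bigD1 a) //= -addrA lerDl addr_ge0 //.
by apply: sumr_ge0 => b _; rewrite invr_ge0 ltW // omega_gt0.
Qed.

Lemma vertex_growth : exists2 m : R, 0 < m & (forall a, m <= wd a) /\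
  forall x (i j : int), i <= j -> m * (j - i)%:~R <= vertex x j - vertex x i.
Proof.
have [m m0 hm] := omega_min; exists m => //; split=> // x i j ij.
have -> : j = i + (absz (j - i)%R)%:Z by lia.
elim: (absz _) => [|n IH]; first by rewrite addr0 !subrr mulr0.
have -> : i + n.+1%:Z = i + n%:Z + 1 by lia.
rewrite vertexS; have -> : i + n%:Z + 1 - i = (i + n%:Z - i) + 1 by lia.
rewrite intrD mulrDr mulr1; have := hm (x (i + n%:Z)); move: IH.
set a := m * _; set b := vertex x (i + _); lra.
Qed.

Lemma vertex_lt x (i j : int) : i < j -> vertex x i < vertex x j.
Proof.
move=> ij; have [m m0 [_ h]] := vertex_growth; have := h x i j (ltW ij).
have : 0 < m * (j - i)%:~R by apply: mulr_gt0 => //; rewrite ltr0z subr_gt0.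
lra.
Qed.

Lemma vertex_le x (i j : int) : i <= j -> vertex x i <= vertex x j.
Proof.
by rewrite le_eqVlt => /predU1P[->//|/vertex_lt/ltW].
Qed.

Lemma vertex_locate x (s : R) : exists i : int, vertex x i <= s < vertex x (i + 1).
Proof.
have [m m0 [_ h]] := vertex_growth.
have [N hN] : exists N : nat, `|s| < m * N%:R.
  exists (Num.bound (`|s| / m)); rewrite mulrC -ltr_pdivrMr //.
  apply: le_lt_trans (archi_boundP _); first by [].
  by rewrite divr_ge0 ?normr_ge0 // ltW.
have hp : s < vertex x N%:Z.
  have := h x 0 N%:Z isT; rewrite vertex0 !subr0 -pmulrn => h1.
  by apply: lt_le_trans h1; apply: le_lt_trans (ler_norm s) hN.
have hn : vertex x (- N%:Z) <= s.
  have := h x (- N%:Z) 0 ltac:(lia); rewrite vertex0 !sub0r opprK -pmulrn => h1.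
  have := ler_norm (- s); rewrite normrN; lra.
have : forall n : nat, s < vertex x (- N%:Z + n%:Z) ->
    exists i : int, vertex x i <= s < vertex x (i + 1).
  elim=> [|n IH] hs; first by move: hs; rewrite addr0; lra.
  case: (ltP s (vertex x (- N%:Z + n%:Z))) => [/IH //|h1].
  exists (- N%:Z + n%:Z); rewrite h1 /=.
  by have -> : - N%:Z + n%:Z + 1 = - N%:Z + n.+1%:Z by lia.
move=> /(_ (N + N)%N); apply.
by have -> : - N%:Z + (N + N)%N%:Z = N%:Z by lia.
Qed.

(** The left end of the right tile and the smaller of the two right ends both lie in the one-point
    intersection, hence coincide; positive widths then force that right end to be the one of the
    left tile. *)
Lemma tiling_step T (i : int) : (T (i + 1)).1 = (T i).1 + wd (T i).2.
Proof.
have [_ meet ord _] := tiles_tiling T.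
have lt := ord i; have [z hz] := meet i.
have w1 := omega_gt0 (T i).2; have w2 := omega_gt0 (T (i + 1)).2.
have zz : (Defs.support omega (T i) `&` Defs.support omega (T (i + 1))) z by rewrite hz.
move: zz => [/= /andP[z1 z2] /andP[z3 z4]].
have uz y : Defs.support omega (T i) y -> Defs.support omega (T (i + 1)) y -> y = z.
  by move=> h1 h2; have : (Defs.support omega (T i) `&` Defs.support omega (T (i + 1))) y by []; rewrite hz.
have e1 : (T (i + 1)).1 = z.
  by apply: uz; rewrite /Defs.support /=; lra.
case: (lerP ((T i).1 + wd (T i).2) ((T (i + 1)).1 + wd (T (i + 1)).2)) => h.
  by have : (T i).1 + wd (T i).2 = z; [apply: uz; rewrite /Defs.support /= /wd in h *; lra|lra].
have : (T (i + 1)).1 + wd (T (i + 1)).2 = z; last by rewrite -e1 /wd; lra.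
by apply: uz; rewrite /Defs.support /= /wd in h *; lra.
Qed.

Definition word T : int -> 'I_d := tiling_word T.
Definition phase T : R := - (T 0).1.

Lemma phase_bounds T : 0 <= phase T < wd (word T 0).
Proof.
have [_ _ _ [/= /andP[h1' h2'] h3]] := tiles_tiling T.
have h1 : (T 0).1 <= 0 := h1'.
have h2 : 0 <= (T 0).1 + wd (T 0).2 := h2'.
have e : (T 1).1 = (T 0).1 + wd (T 0).2 := tiling_step T 0.
have w1 : 0 < wd (T 1).2 := omega_gt0 _.
rewrite /phase /word /tiling_word; apply/andP; split; first by lra.
suff : ~ (T 1).1 <= 0 by move/negP; rewrite -ltNge; lra.
move=> h; apply: h3; apply/andP; rewrite -/(wd _); split; lra.
Qed.

Lemma tile_word T (i : int) : T i = (vertex (word T) i - phase T, word T i).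
Proof.
rewrite [LHS]surjective_pairing; congr (_, _).
have := @psum_uniq _ (fun i => wd (T i).2) (fun i => (T i).1) (tiling_step T) i => /= ->.
by rewrite /phase opprK addrC.
Qed.

Lemma word_biallowed T : biallowed phi (word T).
Proof. exact: tiles_allowed. Qed.

(** [T] has the vertices [vertex x i - s]: it is the tiling with word [x] and a
    vertex at [0], translated by [- s]. *)
Definition located x (s : R) T : Prop :=
  exists k : int, forall i : int, T i = (vertex x (i + k) - s, x (i + k)).

Lemma located_self T : located (word T) (phase T) T.
Proof. by exists 0 => i; rewrite addr0 tile_word. Qed.

Lemma located_shift (j : int) x s T : located x s T ->
  located (shift j x) (s - vertex x j) T.
Proof.
move=> [k hk]; exists (k - j) => i; rewrite hk vertex_shift /shift.
have -> : i + (k - j) + j = i + k by lia.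
by congr (_, _); lra.
Qed.

Lemma located_index x s T k : (forall i : int, T i = (vertex x (i + k) - s, x (i + k))) ->
  vertex x k <= s < vertex x (k + 1).
Proof.
move=> hk; have := phase_bounds T; rewrite /phase /word /tiling_word hk add0r /=.
by rewrite vertexS; lra.
Qed.

Lemma vertex_index_uniq x s (i j : int) : vertex x i <= s < vertex x (i + 1) ->
  vertex x j <= s < vertex x (j + 1) -> i = j.
Proof.
have H (k l : int) : vertex x k <= s -> s < vertex x (l + 1) -> k <= l.
  move=> h1 h2; rewrite leNgt; apply/negP => lk.
  have := @vertex_le x (l + 1) k ltac:(lia); lra.
move=> /andP[h1 h2] /andP[h3 h4]; apply/eqP; rewrite eq_le.
by rewrite (H i j) // (H j i).
Qed.

Lemma tiling_ext T T' : (forall i : int, T i = T' i) -> T = T'.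
Proof.
case: T T' => [t h1 h2] [t' h1' h2'] /= e; have et : t = t' by apply/funext.
by subst t'; congr Tiling; apply: Prop_irrelevance.
Qed.

Lemma located_uniq x s T T' : located x s T -> located x s T' -> T = T'.
Proof.
move=> [k hk] [k' hk']; apply: tiling_ext => i; rewrite hk hk'.
by rewrite (vertex_index_uniq (located_index hk) (located_index hk')).
Qed.

Lemma located_word x s T : located x s T -> 0 <= s < wd (x 0) -> word T = x /\ phase T = s.
Proof.
move=> [k hk] hs; have k0 : k = 0.
  apply: (vertex_index_uniq (located_index hk)); rewrite add0r vertex0.
  by rewrite -[1%R]add0r vertexS vertex0 add0r.
split; first by apply/funext => i; rewrite /word /tiling_word hk k0 addr0.
by rewrite /phase hk k0 add0r vertex0 sub0r opprK.
Qed.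

Lemma located_exists x s : biallowed phi x -> exists T, located x s T.
Proof.
move=> hx; have [k hk] := vertex_locate x s.
pose t (i : int) : tile R d := (vertex x (i + k) - s, x (i + k)).
have tS (i : int) : vertex x (i + 1 + k) = vertex x (i + k) + wd (x (i + k)).
  by rewrite -vertexS; congr vertex; lia.
have ht : is_tiling omega t.
  split.
  - rewrite -subTset => y _; have [i hi] := vertex_locate x (y + s).
    exists (i - k) => //; rewrite /Defs.support /t /= subrK.
    by move: hi; rewrite vertexS /wd; lra.
  - move=> i; exists (vertex x (i + 1 + k) - s).
    have w1 := omega_gt0 (x (i + k)); have w2 := omega_gt0 (x (i + 1 + k)).
    apply/seteqP; split=> y; rewrite /Defs.support /= tS /wd.
      by move=> [/= h1 h2]; lra.
    by move=> ->; split => /=; lra.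
  - by move=> i; rewrite /t /= tS ltrD2r ltrDl omega_gt0.
  - rewrite /Defs.support /t /=; have := tS 0; rewrite add0r => e.
    move: hk; have -> : k + 1 = 1 + k by lia.
    rewrite add0r in e; move=> /andP[q1 q2]; rewrite e in q2; rewrite add0r -/(wd _).
    by split=> [|/andP[q3 _]]; [lra|rewrite e in q3; lra].
have ha : biallowed phi (tiling_word t).
  by move=> i n; have := biallowed_shift k hx i n.
by exists (Tiling ht ha), k.
Qed.

Lemma psum_agree_vertex N x x' (i : int) : agree N x x' -> - N%:Z <= i <= N%:Z ->
  vertex x i = vertex x' i.
Proof.
by move=> h; apply: (@psum_agree _ N) => k hk /=; rewrite h.
Qed.

Lemma located_nbhs x s T (P : set (tiling_space phi omega)) : located x s T -> nbhs T P ->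
  exists N, exists2 eta : R, 0 < eta & forall x' s' T',
    located x' s' T' -> agree N x x' -> `|s - s'| < eta -> P T'.
Proof.
move=> [k hk] [delta d0 hP]; have [m m0 [hm grow]] := vertex_growth.
have [N hN] : exists N : nat, delta^-1 + `|s| < m * N%:R.
  exists (Num.bound ((delta^-1 + `|s|) / m)); rewrite mulrC -ltr_pdivrMr //.
  apply: le_lt_trans (archi_boundP _); first by [].
  by rewrite divr_ge0 ?addr_ge0 ?normr_ge0 ?invr_ge0 // ltW.
exists N, delta => // x' s' T' [k' hk'] ag hs; apply: hP.
exists (s' - s); first by rewrite distrC.
(* The tiles that meet the ball of radius [delta^-1] have indices controlled by the agreement of the
   words. *)
have out (z : int -> 'I_d) (i : int) y : vertex z i - s <= y -> y <= vertex z i - s + wd (z i) ->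
    `|y| < delta^-1 -> - N%:Z <= i < N%:Z.
  rewrite ltr_norml => h1 h2 /andP[h3 h4]; have sn := ler_norm s.
  have sn' := ler_norm (- s); rewrite normrN in sn'.
  rewrite -addrA [- s + _]addrC addrA -vertexS in h2.
  apply/andP; split; [rewrite leNgt|rewrite ltNge]; apply/negP => hi.
    have := grow z (i + 1) (- N%:Z) ltac:(clear -hi; lia); have := grow z (- N%:Z) 0 ltac:(clear; lia).
    rewrite vertex0 sub0r opprK -pmulrn => g1 g2.
    have : 0 <= m * (- N%:Z - (i + 1))%:~R by apply: mulr_ge0; [exact: ltW|rewrite ler0z; clear -hi; lia].
    lra.
  have := grow z N%:Z i ltac:(clear -hi; lia); have := grow z 0 N%:Z ltac:(clear; lia).
  rewrite vertex0 !subr0 -pmulrn => g1 g2.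
  have : 0 <= m * (i - N%:Z)%:~R by apply: mulr_ge0; [exact: ltW|rewrite ler0z; clear -hi; lia].
  lra.
move=> t [y /= /andP[y1 y2] y3]; split=> -[i _ /= e].
  have hi : - N%:Z <= i + k < N%:Z.
    by rewrite -e hk /= in y1 y2; exact: out y1 y2 y3.
  exists (i + k - k') => //=; rewrite -e hk hk' /translate /=.
  have -> : i + k - k' + k' = i + k by lia.
  by rewrite (ag _ hi) (psum_agree_vertex ag) ?(ltW (proj2 (andP hi))) ?(proj1 (andP hi)) //; congr (_, _); lra.
have hi : - N%:Z <= i + k' < N%:Z.
  rewrite -e hk' /translate /= in y1 y2.
  have q (a : R) : a - s' + (s' - s) = a - s by lra.
  by rewrite q in y1 y2; exact: out y1 y2 y3.
exists (i + k' - k) => //=; rewrite -e hk hk' /translate /=.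
have -> : i + k' - k + k = i + k' by lia.
by rewrite (ag _ hi) (psum_agree_vertex ag) ?(ltW (proj2 (andP hi))) ?(proj1 (andP hi)) //; congr (_, _); lra.
Qed.

Lemma near_located x s T N (eta : R) : located x s T -> 0 < eta ->
  \forall T' \near T, exists x' s', [/\ biallowed phi x', located x' s' T',
    agree N x x' & `|s - s'| < eta].
Proof.
move=> [k hk] eta0; pose M := N.+1.
(* All vertices with index in [-M, M] lie within distance [B] of the origin, so closeness at scale
   [B^-1] controls these tiles. *)
pose B := `|vertex x (- M%:Z)| + `|vertex x M%:Z| + `|s| + 1.
have B0 : 0 < B by rewrite ltr_wpDl // !addr_ge0.
exists (Num.min eta B^-1); first by rewrite lt_min eta0 invr_gt0.
move=> T' [e he h].
have eeta : `|e| < eta by apply: lt_le_trans he _; rewrite ge_min lexx.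
have big : B <= (Num.min eta B^-1)^-1.
  by rewrite -[leLHS]invrK lef_pV2 ?posrE ?lt_min ?eta0 ?invr_gt0 // ge_min lexx orbT.
have tile (j : int) : - M%:Z <= j <= M%:Z -> exists i : int, T' i = (vertex x j - s - e, x j).
  move=> /andP[j1 j2].
  have /h[+ _] : exists2 y, Defs.support omega (vertex x j - s, x j) y & `|y| < (Num.min eta B^-1)^-1.
    exists (vertex x j - s).
      by rewrite /Defs.support /= lexx lerDl ltW // omega_gt0.
    apply: lt_le_trans big; rewrite /B ltr_norml.
    have nb (u : R) : - `|u| <= u <= `|u| by rewrite -ler_norml.
    move: (vertex_le x j1) (vertex_le x j2) (nb s) (nb (vertex x M%:Z)) (nb (vertex x (- M%:Z))).
    move: (vertex x (- M%:Z)) (vertex x M%:Z) (vertex x j) => u v w q1 q2 /andP[q3 q4] /andP[q5 q6] /andP[q7 q8].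
    have := normr_ge0 u; have := normr_ge0 v => q9 q10.
    by apply/andP; split; lra.
  case=> [|i _ /= ei]; first by exists (j - k) => //; rewrite hk subrK.
  exists i; move: ei; rewrite /translate; case: (T' i) => a b /= [<- <-].
  by congr (_, _); lra.
have [k0 hk0] := tile (- M%:Z) ltac:(lia).
have T'lt (i j : int) : (T' i).1 = (T' j).1 -> i = j.
  move=> eij; rewrite !tile_word /= in eij; apply/eqP; rewrite eq_le !leNgt.
  by apply/andP; split; apply/negP => /(vertex_lt (word T')); lra.
have all (n : nat) : (n <= M + M)%N ->
    T' (k0 + n%:Z) = (vertex x (n%:Z - M%:Z) - s - e, x (n%:Z - M%:Z)).
  elim: n => [|n IH] hn; first by rewrite addr0 sub0r.
  have [i hi] := tile (n.+1%:Z - M%:Z) ltac:(lia).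
  rewrite -hi; congr (T' _); apply: T'lt.
  have -> : k0 + n.+1%:Z = k0 + n%:Z + 1 by lia.
  rewrite tiling_step IH /=; last by lia.
  rewrite hi /=; have -> : n.+1%:Z - M%:Z = n%:Z - M%:Z + 1 by lia.
  by rewrite vertexS; lra.
pose j0 := k0 + M%:Z.
exists (shift j0 (word T')), (phase T' - vertex (word T') j0); split.
- exact/biallowed_shift/word_biallowed.
- exact/located_shift/located_self.
- move=> i hi; have := all (absz (i + M%:Z)%R) ltac:(rewrite /M; lia).
  have -> : k0 + (absz (i + M%:Z)%R)%:Z = i + j0 by rewrite /j0 /M; lia.
  have -> : (absz (i + M%:Z)%R)%:Z - M%:Z = i by rewrite /M; lia.
  by rewrite tile_word => -[].
- have := all M ltac:(lia); rewrite subrr vertex0 -/j0 tile_word => -[e1 _].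
  by have -> : s - (phase T' - vertex (word T') j0) = - e; [lra|rewrite normrN].
Qed.

(** Near [T], the vertex structure is unchanged, except that the vertex at the
    origin of [T], if any, may have moved to the right of the origin. *)
Lemma near_cases T N (eta : R) : 0 < eta ->
  \forall T' \near T,
    (agree N (word T) (word T') /\ `|phase T' - phase T| < eta) \/
    [/\ phase T = 0, agree N (word T) (shift 1 (word T')) &
        wd (word T' 0) - eta < phase T'].
Proof.
move=> eta0; have [m m0 [hm _]] := vertex_growth; have /andP[t0 tw] := phase_bounds T.
(* When the phase is positive, the bound [e1] keeps [s'] positive, so no vertex can cross the
   origin. *)
pose e1 := if phase T == 0 then eta else phase T.
have e10 : 0 < e1 by rewrite /e1; case: eqP => // /eqP nz; rewrite lt_neqAle eq_sym nz.
pose e2 := Num.min (Num.min eta m) (Num.min e1 (wd (word T 0) - phase T)).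
have e20 : 0 < e2 by rewrite !lt_min eta0 m0 e10 subr_gt0.
have /and4P[l1 l2 l3 l4] : [&& e2 <= eta, e2 <= m, e2 <= e1 & e2 <= wd (word T 0) - phase T].
  by rewrite /e2 !ge_min !lexx /= ?orbT.
near=> T'.
have [x' [s' [hx' hl ag]]] : exists x' s', [/\ biallowed phi x', located x' s' T',
    agree N.+1 (word T) x' & `|phase T - s'| < e2].
  by near: T'; apply: near_located => //; exact: located_self.
rewrite ltr_norml => /andP[b1 b2].
case: (lerP 0 s') => s0.
  have [ew ep] : word T' = x' /\ phase T' = s'.
    apply: (located_word hl); rewrite s0 /=.
    rewrite -(ag 0); last by clear; lia.
    lra.
  left; rewrite ew ep; split; first exact: agree_le ag.
  by rewrite ltr_norml; apply/andP; split; lra.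
right; have tz : phase T = 0.
  move: l3; rewrite /e1; case: eqP => // _ l3; lra.
have := located_shift (-1) hl; set x'' := shift _ _; set s'' := _ - _ => hl2.
have vm : vertex x' (-1) = - wd (x' (-1)).
  by have := vertexS x' (-1); rewrite addNr vertex0; lra.
have x0 : x'' 0 = x' (-1) by rewrite /x'' /shift add0r.
have [ew ep] : word T' = x'' /\ phase T' = s''.
  apply: (located_word hl2); rewrite x0 /s'' vm; have := hm (x' (-1)); lra.
split=> //.
  by rewrite ew /x'' shiftD subrr shift0; exact: agree_le ag.
by rewrite ew ep x0 /s'' vm; lra.
Unshelve. all: by end_near. Qed.

(** When the vertex at the origin of [T] moves to the right of the origin, the
    phase of the tiling is close to the length of its tile at the origin, and
    the functions with jump [jump f] drop by the value of [f] at this vertex. *)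
Definition jump (f : (int -> 'I_d) -> int) T T' : int :=
  if (phase T == 0) && (wd (word T' 0) <= phase T' *+ 2) then - f (word T) else 0.

Lemma jump_eq f f' xi : (forall x, biallowed phi x -> f x = f' x) ->
  represents (jump f) xi -> represents (jump f') xi.
Proof.
move=> e; apply: represents_near => T; near=> T'.
by rewrite /jump (e _ (word_biallowed T)).
Unshelve. all: by end_near. Qed.

Lemma jumpB f f' xi xi' : represents (jump f) xi -> represents (jump f') xi' ->
  represents (jump (fun x => f x - f' x)) (xi - xi').
Proof.
move=> h h'; apply: represents_near (representsB h h') => T; near=> T'.
by rewrite /jump; case: ifP => _; lia.
Unshelve. all: by end_near. Qed.

Definition near_jump f N (eta : R) T T' : Prop :=
  [/\ agree N (word T) (word T'), `|phase T' - phase T| < eta & jump f T T' = 0] \/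
  [/\ phase T = 0, agree N (word T) (shift 1 (word T')), wd (word T' 0) - eta < phase T'
   & jump f T T' = - f (word T)].

Lemma near_jumpP T f N (eta : R) : 0 < eta -> \forall T' \near T, near_jump f N eta T T'.
Proof.
move=> eta0; have [m m0 [hm _]] := vertex_growth.
(* Half the least tile length separates the two cases at the threshold used in [jump]. *)
pose e := Num.min eta (m / 2).
have e0 : 0 < e by rewrite lt_min eta0 divr_gt0.
have [l1 l2] : e <= eta /\ e <= m / 2 by rewrite /e !ge_min !lexx orbT.
near=> T'.
have [[ag ht]|[t0 ag ht]] : (agree N (word T) (word T') /\ `|phase T' - phase T| < e) \/
    [/\ phase T = 0, agree N (word T) (shift 1 (word T')) &
        wd (word T' 0) - e < phase T'] by near: T'; exact: near_cases.
  left; split=> //; first exact: lt_le_trans ht l1.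
  rewrite /jump; case: eqP => //= t0; rewrite leNgt mulr2n.
  rewrite t0 subr0 ltr_norml in ht; have /andP[_ h] := ht.
  by have := hm (word T' 0) => hm'; rewrite ifF //; apply/negbTE; rewrite negbK; lra.
right; have := hm (word T' 0) => hm'; split=> //; first lra.
by rewrite /jump t0 eqxx /= mulr2n ifT //; lra.
Unshelve. all: by end_near. Qed.

Lemma coboundary_represents f : coboundary phi f -> represents (jump f) 0.
Proof.
move=> [u [r hr] hu]; apply/represents_trivial; exists (fun T => u (word T)) => T _.
near=> T'.
have hb := word_biallowed T; have hb' := word_biallowed T'.
have [[ag _ ->]|[_ ag _ ->]] : near_jump f r.+1 1 T T' by near: T'; exact: near_jumpP.
  by rewrite addr0; apply/esym/hr => //; exact: agree_le ag.
rewrite (hu _ hb) (_ : u (word T') = u (shift (-1) (word T))); first by lia.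
apply: hr => //; first exact: biallowed_shift.
have -> : word T' = shift (-1) (shift 1 (word T')) by rewrite shiftD addNr shift0.
by apply/agree_sym/agree_shift; rewrite addn1.
Unshelve. all: by end_near. Qed.

Lemma locally_constant_segment (G : R -> int) (w : R) : 0 < w ->
  (forall s, 0 <= s <= w -> exists2 eta : R, 0 < eta &
     forall s', 0 <= s' <= w -> `|s - s'| < eta -> G s' = G s) -> G w = G 0.
Proof.
move=> w0 hG.
pose E := [set s : R | 0 <= s <= w /\ forall s', 0 <= s' <= s -> G s' = G 0].
have E0 : E 0.
  split=> [|s' h]; first by rewrite lexx ltW.
  by congr G; lra.
have Eb : ubound E w by move=> s [/andP[]].
have hs : has_sup E by split; [exists 0|exists w].
have sE := sup_upper_bound hs.
pose c := sup E.
have c0 : 0 <= c by apply: sE.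
have cw : c <= w by apply: ge_sup => //; exists 0.
have [eta eta0 he] := hG c ltac:(by rewrite c0 cw).
have [s Es sc] := sup_adherent eta0 hs.
have [/andP[s0 sw] hsG] := Es.
have sc' := sE s Es; rewrite -/c in sc sc'.
have Gc : G c = G 0.
  rewrite -(he s) ?s0 ?sw //; first by apply: hsG; rewrite s0 lexx.
  by rewrite ltr_norml; apply/andP; split; lra.
have near s' : 0 <= s' <= w -> s' < c + eta -> G s' = G 0.
  move=> /andP[h1 h2] h3; case: (lerP s' s) => h4.
    by apply: hsG; rewrite h1 h4.
  rewrite -Gc; apply: he; first by rewrite h1 h2.
  by rewrite ltr_norml; apply/andP; split; lra.
apply: (near w); first by rewrite lexx ltW.
rewrite ltNge; apply/negP => h.
have Ec : E (c + eta / 2).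
  split=> [|s' /andP[h1 h2]]; first by apply/andP; split; lra.
  by apply: (near s'); [apply/andP; split; lra|lra].
by have := sE _ Ec; rewrite -/c; lra.
Qed.

Lemma locconst_compact (V : Type) (u : (int -> 'I_d) -> V) :
  (forall x, biallowed phi x -> exists r, forall x', biallowed phi x' -> agree r x x' -> u x' = u x) ->
  locconst phi u.
Proof.
move=> hu; apply: contrapT => nr; have [U [UU Uoo]] := free_ultrafilter.
have /choice[f hf] : forall r, exists f : (int -> 'I_d) * (int -> 'I_d),
    [/\ biallowed phi f.1, biallowed phi f.2, agree r f.1 f.2 & u f.1 <> u f.2].
  move=> r; apply: contrapT => nf; apply: nr; exists r => x x' h h' a.
  by apply: contrapT => np; apply: nf; exists (x, x').
have [h1 h2 h3 h4] := all_and4 hf.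
have [x hx] := ultralimit_exists UU (fun r => (f r).1).
have [r hr] := hu x (biallowed_ultralimit UU hx h1).
have [n [/= e1 e2]] := filter_ex (filterI (hx r) (Uoo r)).
apply: (h4 n); rewrite (hr (f n).1) ?(hr (f n).2) //.
  by apply: agree_trans (agree_sym e1) _; exact: agree_le (h3 n).
exact: agree_sym.
Qed.

(** A global section, read along the first tile of [x], is constant up to its right end, where it
    jumps by [f]. Its values at the tilings with a vertex at the origin form the transfer
    function. *)
Lemma represents_coboundary f : represents (jump f) 0 -> coboundary phi f.
Proof.
move=> /represents_trivial[G hG].
have /choice[v hv] : forall x, exists v : R -> int,
    biallowed phi x -> forall s T, located x s T -> v s = G T.
  move=> x; case: (pselect (biallowed phi x)) => [hx|nx]; last by exists (fun=> 0).
  have /choice[tl h] := fun s => located_exists s hx.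
  by exists (fun s => G (tl s)) => _ s T hT; rewrite (located_uniq hT (h s)).
have step x : biallowed phi x -> f (shift 1 x) = v (shift 1 x) 0 - v x 0.
  move=> hx; set w := wd (x 0); have w0 : 0 < w by apply: omega_gt0.
  have v1 : vertex x 1 = w by have := vertexS x 0; rewrite vertex0 add0r add0r.
  have vw : v x w = v (shift 1 x) 0.
    have [T hT] := located_exists w hx.
    have := located_shift 1 hT; rewrite v1 subrr => hT'.
    by rewrite (hv _ hx _ _ hT) (hv _ (biallowed_shift 1 hx) _ _ hT').
  (* Subtracting the jump at the right end makes the function locally constant on the closed
     tile. *)
  pose H (s : R) := if s < w then v x s else v x s - f (shift 1 x).
  suff : H w = H 0 by rewrite /H ltxx w0 vw; lia.
  apply: locally_constant_segment => // s /andP[s0 sw].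
  have [T hT] := located_exists s hx.
  have [N [eta eta0 he]] := located_nbhs hT (hG T I).
  case: (ltP s w) => hs.
    have [ew ep] := located_word hT ltac:(by rewrite s0 hs).
    exists (Num.min eta (Num.min (w - s) (w / 2))).
      by rewrite !lt_min eta0 subr_gt0 hs divr_gt0.
    move=> s' /andP[s0' sw']; rewrite !lt_min => /and3P[l1 l2 l3].
    move: l2 l3; rewrite !ltr_norml => /andP[l2 l2'] /andP[l3 l3'].
    have hs' : s' < w by lra.
    have [T' hT'] := located_exists s' hx.
    have [ew' ep'] := located_word hT' ltac:(by rewrite s0' hs').
    rewrite /H hs hs' (hv _ hx _ _ hT) (hv _ hx _ _ hT') (he _ _ _ hT') //.
    rewrite /jump ep ep' ew'; case: eqP => [z|_]; last by rewrite addr0.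
    by rewrite ifF ?addr0 //; apply/negbTE; rewrite -ltNge mulr2n -/w; lra.
  have {}hs : s = w by lra.
  subst s; exists (Num.min eta (w / 2)); first by rewrite lt_min eta0 divr_gt0.
  move=> s' /andP[s0' sw']; rewrite !lt_min => /andP[l1 l3].
  case: (ltP s' w) => hs'; last by congr H; lra.
  have [T' hT'] := located_exists s' hx.
  have [ew' ep'] := located_word hT' ltac:(by rewrite s0' hs').
  have := located_shift 1 hT; rewrite v1 subrr => /located_word[|ew ep].
    by rewrite lexx omega_gt0.
  rewrite /H hs' ltxx (hv _ hx _ _ hT) (hv _ hx _ _ hT') (he _ _ _ hT') //.
  rewrite /jump ep ep' ew' ew eqxx ifT //= -/w mulr2n.
  by move: l3; rewrite ltr_norml => /andP[_ l3]; lra.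
exists (fun x => v x 0) => [|x hx]; last first.
  have := step _ (biallowed_shift (-1) hx).
  by rewrite shiftD subrr shift0.
apply: locconst_compact => x hx; have [T hT] := located_exists 0 hx.
have [N [eta eta0 he]] := located_nbhs hT (hG T I).
exists N => x' hx' ag; have [T' hT'] := located_exists 0 hx'.
rewrite (hv _ hx _ _ hT) (hv _ hx' _ _ hT') (he _ _ _ hT') ?subrr ?normr0 //.
have [_ ep] := located_word hT' ltac:(by rewrite lexx omega_gt0).
rewrite /jump ep mul0rn ifF ?addr0 //; apply/negbTE; rewrite negb_and -ltNge.
by rewrite omega_gt0 orbT.
Qed.

(** The tilings with a vertex near the origin form members of the cover
    according to the value of [f] at this vertex; there the section is this
    value if the origin is to the right of the vertex, and [0] otherwise. *)
Lemma locconst_represents f : locconst phi f -> exists xi, represents (jump f) xi.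
Proof.
move=> [r hr]; have [m m0 [hm _]] := vertex_growth.
(* The interior of a tile is covered by two members rather than one: a member around a vertex meets
   each of them on one side of the vertex only, so the difference of the sections is constant on
   every overlap. *)
pose A (i : bool + int) : set (tiling_space phi omega) :=
  match i with
  | inl true => [set T | 0 < phase T /\ phase T *+ 3 < wd (word T 0) *+ 2]
  | inl false => [set T | wd (word T 0) < phase T *+ 3]
  | inr n => [set T | (phase T *+ 3 < wd (word T 0) /\ f (word T) = n) \/
      (wd (word T 0) *+ 2 < phase T *+ 3 /\ f (shift 1 (word T)) = n)]
  end.
pose g (i : bool + int) T : int :=
  match i with
  | inl _ => 0
  | inr n => if phase T *+ 2 < wd (word T 0) then n else 0
  end.
pose steady eta T T' := [/\ `|phase T' - phase T| < eta, jump f T T' = 0,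
  wd (word T' 0) = wd (word T 0), f (word T') = f (word T) &
  f (shift 1 (word T')) = f (shift 1 (word T))].
have near_pos T (eta : R) : 0 < phase T -> 0 < eta -> \forall T' \near T, steady eta T T'.
  move=> t0 eta0; near=> T'.
  have [[ag h1 h2]|[t00]] : near_jump f r.+1 eta T T' by near: T'; exact: near_jumpP.
    have hb := word_biallowed T; have hb' := word_biallowed T'.
    split=> //.
    - by rewrite (ag 0).
    - by apply/esym/hr => //; exact: agree_le ag.
    - apply/esym/hr; [exact: biallowed_shift|exact: biallowed_shift|].
      by apply: agree_shift; rewrite addn1.
  by rewrite t00 ltxx in t0.
have wpos T : 0 < wd (word T 0) := omega_gt0 _.
apply: (@represents_exists _ (jump f) _ A g).
- move=> i; rewrite openE => T; rewrite /interior; case: i => [[]|n] /=.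
  + move=> -[t0 h]; near=> T'.
    have [e _ ew _ _] : steady (Num.min (phase T) ((wd (word T 0) *+ 2 - phase T *+ 3) / 3)) T T'.
      near: T'; apply: near_pos => //; rewrite lt_min t0 divr_gt0 //.
      by lra.
    move: e; rewrite lt_min ltr_norml => /andP[/andP[e1 _]].
    rewrite ltr_norml => /andP[_ e2].
    rewrite /= ew; split; lra.
  + move=> h; have := wpos T => w0; near=> T'.
    have [e _ ew _ _] : steady ((phase T *+ 3 - wd (word T 0)) / 3) T T'.
      near: T'; apply: near_pos; first lra.
      by rewrite divr_gt0 //; lra.
    move: e; rewrite ltr_norml => /andP[e1 _].
    rewrite /= ew; lra.
  + have := wpos T => w0; move=> -[[h fn]|[h fn]].
      near=> T'; have hb := word_biallowed T; have hb' := word_biallowed T'.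
      have := wpos T' => w0'; have := hm (word T' 0) => hmw.
      have [[ag e _]|[t0 ag e _]] : near_jump f r.+1
          (Num.min ((wd (word T 0) - phase T *+ 3) / 3) (m / 3)) T T'.
        near: T'; apply: near_jumpP; rewrite lt_min !divr_gt0 //.
        by lra.
        left; split; last first.
          by rewrite -fn; apply/esym/hr => //; exact: agree_le ag.
        move: e; rewrite lt_min ltr_norml => /andP[/andP[_ e1] _].
        rewrite -(ag 0) //; move: e1; lra.
      right; split; last first.
        by rewrite -fn; apply/esym/hr => //; [exact: biallowed_shift|exact: agree_le ag].
      have : Num.min ((wd (word T 0) - phase T *+ 3) / 3) (m / 3) <= m / 3 by rewrite ge_min lexx orbT.
      by move: (Num.min _ _) e => q e q1; lra.
    near=> T'.
    have [e _ ew _ ef] : steady ((phase T *+ 3 - wd (word T 0) *+ 2) / 3) T T'.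
      near: T'; apply: near_pos; first lra.
      by rewrite divr_gt0 //; lra.
    right; rewrite ew ef; split=> //; move: e.
    by rewrite ltr_norml => /andP[e1 _]; lra.
- move=> T; have /andP[t0 tw] := phase_bounds T.
  case: (ltP (wd (word T 0)) (phase T *+ 3)) => h1; first by exists (inl false).
  case: (ltP 0 (phase T)) => h2.
    exists (inl true); split=> //; move: h1; lra.
  exists (inr (f (word T))); left; split=> //.
  by have := wpos T; lra.
- move=> [b|n] T; have := wpos T => w0.
    move=> AT; have t0 : 0 < phase T.
      by case: b AT => /=; [case|lra].
    near=> T'.
    have [_ -> _ _ _] : steady 1 T T'.
      by near: T'; exact: near_pos.
    by rewrite addr0.
  have /andP[t0 _] := phase_bounds T.
  case: (ltP 0 (phase T)) => tp.
    move=> AT; near=> T'.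
    have [e -> ew _ _] : steady (wd (word T 0) / 6%:R) T T'.
      by near: T'; apply: near_pos => //; rewrite divr_gt0.
    move: e; rewrite ltr_norml => /andP[e1 e2].
    rewrite addr0 /g ew; move: AT; rewrite /A /=.
    move=> [[h _]|[h _]]; first by rewrite !ifT //; lra.
    by rewrite !ifF //; apply/negbTE; rewrite -leNgt; lra.
  have {tp}t00 : phase T = 0 by lra.
  move=> [[_ fn]|[h _]]; last by exfalso; rewrite t00 in h; lra.
  near=> T'; rewrite /g /jump t00 mul0rn w0 eqxx fn /= leNgt.
  by case: ifP => _ /=; lia.
- have val n T : A (inr n) T -> phase T *+ 3 < wd (word T 0) *+ 2 -> g (inr n) T = n.
    have := wpos T; rewrite /A /g /= => w0 [[h _]|[h _]] h'.
      by rewrite ifT //; lra.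
    by have : False by lra.
  have val' n T : A (inr n) T -> wd (word T 0) < phase T *+ 3 -> g (inr n) T = 0.
    have := wpos T; rewrite /A /g /= => w0 [[h _]|[h _]] h'.
      by have : False by lra.
    by rewrite ifF //; apply/negbTE; rewrite -leNgt; lra.
  move=> [b|n] [b'|n'].
  + by exists 0.
  + case: b; [exists n'|exists 0] => T; [move=> [_ h]|move=> h] => AT.
      by rewrite (val n' T AT h) subr0.
    by rewrite (val' n' T AT h) subr0.
  + case: b'; [exists (- n)|exists 0] => T AT; [move=> [_ h]|move=> h].
      by rewrite (val n T AT h) sub0r.
    by rewrite (val' n T AT h) subr0.
  + exists 0 => T; have := wpos T; rewrite /A /g /=.
    move=> w0 [[h e]|[h e]] [[h' e']|[h' e']]; rewrite -?e -?e' ?subrr //;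
      by have : False by lra.
Unshelve. all: by end_near. Qed.

(** The limit is the supremum of the reals that bound [s_] from below on a set of the
    ultrafilter. *)
Lemma ultra_real (U : set_system nat) (s_ : nat -> R) (W : R) : UltraFilter U ->
  (forall n, 0 <= s_ n <= W) ->
  exists s, forall eta : R, 0 < eta -> U [set n | `|s_ n - s| < eta].
Proof.
move=> UU hs; pose E := [set c : R | U [set n | c <= s_ n]].
have E0 : E 0 by apply: filterS filterT => n _ /=; case/andP: (hs n).
have Eb : ubound E W.
  by move=> c /filter_ex[n /= h]; apply: le_trans h _; case/andP: (hs n).
have hsE : has_sup E by split; [exists 0|exists W].
exists (sup E) => eta eta0.
have [c Ec hc] := sup_adherent eta0 hsE.
have nE : ~ E (sup E + eta).
  by move=> /(sup_upper_bound hsE); rewrite gerDl leNgt eta0.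
have [//|Un] := @in_ultra_setVsetC _ U [set n | sup E + eta <= s_ n] UU.
apply: filterS (filterI Ec Un) => n [/= h1 /negP]; rewrite -ltNge => h2.
by rewrite ltr_norml; apply/andP; split; lra.
Qed.

(** A Lebesgue lemma: if the first tile of [x] is divided into [n + 1] pieces of
    equal length, the tilings that have the origin in the [j]-th piece and agree
    with [x] up to distance [n] lie in one member of the cover. *)
Lemma lebesgue_boxes (U : open_cover (tiling_space phi omega)) :
  exists n (a : (int -> 'I_d) -> nat -> set (tiling_space phi omega)),
  [/\ forall x j, biallowed phi x -> (j <= n)%N -> members U (a x j),
      forall x x' j, agree n x x' -> a x j = a x' j &
      forall x j s T, biallowed phi x -> (j <= n)%N ->
        j%:R * wd (x 0) <= n.+1%:R * s <= j.+1%:R * wd (x 0) -> located x s T -> a x j T].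
Proof.
(* The member is chosen for the finite window [w], not for the word, which makes the choice locally
   constant. *)
pose good n (w : seq 'I_d) j A := forall x, biallowed phi x ->
  Defs.factor x (- n%:Z) (n + n) = w -> (j <= n)%N -> members U A /\
  forall s T, j%:R * wd (x 0) <= n.+1%:R * s <= j.+1%:R * wd (x 0) -> located x s T -> A T.
have [[n hn]|none] := pselect (exists n, forall w j, exists A, good n w j A).
  have /choice[a ha] : forall wj : seq 'I_d * nat, exists A, good n wj.1 wj.2 A.
    by move=> [w j]; apply: hn.
  exists n, (fun x j => a (Defs.factor x (- n%:Z) (n + n), j)); split.
  - by move=> x j hx jn; have [] := ha (_, j) x hx erefl jn.
  - by move=> x x' j /agree_factor ->.
  - by move=> x j s T hx jn hs hT; have [_ h] := ha (_, j) x hx erefl jn; exact: h hs hT.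
exfalso.
have /choice[wj hwj] : forall n, exists wj : seq 'I_d * nat, forall A, ~ good n wj.1 wj.2 A.
  move=> n; apply: contrapT => nw; apply: none; exists n => w j.
  apply: contrapT => nA; apply: nw; exists (w, j) => A h; apply: nA; by exists A.
have bad n A : exists x, [/\ biallowed phi x, Defs.factor x (- n%:Z) (n + n) = (wj n).1,
   ((wj n).2 <= n)%N & members U A -> exists s T, [/\ (wj n).2%:R * wd (x 0) <= n.+1%:R * s <= (wj n).2.+1%:R * wd (x 0),
     located x s T & ~ A T]].
  apply: contrapT => nx; apply: (hwj n A) => x hx hw hj.
  have UA : members U A.
    apply: contrapT => nU; apply: nx; exists x; split=> // UA; by exfalso; exact: nU.
  split=> // s T hs hT; apply: contrapT => nA; apply: nx; exists x; split=> // _.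
  by exists s, T.
have [Ul [UU Uoo]] := free_ultrafilter.
have /choice[x_ hx_] := fun n => bad n set0.
have [h1 h2 h3 _] := all_and4 hx_.
have [x hx] := ultralimit_exists UU x_.
pose W := \sum_a wd a.
have hW b : wd b <= W.
  rewrite /W (bigD1 b) //= lerDl; apply: sumr_ge0 => c _; exact/ltW/omega_gt0.
(* The left end of the bad piece. A member containing the limit tiling contains the whole piece once
   it is short enough, a contradiction. *)
pose s_ n := (wj n).2%:R * wd (x_ n 0) / n.+1%:R.
have [s hs] : exists s, forall eta : R, 0 < eta -> Ul [set n | `|s_ n - s| < eta].
  apply: (@ultra_real _ _ W) => n; apply/andP; split.
    by rewrite divr_ge0 // mulr_ge0 // ltW // omega_gt0.
  rewrite ler_pdivrMr // mulrC; apply: ler_pM => //; first by rewrite ltW // omega_gt0.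
  by rewrite ler_nat; apply: leq_trans (h3 n) _.
have [T hT] := located_exists s (biallowed_ultralimit UU hx h1).
have [A UA AT] := cover_member U T.
have [N [eta eta0 he]] := located_nbhs hT (member_nbhs UA AT).
have [K hK] : exists K : nat, W < K%:R * (eta / 2).
  exists (Num.bound `|W / (eta / 2)|); rewrite -ltr_pdivrMr ?divr_gt0 //.
  by apply: le_lt_trans (ler_norm _) _; apply: archi_boundP; rewrite normr_ge0.
have e20 : 0 < eta / 2 by rewrite divr_gt0.
have [n [[/= ag hsn] big]] := filter_ex (filterI (filterI (hx N) (hs _ e20)) (Uoo (K + N).+1)).
have [x' [hx' hf hj]] := bad n A.
move=> /(_ UA)[s' [T' [box hT' nA]]]; apply: nA.
have ag' : agree n (x_ n) x' by apply/agree_factor; rewrite h2 hf.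
apply: (he _ _ _ hT').
  by apply: agree_trans (agree_sym ag) _; apply: agree_le ag'; clear -big; lia.
have e0 : x' 0 = x_ n 0 by apply/esym/ag'; clear -big; lia.
rewrite e0 in box; have n0 : 0 < n.+1%:R :> R by [].
have sE : n.+1%:R * s_ n = (wj n).2%:R * wd (x_ n 0) by rewrite /s_ mulrC divfK // gt_eqF.
have jS : (wj n).2.+1%:R * wd (x_ n 0) = n.+1%:R * s_ n + wd (x_ n 0).
  by rewrite sE -addn1 natrD mulrDl mul1r.
rewrite -sE jS in box; move/andP: box => [b1 b2].
have c1 : s_ n <= s' by rewrite -(ler_pM2l n0).
have c2 : s' - s_ n < eta / 2.
  rewrite -(ltr_pM2l n0) mulrBr; apply: le_lt_trans (_ : wd (x_ n 0) < _); first lra.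
  apply: le_lt_trans (hW _) _; apply: lt_le_trans hK _.
  by apply: ler_wpM2r; [exact: ltW|rewrite ler_nat; clear -big; lia].
move: hsn; rewrite ltr_norml => /andP[d1 d2].
by rewrite ltr_norml; apply/andP; split; lra.
Qed.

Lemma cocycle_eq (X : topologicalType) (U : open_cover X) (c : Z1 U) A B C p :
  members U A -> members U B -> members U C -> A p -> B p -> C p ->
  val c A C = val c A B + val c B C.
Proof.
move=> UA UB UC Ap Bp Cp; have /asboolP h := valP c.
have /h : (A `&` B `&` C) !=set0 by exists p.
by move=> /(_ UA UB UC); lia.
Qed.

Lemma box_index n (w t : R) : 0 <= t < w ->
  exists j, (j <= n)%N /\ j%:R * w <= n.+1%:R * t < j.+1%:R * w.
Proof.
move=> /andP[t0 tw]; have w0 : 0 < w by lra.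
have h : n.+1%:R * t < n.+1%:R * w by rewrite ltr_pM2l.
have H k : (k <= n.+1)%N -> n.+1%:R * t < k%:R * w -> exists j, (j < k)%N /\ j%:R * w <= n.+1%:R * t < j.+1%:R * w.
  elim: k => [|k IH] hk hlt.
    by exfalso; move: hlt; rewrite mul0r ltNge mulr_ge0.
  case: (ltP (n.+1%:R * t) (k%:R * w)) => hk'.
    by have [j [jk hj]] := IH (ltnW hk) hk'; exists j; split=> //; exact: ltnW.
  by exists k; rewrite hk' hlt; split.
exact: H h.
Qed.

(** [H] sums the cocycle from box to box along a tile, which gives a primitive of [c]. The function
    [f] is minus the total over the tile to the left of the vertex, including the passage to the
    first box of the next tile. *)
Lemma represents_surjective xi : exists2 f, locconst phi f & represents (jump f) xi.
Proof.
have [U [c ->]] := cech_classP xi.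
have [n [a [ha1 ha2 ha3]]] := lebesgue_boxes U.
have [m m0 [hm _]] := vertex_growth.
pose H x j : int := \sum_(i < j) val c (a x i) (a x i.+1).
have HS x j : H x j.+1 = H x j + val c (a x j) (a x j.+1) by rewrite /H big_ord_recr.
have /choice[idx hidx] := fun T => box_index n (phase_bounds T).
have inbox T : a (word T) (idx T) T.
  have [h1 /andP[h2 h3]] := hidx T.
  apply: (ha3 _ _ _ _ (word_biallowed T) h1 _ (located_self T)).
  by rewrite h2 ltW.
pose g A T := H (word T) (idx T) + val c (a (word T) (idx T)) A.
pose f x := - H (shift (-1) x) n - val c (a (shift (-1) x) n) (a x 0%N).
exists f.
  exists n.+1 => x x' _ _ ag; rewrite /f.
  have ag' : agree n (shift (-1) x) (shift (-1) x') by apply: agree_shift; rewrite addn1.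
  have e j := ha2 _ _ j ag'.
  rewrite (ha2 x x' 0%N (agree_le (leqnSn n) ag)) e; congr (- _ - _).
  by apply: eq_bigr => i _; rewrite !e.
have memb T : members U (a (word T) (idx T)).
  by apply: ha1; [exact: word_biallowed|case: (hidx T)].
exists U, c, g; split=> // [A UA T AT|A B T UA UB AT BT]; last first.
  by rewrite /g (cocycle_eq c (memb T) UA UB (inbox T) AT BT); lia.
have [h1 /andP[h2 h3]] := hidx T; set j := idx T in h1 h2 h3.
have n0 : 0 < n.+1%:R :> R by [].
(* The three bounds keep the origin left of the end of box [j], let it fall back by at most one box,
   and put it in the last box [n] when a vertex has crossed. *)
pose e := Num.min (Num.min ((j.+1%:R * wd (word T 0) - n.+1%:R * phase T) / n.+1%:R)
  (wd (word T 0) / n.+1%:R)) (m / n.+1%:R).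
have w0 : 0 < wd (word T 0) by apply: omega_gt0.
have e0 : 0 < e by rewrite !lt_min !divr_gt0 // subr_gt0.
have /and3P[l1 l2 l3] : [&& n.+1%:R * e <= j.+1%:R * wd (word T 0) - n.+1%:R * phase T,
   n.+1%:R * e <= wd (word T 0) & n.+1%:R * e <= m].
  have dv u : e <= u / n.+1%:R -> n.+1%:R * e <= u by rewrite ler_pdivlMr // mulrC.
  by apply/and3P; split; apply: dv; rewrite !ge_min lexx ?orbT.
near=> T'.
have AT' : A T' by near: T'; exact: (member_nbhs UA AT).
have aT' : a (word T) j T' by near: T'; apply: (member_nbhs (memb T)); exact: inbox.
have [k1 /andP[k2 k3]] := hidx T'.
have [[ag ht ->]|[t0 ag ht ->]] : near_jump f n.+1 e T T' by near: T'; exact: near_jumpP.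
  have ea i := ha2 _ _ i (agree_le (leqnSn n) ag).
  have eH i : H (word T') i = H (word T) i by apply: eq_bigr => q _; rewrite !ea.
  have ew : word T' 0 = word T 0 by rewrite (ag 0).
  rewrite ew in k2 k3.
  have hk : (idx T' <= j)%N /\ (j <= (idx T').+1)%N.
    move: ht; rewrite -(ltr_pM2l n0) -[X in X * _]normr_nat -normrM mulrBr ltr_norml => /andP[q1 q2].
    split; rewrite -ltnS -(ltr_nat R) -(ltr_pM2r w0); first by lra.
    rewrite -[(idx T').+2]addn1 natrD mulrDl mul1r.
    lra.
  rewrite addr0 /g eH -ea -/j.
  have [<-//|ek] : idx T' = j \/ (idx T').+1 = j by clear -hk; lia.
  have m1 : members U (a (word T) (idx T')) by rewrite ea; exact: memb.
  have i1 : a (word T) (idx T') T' by rewrite ea; exact: inbox.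
  have -> : H (word T) j = H (word T) (idx T') + val c (a (word T) (idx T')) (a (word T) j).
    by rewrite -ek HS.
  by rewrite (cocycle_eq c m1 (memb T) UA i1 aT' AT') addrA.
have j0 : j = 0%N.
  apply/eqP; rewrite -leqn0 leqNgt; apply/negP => j1.
  by move: h2; rewrite t0 mulr0 leNgt mulr_gt0 // ltr0n.
have agm : agree n (word T') (shift (-1) (word T)).
  have -> : word T' = shift (-1) (shift 1 (word T')) by rewrite shiftD addNr shift0.
  by apply/agree_sym/agree_shift; rewrite addn1.
have ea i := ha2 _ _ i agm.
have eH i : H (word T') i = H (shift (-1) (word T)) i by apply: eq_bigr => q _; rewrite !ea.
have w0' : 0 < wd (word T' 0) by apply: omega_gt0.
have hk : idx T' = n.
  apply/eqP; rewrite eqn_leq k1 /= -ltnS -(ltr_nat R) -(ltr_pM2r w0').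
  apply: lt_trans k3; have q : n.+1%:R * (wd (word T' 0) - e) < n.+1%:R * phase T'.
    by rewrite ltr_pM2l.
  rewrite mulrBr in q; have := hm (word T' 0).
  have : n.+1%:R * wd (word T' 0) = n%:R * wd (word T' 0) + wd (word T' 0).
    by rewrite -natr1 mulrDl mul1r.
  lra.
rewrite /g hk eH ea -/j j0 /f [H _ 0%N]big_ord0 add0r.
have m1 : members U (a (shift (-1) (word T)) n).
  by apply: ha1 => //; exact/biallowed_shift/word_biallowed.
have m2 : members U (a (word T) 0%N) by rewrite -j0; exact: memb.
have i1 : a (shift (-1) (word T)) n T' by rewrite -ea -hk; exact: inbox.
have i2 : a (word T) 0%N T' by rewrite -j0.
by rewrite (cocycle_eq c m1 m2 UA i1 i2 AT'); ring.
Unshelve. all: by end_near. Qed.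

End TilingTopology.

(** * The exact sequence *)

(** Lifting a basis of [E] gives the section [sigma]; what remains after subtracting it comes from
    [L]. *)
Lemma split_extension (L H E : zmodType) (G : zmodClosed L) (l : nat)
    (alpha : {additive L -> H}) (beta : {additive H -> E}) :
  (forall u, (u \in G) = (alpha u == 0)) ->
  (forall eta, exists xi, beta xi = eta) ->
  (forall xi, beta xi = 0 <-> exists u, alpha u = xi) ->
  zmod_iso E 'rV[int]_l -> zmod_iso H ('rV[int]_l * quotient G)%type.
Proof.
move=> GE surj exact [theta [theta' thetaK theta'K]].
have /choice[s hs] (i : 'I_l) : exists xi, theta (beta xi) = delta_mx 0 i.
  have [xi e] := surj (theta' (delta_mx 0 i)).
  by exists xi; rewrite e theta'K.
pose sigma (rho : 'rV[int]_l) : H := \sum_i s i *~ rho 0 i.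
have sigmaB rho rho' : sigma (rho - rho') = sigma rho - sigma rho'.
  by rewrite -sumrB; apply: eq_bigr => i _; rewrite !mxE mulrzBr.
have sigmaK rho : theta (beta (sigma rho)) = rho.
  rewrite !raddf_sum [RHS]row_sum_delta; apply: eq_bigr => i _.
  by rewrite !raddfMz hs -scaler_int intz.
apply: (@zmod_iso_of_relation _ _ (fun xi (y : 'rV[int]_l * quotient G) =>
  exists u, [/\ y.1 = theta (beta xi), y.2 = \pi_(quotient G)%qT u &
                alpha u = xi - sigma y.1])).
- move=> xi y xi' y' [u [e1 e2 e3]] [u' [e1' e2' e3']]; exists (u - u'); split.
  + by rewrite !raddfB /= e1 e1'.
  + by rewrite [RHS]raddfB [LHS]raddfB /= e2 e2'.
  + by rewrite [LHS]raddfB e3 e3' sigmaB !opprD !opprK addrACA.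
- move=> xi; have /exact[u hu] : beta (xi - sigma (theta (beta xi))) = 0.
    by apply: (can_inj thetaK); rewrite !raddfB sigmaK subrr raddf0.
  by exists (theta (beta xi), \pi_(quotient G)%qT u), u.
- move=> [rho kappa] [u /= [e1 e2 e3]]; move: e1; rewrite !raddf0 => e1.
  have s0 : sigma 0 = 0 by have := sigmaB 0 0; rewrite !subrr.
  congr (_, _) => //; rewrite e2; apply/quotient_eq0.
  by rewrite GE e3 e1 s0 subrr.
- move=> [rho kappa]; exists (alpha (repr kappa) + sigma rho), (repr kappa) => /=.
  split; last by rewrite addrK.
    rewrite !raddfD sigmaK; have /exact -> : exists u, alpha u = alpha (repr kappa) by eexists.
    by rewrite raddf0 add0r.
  by rewrite reprK.
- move=> xi [u /= [_ /esym/quotient_eq0 e2 e3]].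
  have s0 : sigma 0 = 0 by have := sigmaB 0 0; rewrite !subrr.
  by move: e2; rewrite GE e3 s0 subr0 => /eqP.
Qed.

Definition spans (V : zmodType) n (g : 'I_n -> V) : Prop :=
  forall v, exists c : 'I_n -> int, v = \sum_i g i *~ c i.

(** * Finitely generated torsion-free groups are free *)

Section FreeModules.
Variable V : zmodType.
Hypothesis torsion_free : forall (v : V) (m : int), m != 0 -> v *~ m = 0 -> v = 0.

Lemma sum_elementary n (g : 'I_n -> V) (c : 'I_n -> int) i j s : i != j ->
  \sum_k g k *~ c k = \sum_k (if k == j then g j + g i *~ s else g k) *~
                            (if k == i then c i - s * c j else c k).
Proof.
move=> ij; have ji : j != i by rewrite eq_sym.
rewrite (bigD1 i) // (bigD1 j) //= [RHS](bigD1 i) // [X in _ = _ + X](bigD1 j) //=.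
rewrite !eqxx (negbTE ij) (negbTE ji) !addrA; congr (_ + _).
  by rewrite mulrzBr mulrzDl -mulrzA [X in _ = _ + X]addrC addrA subrK.
by apply: eq_bigr => k /andP[/negbTE -> /negbTE ->].
Qed.

(** The Euclidean algorithm on the coefficients of a nontrivial relation ends
    with a relation of one term, hence with a generator that is zero. *)
Lemma spans_reduce n (g : 'I_n.+1 -> V) (c : 'I_n.+1 -> int) j :
  spans g -> \sum_i g i *~ c i = 0 -> c j != 0 -> exists g' : 'I_n -> V, spans g'.
Proof.
have [N] := ubnP (\sum_i absz (c i))%N.
elim: N g c j => // N IH g c j; rewrite ltnS => le sp rel cj.
have [[i /andP[ij ci]]|no] := pselect (exists i, (i != j) && (c i != 0)); last first.
  have ci i : i != j -> c i = 0.
    by move=> ij; apply/eqP/negP => /negP ci; apply: no; exists i; rewrite ij.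
  exists (g \o lift j) => v; have [a ->] := sp v; exists (a \o lift j).
  have gj : g j = 0.
    apply: torsion_free cj _; move: rel; rewrite (bigD1 j) //= big1 ?addr0 //.
    by move=> i /ci ->; rewrite mulr0z.
  by rewrite (bigD1_ord j) //= gj mul0rz add0r.
wlog cc : i j ij ci cj / (absz (c j) <= absz (c i))%N.
  move=> W; have [|/ltnW] := leqP (absz (c j)) (absz (c i)); first exact: W.
  by apply: W => //; rewrite eq_sym.
(* With this sign the larger coefficient decreases in absolute value by the smaller one. *)
pose s := Num.sg (c i) * Num.sg (c j).
apply: (IH (fun k => if k == j then g j + g i *~ s else g k)
  (fun k => if k == i then c i - s * c j else c k) j).
- apply: leq_trans le.
  rewrite [X in (X < _)%N](bigD1 i) // [X in (_ < X)%N](bigD1 i) //= eqxx.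
  rewrite [X in (_ + X < _)%N](eq_bigr (fun k => absz (c k))) => [|k /negbTE -> //].
  rewrite ltn_add2r /s; clear -ci cj cc.
  by case: (ltrgtP (c i) 0) ci => // hi _; case: (ltrgtP (c j) 0) cj => // hj _;
    rewrite ?(gtr0_sg hi) ?(ltr0_sg hi) ?(gtr0_sg hj) ?(ltr0_sg hj); lia.
- move=> v; have [a ->] := sp v; exists (fun k => if k == i then a i - s * a j else a k).
  exact: sum_elementary.
- by rewrite -sum_elementary.
- by rewrite (eq_sym j) (negbTE ij).
Qed.

Lemma basis_exists n (g : 'I_n -> V) : spans g ->
  exists m (b : 'I_m -> V), spans b /\ independent b.
Proof.
elim: n g => [|n IH] g sp.
  by exists 0, g; split => // c _ [].
have [ind|] := pselect (independent g); first by exists n.+1, g.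
move=> /existsNP[c /not_implyP[rel /existsNP[j /eqP cj]]].
by have [g' /IH] := spans_reduce sp rel cj.
Qed.

End FreeModules.

(** A nonzero rational vector of the kernel, multiplied by the product of its denominators. *)
Lemma row_relation_exists m n (M : 'M[int]_(m, n)) : (n < m)%N ->
  exists2 u : 'rV[int]_m, u != 0 & u *m M = 0.
Proof.
move=> nm; pose MQ : 'M[rat]_(m, n) := map_mx intr M.
have : kermx MQ != 0.
  by rewrite -mxrank_eq0 mxrank_ker subn_eq0 -ltnNge; apply: leq_ltn_trans nm; exact: rank_leq_col.
move=> /rowV0Pn[w /sub_kermxP wM w0].
pose D := \prod_i denq (w 0 i).
have D0 : D != 0 by apply/prodf_neq0 => i _; rewrite denq_neq0.
have hw i : exists z : int, z%:~R = D%:~R * w 0 i :> rat.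
  exists (numq (w 0 i) * \prod_(k | k != i) denq (w 0 k)).
  have -> : D = denq (w 0 i) * \prod_(k | k != i) denq (w 0 k) by rewrite /D (bigD1 i).
  have := denq_neq0 (w 0 i); have := divq_num_den (w 0 i).
  move: (numq _) (denq _) => a b <- b0; rewrite !rmorphM /=.
  have : b%:~R != 0 :> rat by rewrite intr_eq0.
  by move=> h; field.
have /choice[u hu] := hw.
have uE : map_mx intr (\row_i u i) = D%:~R *: w.
  by apply/rowP => i; rewrite !mxE hu.
exists (\row_i u i).
  apply: contraNneq w0 => u0; move: uE; rewrite u0 map_mx0 => /esym/eqP.
  by rewrite scaler_eq0 intr_eq0 (negbTE D0).
have : map_mx intr (\row_i u i *m M) = 0 :> 'rV[rat]_n.
  by rewrite map_mxM uE -scalemxAl wM scaler0.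
move: (_ *m M) => z /rowP h; apply/rowP => j; move: (h j); rewrite !mxE.
by move/eqP; rewrite intr_eq0 => /eqP.
Qed.

Lemma free_of_rank (V : zmodType) n (g : 'I_n -> V) l : spans g ->
  (forall (v : V) (m : int), m != 0 -> v *~ m = 0 -> v = 0) ->
  has_rank V l -> zmod_iso V 'rV[int]_l.
Proof.
move=> sp tf [[x indx] max].
have [m [b [spb indb]]] := basis_exists tf sp.
have ml : m = l.
  case: (ltngtP l m) => [lt|lt|-> //].
    case: max; exists (b \o widen_ord lt) => c rel i.
    pose c' (k : 'I_m) := if insub (val k) is Some k' then c k' else 0.
    have c'E (k : 'I_l.+1) : c' (widen_ord lt k) = c k by rewrite /c' /= valK.
    rewrite -c'E; apply: indb; rewrite -[RHS]rel.
    rewrite (bigID (fun k : 'I_m => (k < l.+1)%N)) /= [X in _ + X]big1 => [|k /negbTE lk].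
      rewrite addr0 (big_ord_narrow lt) /=.
      by apply: eq_bigr => k _; rewrite c'E.
    by rewrite /c' insubF ?mulr0z.
  exfalso; pose M : 'M[int]_(l, m) := \matrix_(i, j) projT1 (cid (spb (x i))) j.
  have [u u0 uM] := row_relation_exists M lt.
  move/eqP: u0; apply; apply/rowP => i; rewrite mxE; apply: indx (fun i => u 0 i) _ i.
  have xE i : x i = \sum_j b j *~ M i j.
    by rewrite {1}(projT2 (cid (spb (x i)))); apply: eq_bigr => j _; rewrite mxE.
  under eq_bigr => i _ do rewrite xE mulrz_suml.
  rewrite exchange_big big1 //= => j _.
  under eq_bigr => i _ do rewrite -mulrzA.
  rewrite -mulrz_sumr; have -> : \sum_i M i j * u 0 i = (u *m M) 0 j.
    by rewrite mxE; apply: eq_bigr => i _; rewrite mulrC.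
  by rewrite uM mxE mulr0z.
subst m.
apply: (@zmod_iso_of_relation _ _ (fun v (c : 'rV[int]_l) => v = \sum_i b i *~ c 0 i)).
- move=> v c v' c' -> ->; rewrite -sumrB; apply: eq_bigr => i _.
  by rewrite !mxE mulrzBr.
- move=> v; have [c ->] := spb v; exists (\row_i c i).
  by apply: eq_bigr => i _; rewrite mxE.
- by move=> c /esym/indb c0; apply/rowP => i; rewrite c0 mxE.
- by move=> c; eexists.
- by move=> v ->; rewrite big1 // => i _; rewrite mxE mulr0z.
Qed.

(** * Cohomology and components of the graph ER *)

Section EventualRangeGraph.
Variables (d : nat) (phi : substitution d).
Local Notation ER := (ER_edges phi).

Definition edge_cochain (c : 'I_d * 'I_d -> int) : {ffun ER_edge phi -> int} :=
  [ffun e => c (val e)].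

Definition graph_class (c : 'I_d * 'I_d -> int) : ER_H1 phi :=
  \pi_(ER_H1 phi)%qT (edge_cochain c).

Lemma ER_edge_val (e : ER_edge phi) : ER (val e).
Proof. exact/asboolP/(valP e). Qed.

Lemma graph_class_eq0 c : graph_class c = 0 <-> potential phi c.
Proof.
rewrite quotient_eq0; split=> [/asboolP[F hF]|[F hF]].
  exists F => e /asboolP he; have := hF (exist _ e he).
  by rewrite ffunE.
by apply/asboolP; exists F => e; rewrite ffunE hF //; exact: ER_edge_val.
Qed.

Lemma graph_classB c c' : graph_class c - graph_class c' = graph_class (fun e => c e - c' e).
Proof.
rewrite /graph_class -raddfB; congr (\pi_(ER_H1 phi)%qT _).
by apply/ffunP => e; rewrite !ffunE.
Qed.

Lemma graph_classP eta : exists c, eta = graph_class c.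
Proof.
pose x : {ffun ER_edge phi -> int} := repr eta.
exists (fun e => if insub e is Some e' then x e' else 0).
rewrite -[LHS]reprK; congr (\pi_(ER_H1 phi)%qT _).
by apply/ffunP => e; rewrite ffunE valK.
Qed.

Lemma graph_class_spans :
  spans (fun i : 'I_#|ER_edge phi| => graph_class (fun e => (e == val (enum_val i))%:R)).
Proof.
move=> eta; have [c ->] := graph_classP eta.
exists (fun i => c (val (enum_val i))); rewrite /graph_class.
under eq_bigr => i _ do rewrite -raddfMz.
rewrite -raddf_sum; congr (\pi_(ER_H1 phi)%qT _).
apply/ffunP => e; rewrite sum_ffunE ffunE (bigD1 (enum_rank e)) //= big1 => [|i ie].
  by rewrite addr0 ffunMzE !ffunE enum_rankK eqxx intz.
rewrite ffunMzE !ffunE; have -> : (val e == val (enum_val i)) = false.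
  by apply: contraNF ie => /eqP/val_inj ->; rewrite enum_valK.
by rewrite mul0rz.
Qed.

(** If [m] times the cochain has a potential [F], the values of [F] at the ends of an edge are
    congruent modulo [m], so the rounded quotient of [F] by [m] is a potential of the cochain. *)
Lemma graph_class_torsion_free (eta : ER_H1 phi) (m : int) :
  m != 0 -> eta *~ m = 0 -> eta = 0.
Proof.
have [c ->] := graph_classP eta; move=> m0.
have -> : graph_class c *~ m = graph_class (fun e => c e * m).
  rewrite /graph_class -raddfMz; congr (\pi_(ER_H1 phi)%qT _).
  by apply/ffunP => e; rewrite ffunMzE !ffunE mulrzz.
rewrite !graph_class_eq0 => -[F hF]; exists (fun v => (F v %/ m)%Z) => e he.
have -> : F (inr e.2) = c e * m + F (inl e.1) by rewrite hF // subrK.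
by rewrite divzMDl // addrK.
Qed.

Lemma graph_H1_free l : has_rank (ER_H1 phi) l -> zmod_iso (ER_H1 phi) 'rV[int]_l.
Proof. exact: free_of_rank graph_class_spans graph_class_torsion_free. Qed.

Local Notation adj := (ER_adjacent phi).

Lemma ER_adjacent_sym : connect_sym adj.
Proof.
apply: sym_connect_sym => u v; apply: eq_existsb => e.
by rewrite orbC.
Qed.

Lemma ER_adjacent_edge e : ER e -> adj (inl e.1) (inr e.2).
Proof. by move=> /asboolP he; apply/existsP; exists (exist _ e he); rewrite !eqxx. Qed.

Lemma ER_vertex_closed : fingraph.closed adj (ER_vertex phi).
Proof.
apply: intro_closed => [|u v /existsP[e h] _]; first exact: ER_adjacent_sym.
by apply/existsP; exists e; case/orP: h => /andP[hu hv]; apply/orP; [right|left].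
Qed.

Lemma ER_vertex_edge e : ER e -> ER_vertex phi (inl e.1).
Proof. by move=> /asboolP he; apply/existsP; exists (exist _ e he); rewrite eqxx. Qed.

Lemma edge_constant_connect h u v : edge_constant phi h -> connect adj u v -> h u = h v.
Proof.
move=> hc /connectP[s hs ->]; elim: s u hs => //= w s IH u /andP[/existsP[e he] /IH <-].
have := hc _ (ER_edge_val e).
by case/orP: he => /andP[/eqP -> /eqP ->].
Qed.

Lemma component_representatives : exists rt : 'I_(ER_components phi) -> 'I_d + 'I_d,
  [/\ forall i, ER_vertex phi (rt i),
      forall v, ER_vertex phi v -> exists i, connect adj v (rt i) &
      forall rho : 'I_(ER_components phi) -> int, exists2 h,
        edge_constant phi h & forall i, h (rt i) = rho i].
Proof.
rewrite /ER_components /n_comp_mem.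
set Rt := predI _ _; pose rt (i : 'I_#|Rt|) : 'I_d + 'I_d := enum_val i; exists rt.
have rtP i : roots adj (rt i) && ER_vertex phi (rt i) .
  by have : rt i \in Rt by exact: (@enum_valP _ Rt i).
split=> [i|v hv|rho]; first by case/andP: (rtP i).
  have hr : fingraph.root adj v \in Rt.
    rewrite inE /= roots_root ?andTb; last exact: ER_adjacent_sym.
    by rewrite -(closed_connect ER_vertex_closed (connect_root _ v)).
  by exists (enum_rank_in hr (fingraph.root adj v)); rewrite /rt enum_rankK_in // connect_root.
exists (fun v => if [pick i | rt i == fingraph.root adj v] is Some i then rho i else 0).
  move=> e he; have -> // : fingraph.root adj (inl e.1) = fingraph.root adj (inr e.2).
  by apply/(fingraph.rootP (@ER_adjacent_sym))/connect1/ER_adjacent_edge.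
move=> i; case: pickP => [k|/(_ i)]; case/andP: (rtP i) => /eqP -> _; last by rewrite eqxx.
by move=> /eqP/enum_val_inj ->.
Qed.

End EventualRangeGraph.

(** * Maps between the groups and the kernel [G] *)

Section Assembly.
Variables (R : realType) (d : nat) (phi : substitution d) (omega : 'rV[R]_d).
Hypotheses (prim : primitive phi) (aper : aperiodic phi).
Hypothesis omega_gt0 : forall a, 0 < omega ord0 a.
Local Notation A := (transition_mx phi).
Local Notation L := (matrix_limit A^T).
Local Notation H := (cech_H1 (tiling_space phi omega)).
Local Notation induce := (induce phi).
Local Notation level_class n v := (@to_dirlim (mxsys A^T) n%N v : L).
Implicit Types (xi : H) (f : (int -> 'I_d) -> int).

Lemma jump_uniq f f' xi xi' : cohomologous phi f f' ->
  represents (jump f) xi -> represents (jump f') xi' -> xi = xi'.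
Proof.
move=> c hf hf'; apply/eqP; rewrite -subr_eq0; apply/eqP/represents0.
have := representsB (jumpB hf hf') (coboundary_represents omega_gt0 c).
by rewrite subr0; apply: represents_near => T; near=> T'; rewrite subrr.
Unshelve. all: by end_near. Qed.

Lemma level_classD n m v : level_class (n + m) (A^T ^+ m *m v) = level_class n v.
Proof.
rewrite -(@to_dirlim_map (mxsys A^T) n (n + m)%N (leq_addr m n)) /= /mxsys_map /=.
by rewrite addKn.
Qed.

Lemma level_class_eq0 n v : level_class n v = 0 -> exists m, A^T ^+ m *m v = 0.
Proof. by move=> /to_dirlim_eq0[k [nk e]]; exists (k - n)%N. Qed.

Lemma level_map_exists : exists alpha : {additive L -> H}, forall n v,
  represents (jump (induce n (letter_fun v))) (alpha (level_class n v)).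
Proof.
pose rel (u : L) xi := exists (n : nat) (v : 'cV[int]_d), u = level_class n v /\
  represents (jump (induce n (letter_fun v))) xi.
have up xi n (v : 'cV[int]_d) m : represents (jump (induce n (letter_fun v))) xi ->
    represents (jump (induce (n + m) (letter_fun (A^T ^+ m *m v)))) xi.
  move=> h; have [xi' h'] := locconst_represents omega_gt0
    (locconst_induce prim aper (n + m) (locconst_letter phi (A^T ^+ m *m v))).
  by rewrite (jump_uniq (cohomologous_level prim aper n m v) h h').
have relB u xi u' xi' : rel u xi -> rel u' xi' -> rel (u - u') (xi - xi').
  move=> [n [v [-> h]]] [n' [v' [-> h']]].
  exists (n + n')%N, (A^T ^+ n' *m v - A^T ^+ n *m v'); split.
    by rewrite -to_dirlimB level_classD [in RHS]addnC level_classD.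
  have h2 := up _ _ _ n h'; rewrite addnC in h2.
  move: (jumpB (up _ _ _ n' h) h2); apply: jump_eq => x _; rewrite -induceB; congr (induce _ _ _).
  by apply/funext => y; rewrite /letter_fun !mxE.
have rel0 xi : rel 0 xi -> xi = 0.
  move=> [n [v [/esym/level_class_eq0[m e] /(up _ _ _ m)]]]; rewrite e => h.
  apply: jump_uniq h (coboundary_represents omega_gt0 (coboundary0 phi)).
  by apply: cohomologous_eq => x _; rewrite /induce /letter_fun mxE if_same.
have [|alpha halpha] := additive_of_relation relB _ rel0.
  move=> u; have [n [v ->]] := to_dirlimP u.
  have [xi h] := locconst_represents omega_gt0
    (locconst_induce prim aper n (locconst_letter phi v)).
  by exists xi, n, v.
exists alpha => n v; have [xi h] := locconst_represents omega_gt0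
    (locconst_induce prim aper n (locconst_letter phi v)).
suff -> : alpha (level_class n v) = xi by [].
apply/eqP; rewrite -subr_eq0; apply/eqP/rel0; rewrite -(subrr (level_class n v)).
by apply: relB => //; exists n, v.
Qed.

Variable M : nat.
Hypotheses (M_gt0 : (0 < M)%N) (stable : stable_level phi M).

Lemma range_map_exists : exists beta : {additive H -> ER_H1 phi}, forall f r xi,
  represents (jump f) xi -> radius phi f r -> beta xi = graph_class phi (window_sum phi M f r).
Proof.
pose rel xi eta := exists f r, [/\ represents (jump f) xi, radius phi f r &
  eta = graph_class phi (window_sum phi M f r)].
have up f r r' : radius phi f r -> (r <= r')%N ->
    graph_class phi (window_sum phi M f r') = graph_class phi (window_sum phi M f r) :> ER_H1 phi.
  move=> hr rr; apply/eqP; rewrite -subr_eq0 graph_classB; apply/eqP/graph_class_eq0.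
  exact: window_sum_radius.
have relB xi u xi' u' : rel xi u -> rel xi' u' -> rel (xi - xi') (u - u').
  move=> [f [r [h hr ->]]] [f' [r' [h' hr' ->]]].
  exists (fun x => f x - f' x), (maxn r r'); split; first exact: jumpB.
    move=> x x' hx hx' ag; congr (_ - _).
      exact: (radius_le (leq_maxl r r') hr).
    exact: (radius_le (leq_maxr r r') hr').
  rewrite -(up f r (maxn r r')) ?leq_maxl // -(up f' r' (maxn r r')) ?leq_maxr //.
  rewrite graph_classB; congr graph_class; apply/funext => e.
  by rewrite -sumrB.
have rel0 eta : rel 0 eta -> eta = 0.
  move=> [f [r [h hr ->]]]; apply/graph_class_eq0; apply: window_sum_coboundary => //.
  exact: represents_coboundary h.
have [|beta hbeta] := additive_of_relation relB _ rel0.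
  move=> xi; have [f [r hr] h] := represents_surjective omega_gt0 xi.
  by exists (graph_class phi (window_sum phi M f r)), f, r.
exists beta => f r xi h hr.
apply/eqP; rewrite -subr_eq0; apply/eqP/rel0; rewrite -(subrr xi).
by apply: relB => //; exists f, r.
Qed.

Lemma sequence_exact (alpha : {additive L -> H}) (beta : {additive H -> ER_H1 phi}) :
  (forall n v, represents (jump (induce n (letter_fun v))) (alpha (level_class n v))) ->
  (forall f r xi, represents (jump f) xi -> radius phi f r ->
    beta xi = graph_class phi (window_sum phi M f r)) ->
  (forall eta, exists xi, beta xi = eta) /\
  (forall xi, beta xi = 0 <-> exists u, alpha u = xi).
Proof.
move=> ha hb; split=> [eta|xi].
  have [c ->] := graph_classP eta.
  have [f [r [lf hr pf]]] := window_sum_surjective prim aper M_gt0 stable c.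
  have [xi h] := locconst_represents omega_gt0 lf; exists xi.
  by rewrite (hb _ _ _ h hr); apply/eqP; rewrite -subr_eq0 graph_classB; apply/eqP/graph_class_eq0.
split=> [e|[u <-]].
  have [f [r hr] h] := represents_surjective omega_gt0 xi.
  move: e; rewrite (hb _ _ _ h hr) => /graph_class_eq0 pf.
  have [j _ [v hv]] := window_sum_kernel prim aper M_gt0 stable hr pf.
  by exists (level_class (j * M) v); apply: (jump_uniq (cohomologous_sym hv)) (ha _ _) h.
have [n [v ->]] := to_dirlimP u.
have nM : (n <= n * M)%N by rewrite leq_pmulr.
rewrite -(level_classD n (n * M - n)) subnKC //.
have [r hr] := locconst_induce prim aper (n * M) (locconst_letter phi (A^T ^+ (n * M - n) *m v)).
rewrite (hb _ _ _ (ha _ _) hr); apply/graph_class_eq0.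
exact: window_sum_letter.
Qed.

(** An element of [G] is given by a function [h] on the components up to a constant; its coordinates
    are the differences of [h] with its value on the first component. *)
Lemma kernel_free (alpha : {additive L -> H}) (G : zmodClosed L) :
  (forall n v, represents (jump (induce n (letter_fun v))) (alpha (level_class n v))) ->
  (forall u, (u \in G) = (alpha u == 0)) ->
  zmod_iso (subgroup G) 'rV[int]_(ER_components phi - 1).
Proof.
move=> ha GE; have [rt [rtV rtC rtE]] := component_representatives phi.
have : (0 < ER_components phi)%N.
  have [y hy] := biallowed_exists aper.
  have he := ER_edges_biallowed prim aper M_gt0 stable hy.
  by have [i _] := rtC _ (ER_vertex_edge he); apply: leq_ltn_trans (ltn_ord i).
move: (ER_components phi) rt rtV rtC rtE => [//|k] rt rtV rtC rtE _; rewrite subn1 /=.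
pose vd := vertex_difference phi M.
have vdB h h' : vd (fun w => h w - h' w) = vd h - vd h'.
  by apply/colP => a; rewrite !mxE; ring.
have vd_iter h j : edge_constant phi h -> A^T ^+ (j * M) *m vd h = vd h.
  exact: vertex_difference_fixed.
(* These vectors are fixed by [A^T ^+ M], so a nonzero one cannot vanish later in the direct
   system. *)
have vd_fixed h m : edge_constant phi h -> A^T ^+ m *m vd h = 0 -> vd h = 0.
  move=> hc e; rewrite -(vd_iter _ m hc).
  rewrite -(subnK (leq_pmulr m M_gt0)) exprD -mulmxE -mulmxA [_ ^+ m *m _]e.
  by rewrite mulmx0.
have vd_class h j : edge_constant phi h -> (0 < j)%N ->
    level_class (j * M) (vd h) = level_class M (vd h).
  case: j => // j hc _; rewrite mulSn -{1}(vd_iter _ j hc).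
  exact: level_classD.
have edge_ends c h e : edge_constant phi h -> (forall i, h (rt i) = c) -> ER_edges phi e ->
    h (inl e.1) = c /\ h (inr e.2) = c.
  move=> hc hrt he; rewrite -(hc _ he); have [i hi] := rtC _ (ER_vertex_edge he).
  by rewrite (edge_constant_connect hc hi) hrt.
pose rel (u : subgroup G) (rho : 'rV[int]_k) := exists2 h, edge_constant phi h &
  val u = level_class M (vd h) /\ forall i, rho 0 i = h (rt (lift ord0 i)) - h (rt ord0).
apply: (@zmod_iso_of_relation _ _ rel).
- move=> u rho u' rho' [h hc [hu hr]] [h' hc' [hu' hr']].
  exists (fun w => h w - h' w) => [e he|]; first by rewrite hc // hc'.
  split; first by rewrite vdB -to_dirlimB -hu -hu'.
  by move=> i; rewrite !mxE hr hr'; ring.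
- move=> u; have : alpha (val u) = 0 by apply/eqP; rewrite -GE; exact: valP u.
  have [n [v eu]] := to_dirlimP (val u); rewrite eu => e.
  have := ha n v; rewrite e => /(represents_coboundary omega_gt0).
  move=> /(coboundary_letter prim aper M_gt0 stable)[m [j [h [nm j0 hc hv]]]].
  exists (\row_i (h (rt (lift ord0 i)) - h (rt ord0))), h => //; split; last by move=> i; rewrite mxE.
  by rewrite eu -(level_classD n m) nm hv vd_class.
- move=> rho [h hc [/esym/level_class_eq0[m /(vd_fixed _ _ hc) e] hr]].
  have [c hcst] := vertex_difference_eq0 prim aper M_gt0 stable hc e.
  have rtc i : h (rt i) = c.
    have /existsP[e' /orP[/eqP ->|/eqP ->]] := rtV i; last exact/hcst/ER_edge_val.
    by rewrite (hc _ (ER_edge_val e')); exact/hcst/ER_edge_val.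
  by apply/rowP => i; rewrite hr !rtc subrr mxE.
- move=> rho; have [h hc hr] := rtE (fun i => if unlift ord0 i is Some j then rho 0 j else 0).
  have uG : level_class M (vd h) \in G.
    rewrite GE; apply/eqP.
    have c0 := vertex_difference_coboundary prim aper M_gt0 stable M hc.
    apply: jump_uniq (ha _ _) (coboundary_represents omega_gt0 c0).
    exact: cohomologous_refl.
  exists (exist (fun u : L => u \in G) _ uG), h => //; split=> // i.
  by rewrite !hr liftK unlift_none subr0.
- move=> u [h hc [hu hr]]; apply: val_inj; rewrite hu.
  have rtc i : h (rt i) = h (rt ord0).
    case: (unliftP ord0 i) => [j ->|-> //].
    by apply/eqP; rewrite -subr_eq0 -hr mxE.
  suff -> : vd h = 0 by exact: (@to_dirlim0 (mxsys A^T) M).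
  apply/colP => a; rewrite !mxE; have [y hy ya] := letter_exists prim aper a.
  have [_] := edge_ends _ _ _ hc rtc (ER_edges_biallowed prim aper M_gt0 stable hy).
  have [+ _] := edge_ends _ _ _ hc rtc
    (ER_edges_biallowed prim aper M_gt0 stable (biallowed_shift 1 hy)).
  by rewrite /shift addNr add0r /= ya => -> ->; rewrite subrr.
Qed.

End Assembly.

Theorem theorem4 (R : realType) (d : nat) (phi : substitution d)
    (lam : R) (omega : 'rV[R]_d) (k l : nat) :
  primitive phi ->
  aperiodic phi ->
  let A := transition_mx phi in
  let AR : 'M[R]_d := map_mx intr A in
  perron_eigenvalue AR lam ->
  (forall a, 0 < omega ord0 a) ->
  omega *m AR = lam *: omega ->
  k = ER_components phi ->
  has_rank (ER_H1 phi) l ->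
  exists G : zmodClosed (matrix_limit A^T),
    zmod_iso (subgroup G) 'rV[int]_(k - 1) /\
    zmod_iso (cech_H1 (tiling_space phi omega))
             ('rV[int]_l * quotient G)%type.
Proof.
move=> prim aper A AR _ omega_gt0 _ -> rank.
have [M M_gt0 stable] := stable_level_exists prim aper.
have [alpha ha] := level_map_exists prim aper omega_gt0.
have [beta hb] := range_map_exists prim aper omega_gt0 M_gt0 stable.
have [surj exact] := sequence_exact prim aper omega_gt0 M_gt0 stable ha hb.
have [G GE] := kernel_zmodClosed alpha; exists G; split.
  exact: (kernel_free prim aper omega_gt0 M_gt0 stable ha GE).
exact: split_extension GE surj exact (graph_H1_free rank).
Qed.
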